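(* Let $\mathbf{k}$ be an algebraically closed field of characteristic $p>0$, and let $(X,\Delta_\epsilon)$ be a non-klt Campana toric surface orbifold over $\mathbf{k}$. If every ray of the fan of $X$ has a non-adjacent cone (that is, there is a two-dimensional cone of the fan not containing that ray) which is either smooth or tamely singular, then $(X,\Delta_\epsilon)$ is separably Campana rationally connected.
   Context: Toric setting. $X$ is a projective toric surface over $\mathbf{k}$, with character lattice $M$, dual lattice $N\cong\mathbb{Z}^2$, and fan $\Sigma$ in $N_{\mathbb{R}}$. Let $\rho_1,\dots,\rho_n$ be the rays of $\Sigma$, $u_i\in N$ the primitive generator of $\rho_i$, $\Delta_i$ the torus-invariant prime divisor of $\rho_i$, and $\Delta=\sum_i\Delta_i$ the toric boundary. $X$ is endowed with the divisorial log structure induced by $\Delta$ (the sheaf of regular functions invertible on $X\setminus\Delta$). Singularities of cones. A two-dimensional cone is smooth if its two primitive ray generators form a $\mathbb{Z}$-basis of $N$. A non-smooth two-dimensional cone corresponds to a quotient singularity of type $\frac{1}{m}(1,a)$ (locally $\mathbb{A}^2/\mu_m$ with $\mu_m$ acting diagonally with weights $(1,a)$); it is wildly singular if $p\mid m$ and tamely singular otherwise. Equivalently, for a non-smooth cone with primitive generators $u,u'$: it is wildly singular if $p\mid\det(u,u')$ and tamely singular if $p\nmid\det(u,u')$. Campana toric orbifold. To each $\Delta_i$ assign $m_i\in\mathbb{Z}_{\geq 1}\cup\{\infty\}$ and the weight $\epsilon_i=1-\frac{1}{m_i}$ (so $\epsilon_i=1$ if $m_i=\infty$); put $\Delta_\epsilon=\sum_i\epsilon_i\Delta_i$.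 The pair $(X,\Delta_\epsilon)$ is a Campana toric (surface) orbifold. It is klt if $\epsilon_i\neq 1$ for all $i$, and non-klt otherwise. Log maps and contact orders. A genus zero non-degenerate stable log map to $X$ is a morphism $f:\mathbb{P}^1\to X$ with distinct marked points $p_1,\dots,p_r\in\mathbb{P}^1$, stable in the usual sense as a pointed map, with $f(\mathbb{P}^1)\not\subset\Delta$ and $f^{-1}(\Delta)\subset\{p_1,\dots,p_r\}$ (it is a log morphism when $\mathbb{P}^1$ carries the divisorial log structure of the marked points). Its contact order at $p_k$ is the element $c_k\in N$ such that for all $m\in M$ the rational function $f^*\chi^m$ has order $\langle m,c_k\rangle$ at $p_k$; if $f(p_k)$ lies in the torus orbit of the cone $\tau\in\Sigma$, then $c_k\in N\cap\tau$. Write $c_k=\sum_i c_{k,i}u_i$ with $c_{k,i}\geq 0$ and only rays of the smallest cone containing $c_k$ occurring; $c_{k,i}$ is the multiplicity of $\Delta_i$ at the $k$-th marked point. A collection of contact orders $\varsigma=\{c_k\}$ is of Campana type if: (1) whenever $m_i<\infty$, every $k$ satisfies $c_{k,i}=0$ or $c_{k,i}\geq m_i$; (2) whenever $m_i=\infty$, there is at most one index $k$ with $c_{k,i}>0$. Separable Campana rational connectedness. $X$ is separably rationally $\varsigma$-connected if there is a family of genus zero non-degenerate stable log maps with contact orders $\varsigma$, $\pi:\mathcal{U}\to W$, $ev:\mathcal{U}\to X$, over a variety $W$, with underlying scheme of $\mathcal{U}$ equal to $W\times\mathbb{P}^1$ (with disjoint sections as markings), such that $ev^{(2)}:\mathcal{U}\times_W\mathcal{U}=W\times\mathbb{P}^1\times\mathbb{P}^1\to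 X\times X$ is dominant and separable. $(X,\Delta_\epsilon)$ is separably Campana rationally connected if there exists a collection $\varsigma$ of Campana type such that $X$ is separably rationally $\varsigma$-connected. *)

(* Defs.v *)
From HB Require Import structures.
From mathcomp Require Import all_boot all_order all_algebra.
From mathcomp Require Import separable mpoly.
From mathcomp Require Import boolp classical_sets functions topology.

Set Implicit Arguments.
Unset Strict Implicit.
Unset Printing Implicit Defensive.

Import Order.TTheory GRing.Theory Num.Theory.
Local Open Scope classical_set_scope.
Local Open Scope ring_scope.

(* Varieties over an algebraically closed field are treated classically, as    *)
(* spaces with functions: the set of closed points with its Zariski topology   *)
(* and the sheaf of regular k-valued functions.                                *)

(* [regular U f] only depends on the restriction of [f] to the open set [U].   *)
(* That regular functions form a k-algebra with local inverses is not part of  *)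
(* the record; it holds on a variety because it holds on affine charts.        *)
Record kspace (k : fieldType) := KSpace {
  kpoint :> topologicalType;
  regular : set kpoint -> set (kpoint -> k);
  regular_ext : forall U f g, (forall x, U x -> f x = g x) ->
    regular U f -> regular U g;
  regular_res : forall U V f, open U -> open V -> V `<=` U ->
    regular U f -> regular V f;
  regular_glue : forall U f, open U ->
    (forall x, U x -> exists V, [/\ open V, V x, V `<=` U & regular V f]) ->
    regular U f }.
Arguments regular {k} k0 U f : rename.

Definition morphism (k : fieldType) (X Y : kspace k) (phi : X -> Y) : Prop :=
  continuous phi /\
  forall (V : set Y) (f : Y -> k), open V -> regular Y V f ->
    regular X (phi @^-1` V) (f \o phi).

Definition open_immersion (k : fieldType) (X Y : kspace k) (phi : X -> Y) :
    Prop :=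
  [/\ injective phi,
      forall V : set X, open V <-> open (phi @` V) &
      forall (V : set X) (f : Y -> k), open V ->
        (regular Y (phi @` V) f <-> regular X V (f \o phi))].

(* Gluing data: a set covered by pieces [adom i], each with an algebra         *)
(* [afun i] of coordinate functions, whose values outside [adom i] are         *)
(* irrelevant. The glued space has the topology generated by the principal     *)
(* sets {a != 0} of the pieces, and its regular functions are locally          *)
(* quotients of coordinate functions.                                          *)
Record atlas (k : fieldType) := Atlas {
  apoint : Type;
  aindex : Type;
  adom : aindex -> set apoint;
  afun : aindex -> set (apoint -> k) }.

Definition glued (k : fieldType) (A : atlas k) : Type := apoint A.

Section Glued.
Variables (k : fieldType) (A : atlas k).

HB.instance Definition _ := gen_eqMixin (glued A).
HB.instance Definition _ := gen_choiceMixin (glued A).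

Definition principal : set (set (glued A)) :=
  [set O | exists (i : aindex A) (a : apoint A -> k),
     afun i a /\ O = [set x | adom i x /\ a x != 0]].

HB.instance Definition _ :=
  isSubBaseTopological.Build (glued A) principal (id : set (glued A) -> _).

Definition glued_regular (U : set (glued A)) (f : glued A -> k) : Prop :=
  forall x, U x -> exists (i : aindex A) (a b : apoint A -> k)
      (V : set (glued A)),
    [/\ afun i a, afun i b, open V, V x &
     forall y, V y -> [/\ U y, adom i y, b y != 0 & f y = a y / b y]].

Lemma glued_regular_ext U f g : (forall x, U x -> f x = g x) ->
  glued_regular U f -> glued_regular U g.
Proof.
move=> fg Uf x /Uf[i [a [b [V [ia ib oV Vx VP]]]]].
exists i, a, b, V; split=> // y /VP[Uy iy by0 fy].
by split=> //; rewrite -fg.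
Qed.

Lemma glued_regular_res U V f : open U -> open V -> V `<=` U ->
  glued_regular U f -> glued_regular V f.
Proof.
move=> oU oV VU Uf x Vx; have [i [a [b [W [ia ib oW Wx WP]]]]] := Uf x (VU x Vx).
exists i, a, b, (V `&` W); split=> //; first exact: openI.
by move=> y [Vy /WP[]].
Qed.

Lemma glued_regular_glue U f : open U ->
  (forall x, U x ->
     exists V, [/\ open V, V x, V `<=` U & glued_regular V f]) ->
  glued_regular U f.
Proof.
move=> oU Uf x /Uf[V [oV Vx VU Vf]].
have [i [a [b [W [ia ib oW Wx WP]]]]] := Vf x Vx.
exists i, a, b, W; split=> // y /WP[Vy iy by0 fy].
by split=> //; apply: VU.
Qed.

Definition glue : kspace k :=
  KSpace glued_regular_ext glued_regular_res glued_regular_glue.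

End Glued.

Definition affine_atlas (k : fieldType) (n : nat) (I : set {mpoly k[n]}) :
    atlas k :=
  @Atlas k {x : 'I_n -> k | forall P, I P -> P.@[x] = 0} unit
    (fun=> setT) (fun=> [set a | exists P : {mpoly k[n]},
                           a = fun x => P.@[sval x]]).

Definition affine_set (k : fieldType) (n : nat) (I : set {mpoly k[n]}) :
  kspace k := glue (affine_atlas I).

(* The projective line as k with a point [None] at infinity, covered by the    *)
(* affine lines with coordinates t and 1 / t.                                  *)
Definition P1_coord (k : fieldType) (b : bool) (z : option k) : k :=
  if z is Some t then (if b then t^-1 else t) else 0.

Definition P1_atlas (k : fieldType) : atlas k :=
  @Atlas k (option k) bool
    (fun b => [set z | z <> if b then Some 0 else None])
    (fun b => [set a | exists P : {poly k}, a = fun z => P.[P1_coord b z]]).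

Definition P1 (k : fieldType) : kspace k := glue (P1_atlas k).

(* Product of varieties, with the Zariski topology (not the product topology): *)
(* on U x V the coordinate functions are the finite sums of f(x) g(y).         *)
Definition prod_atlas (k : fieldType) (X Y : kspace k) : atlas k :=
  @Atlas k (X * Y)%type (set X * set Y)%type
    (fun UV => [set z | [/\ open UV.1, open UV.2, UV.1 z.1 & UV.2 z.2]])
    (fun UV => [set a | exists (N : nat) (f : 'I_N -> X -> k) (g : 'I_N -> Y -> k),
       (forall i, regular X UV.1 (f i) /\ regular Y UV.2 (g i)) /\
       a = fun z => \sum_i f i z.1 * g i z.2]).

Definition kprod (k : fieldType) (X Y : kspace k) : kspace k :=
  glue (prod_atlas X Y).

Definition irreducible_space (k : fieldType) (X : kspace k) : Prop :=
  [set: X] !=set0 /\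
  forall U V : set X, open U -> open V -> U !=set0 -> V !=set0 ->
    U `&` V !=set0.

Definition separated_space (k : fieldType) (X : kspace k) : Prop :=
  closed [set z : kprod X X | z.1 = z.2].

Definition affine_cover (k : fieldType) (X : kspace k) : Prop :=
  exists (N : nat) (n : 'I_N -> nat) (I : forall j, set {mpoly k[n j]})
    (phi : forall j, affine_set (I j) -> X),
    (forall j, open_immersion (phi j)) /\
    forall x : X, exists j, range (phi j) x.

Definition is_variety (k : fieldType) (X : kspace k) : Prop :=
  [/\ irreducible_space X, separated_space X & affine_cover X].

(* [K] is the colimit of the rings of regular functions on the nonempty open   *)
(* subsets of [X], with canonical maps [germ U].                               *)
Definition is_function_field (k : fieldType) (X : kspace k) (K : fieldType)
    (germ : set X -> (X -> k) -> K) : Prop :=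
  [/\ forall U f g, open U -> U !=set0 -> regular X U f -> regular X U g ->
        germ U (fun x => f x + g x) = germ U f + germ U g /\
        germ U (fun x => f x * g x) = germ U f * germ U g,
      forall U, open U -> U !=set0 -> germ U (fun=> 1) = 1,
      forall U V f g, open U -> U !=set0 -> open V -> V !=set0 ->
        regular X U f -> regular X V g ->
        (germ U f = germ V g <->
         exists W, [/\ open W, W !=set0, W `<=` U `&` V &
           forall x, W x -> f x = g x]) &
      forall a : K, exists U f,
        [/\ open U, U !=set0, regular X U f & germ U f = a]].

(* [separably_generated iota]: there is a transcendence basis [b] of L / K     *)
(* such that L is separable algebraic over K(b). For function fields, which    *)
(* are finitely generated, this is separability of the extension.              *)
Definition in_adjoin (K L : fieldType) (iota : K -> L) (d : nat)
    (b : 'I_d -> L) (x : L) : Prop :=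
  exists P Q : {mpoly K[d]},
    mmap iota b Q != 0 /\ x = mmap iota b P / mmap iota b Q.

Definition separably_generated (K L : fieldType) (iota : {rmorphism K -> L}) :
    Prop :=
  exists (d : nat) (b : 'I_d -> L),
    (forall P : {mpoly K[d]}, mmap iota b P = 0 -> P = 0) /\
    forall x : L, exists P : {poly L},
      [/\ forall j, in_adjoin iota b P`_j, separable_poly P & root P x].

Definition dominant (k : fieldType) (X Y : kspace k) (phi : X -> Y) : Prop :=
  dense (range phi).

(* For dominant [phi]: the pull-back K(Y) -> K(X) is a separable extension.    *)
Definition separable_morphism (k : fieldType) (X Y : kspace k) (phi : X -> Y) : Prop :=
  exists (K L : fieldType) (germY : set Y -> (Y -> k) -> K)
    (germX : set X -> (X -> k) -> L) (iota : {rmorphism K -> L}),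
    [/\ is_function_field germY, is_function_field germX,
        forall V f, open V -> V !=set0 -> regular Y V f ->
          iota (germY V f) = germX (phi @^-1` V) (f \o phi) &
        separably_generated iota].

(* M and N are both identified with Z^2, in duality through the dot product.   *)
Notation lattice := 'rV[int]_2 (only parsing).

Definition pairing (m v : lattice) : int := \sum_(j < 2) m 0 j * v 0 j.

Definition vecQ (v : lattice) : 'rV[rat]_2 := map_mx intr v.

(* Rational cones are determined by their points in N_Q, so N_Q replaces N_R.  *)
Definition cone (n : nat) (u : 'I_n -> lattice) (s : {set 'I_n}) :
    set 'rV[rat]_2 :=
  [set x | exists a : 'I_n -> rat, (forall i, i \in s -> 0 <= a i) /\
     x = \sum_(i in s) a i *: vecQ (u i)].

(* A fan in the plane, whose cones are given by their sets of rays; strongly   *)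
(* convex cones of dimension at most 2 are simplicial, hence [fan_free].       *)
Record fan (n : nat) := Fan {
  gen : 'I_n -> lattice;
  cones : {set {set 'I_n}};
  gen_primitive : forall i, coprimez (gen i 0 0) (gen i 0 1);
  fan_ray : forall i, [set i]%SET \in cones;
  fan_face : forall s t : {set 'I_n}, s \in cones -> t \subset s -> t \in cones;
  fan_free : forall s, s \in cones -> forall a : 'I_n -> rat,
    \sum_(i in s) a i *: vecQ (gen i) = 0 -> forall i, i \in s -> a i = 0;
  fan_inter : forall s t, s \in cones -> t \in cones ->
    cone gen s `&` cone gen t = cone gen (s :&: t) }.

(* A toric surface is projective if and only if its fan is complete.           *)
Definition complete_fan (n : nat) (F : fan n) : Prop :=
  forall x : 'rV[rat]_2, exists2 s, s \in cones F & cone (gen F) s x.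

Definition det2 (u v : lattice) : int := \det (col_mx u v : 'M[int]_(1 + 1)).

Definition smooth_pair (u v : lattice) : bool :=
  (col_mx u v : 'M[int]_(1 + 1)) \in unitmx.

Definition tame_pair (p : nat) (u v : lattice) : bool :=
  ~~ smooth_pair u v && ~~ (p%:Z %| det2 u v)%Z.

Section Toric.
Variables (k : fieldType) (n : nat) (F : fan n).

Definition perp (s : {set 'I_n}) (m : lattice) : bool :=
  [forall i in s, pairing m (gen F i) == 0].

Definition dual (s : {set 'I_n}) (m : lattice) : bool :=
  [forall i in s, 0 <= pairing m (gen F i)].

(* A point of the orbit of the cone [s] is a homomorphism from the lattice     *)
(* [perp s] to k^*, here extended by zero to M. On the affine chart of a cone  *)
(* containing [s], it takes the value [x.2 m] at the character [m].            *)
Definition toric_point : Type :=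
  {x : {set 'I_n} * (lattice -> k) |
    [/\ x.1 \in cones F,
        forall m, (x.2 m != 0) = perp x.1 m,
        x.2 0 = 1 &
        forall m m', perp x.1 m -> perp x.1 m' ->
          x.2 (m + m') = x.2 m * x.2 m']}.

Definition orbit_cone (x : toric_point) : {set 'I_n} := (sval x).1.
Definition chi (m : lattice) (x : toric_point) : k := (sval x).2 m.

Definition toric_atlas : atlas k :=
  @Atlas k toric_point {set 'I_n}
    (fun s => [set x | s \in cones F /\ orbit_cone x \subset s])
    (fun s => [set a | exists (N : nat) (c : 'I_N -> k) (m : 'I_N -> lattice),
       (forall i, dual s (m i)) /\ a = fun x => \sum_i c i * chi (m i) x]).

Definition toric : kspace k := glue toric_atlas.

Definition Delta (i : 'I_n) : set toric := [set x | i \in orbit_cone x].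
Definition boundary : set toric := \bigcup_(i in [set: 'I_n]) Delta i.

End Toric.
Arguments Delta k {n} F i : rename.
Arguments boundary k {n} F : rename.

(* Local coordinate of P^1 at [q] (a uniformizer, up to shrinking).            *)
Definition uniformizer (k : fieldType) (q z : option k) : k :=
  if z is Some t then (if q is Some a then t - a else t^-1) else 0.

(* The rational function [g] has order [e] at [q].                             *)
Definition order_at (k : fieldType) (g : P1 k -> k) (q : P1 k) (e : int) :
    Prop :=
  exists (V : set (P1 k)) (h : P1 k -> k),
    [/\ open V, V q, regular (P1 k) V h, h q != 0 &
     forall z, V z -> z <> q -> g z = uniformizer q z ^ e * h z].

Definition has_contact_order (k : fieldType) (n : nat) (F : fan n)
    (f : P1 k -> toric k F) (q : P1 k) (c : lattice) : Prop :=
  forall m : lattice, order_at (fun z => chi m (f z)) q (pairing m c).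

Definition is_log_map (k : fieldType) (n : nat) (F : fan n) (r : nat)
    (c : 'I_r -> lattice) (f : P1 k -> toric k F) (q : 'I_r -> P1 k) : Prop :=
  [/\ morphism f,
      injective q /\ ((exists z w, f z <> f w) \/ (3 <= r)%N),
      ~ (range f `<=` boundary k F),
      f @^-1` boundary k F `<=` range q &
      forall j, has_contact_order f (q j) (c j)].

Record log_family (k : fieldType) (n : nat) (F : fan n) (r : nat)
    (c : 'I_r -> lattice) := LogFamily {
  base : kspace k;
  base_variety : is_variety base;
  mark : 'I_r -> base -> P1 k;
  mark_morphism : forall j, morphism (mark j);
  mark_disjoint : forall i j w, i != j -> mark i w <> mark j w;
  ev : kprod base (P1 k) -> toric k F;
  ev_morphism : morphism ev;
  ev_log : forall w, is_log_map c (fun z => ev (w, z)) (fun j => mark j w) }.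
Arguments ev {k n F r c} fam x : rename.
Arguments mark {k n F r c} fam j w : rename.

Definition ev2 (k : fieldType) (n : nat) (F : fan n) (r : nat)
    (c : 'I_r -> lattice) (fam : log_family k F c) :
    kprod (kprod (base fam) (P1 k)) (P1 k) -> kprod (toric k F) (toric k F) :=
  fun x => (ev fam (x.1.1, x.1.2), ev fam (x.1.1, x.2)).
Arguments ev2 {k n F r c} fam x : rename.

Definition separably_rationally_connected (k : fieldType) (n : nat)
    (F : fan n) (r : nat) (c : 'I_r -> lattice) : Prop :=
  exists fam : log_family k F c, dominant (ev2 fam) /\ separable_morphism (ev2 fam).

(* [None] stands for the multiplicity infinity.                                *)
Definition weight (m : option nat) : rat :=
  if m is Some e then 1 - e%:R^-1 else 1.

Definition klt (n : nat) (m : 'I_n -> option nat) : Prop :=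
  forall i, weight (m i) != 1.

(* [a i] is the multiplicity of the i-th boundary divisor at a marked point    *)
(* with contact order [c]; on singular cones it may be a proper fraction.      *)
Definition multiplicities (n : nat) (F : fan n) (c : lattice)
    (a : 'I_n -> rat) : Prop :=
  exists s : {set 'I_n},
    [/\ s \in cones F /\ cone (gen F) s (vecQ c),
        forall t, t \in cones F -> cone (gen F) t (vecQ c) -> s \subset t,
        forall i, 0 <= a i,
        forall i, i \notin s -> a i = 0 &
        vecQ c = \sum_i a i *: vecQ (gen F i)].

Definition campana_type (n : nat) (F : fan n) (m : 'I_n -> option nat)
    (r : nat) (c : 'I_r -> lattice) : Prop :=
  exists a : 'I_r -> 'I_n -> rat,
    [/\ forall j, multiplicities F (c j) (a j),
        forall i e, m i = Some e -> forall j, a j i = 0 \/ e%:R <= a j i &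
        forall i, m i = None ->
          forall j l, 0 < a j i -> 0 < a l i -> j = l].

Definition separably_campana_rationally_connected (k : fieldType) (n : nat)
    (F : fan n) (m : 'I_n -> option nat) : Prop :=
  exists (r : nat) (c : 'I_r -> lattice),
    campana_type F m c /\ separably_rationally_connected k F c.

(* Main.v *)
(* Contact orders c0, c1, c2 with c0 + c1 + c2 = 0 at the points 0, 1, oo      *)
(* define the curves z |-> w z^c0 (z - 1)^c1, for w in the torus W. Because w   *)
(* is arbitrary, evaluation at two points z1, z2 is dominant and separable as   *)
(* soon as (z1, z2) |-> al^c0 be^c1 is, where al = z1 / z2 and                  *)
(* be = (z1 - 1) / (z2 - 1). The pair (al, be) is birational to (z1, z2), and   *)
(* (al, be) |-> al^c0 be^c1 is an isogeny of tori of degree |det(c0, c1)|; so   *)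
(* al and be are D-th roots of functions on the target, D = |det(c0, c1)|, and  *)
(* everything is separable when p does not divide D.                            *)
(* To find the contact orders, take a cone {j, l} with p not dividing           *)
(* det(u_j, u_l), and c0 = N a u_j, c1 = N b u_l with N, a, b prime to p. They  *)
(* are of Campana type, for N large, if - (a u_j + b u_l) lies in the relative  *)
(* interior of a cone that contains neither u_j nor u_l. If no such a, b        *)
(* existed, the fan would consist of three rays, all of whose determinants are  *)
(* prime to p by hypothesis, and the linear relation between the rays would     *)
(* provide a and b after all.                                                   *)

From HB Require Import structures.
From mathcomp Require Import all_boot all_order all_algebra.
From mathcomp Require Import all_field mpoly finmap generic_quotient.
From mathcomp Require Import boolp classical_sets functions topology.
From mathcomp Require Import ring lra zify.
Require Import Defs.

Set Implicit Arguments.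
Unset Strict Implicit.
Unset Printing Implicit Defensive.

Import Order.TTheory GRing.Theory Num.Theory.
Local Open Scope classical_set_scope.
Local Open Scope ring_scope.

(** * Separable extensions *)

(** Write [u_i] for the generator of the ray [i]. If three contact orders satisfy
    [c 0 + c 1 + c ord_max = 0], the curve t -> t^c0 (t - 1)^c1 in the open torus extends to a log
    map on P^1 with these contact orders at 0, 1 and infinity, and translating it by w in the torus
    gives a family over a two-dimensional base ([torus_family]). What remains is to make it of
    Campana type and its evaluation at two points dominant and separable. Both follow once the [c i]
    lie in the relative interiors of cones without common rays, p does not divide D = det(c0, c1),
    and the [c i] are scaled enough.

    Evaluation. The quotient of the values at z1 and z2 is al^c0 be^c1 with al = z1 / z2 and be =
    (z1 - 1) / (z2 - 1), whatever w is, while w moves the value at z2 freely. Up to birational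
    changes of coordinates, the evaluation is therefore the isogeny (al, be) -> al^c0 be^c1, times
    an identity. It is surjective on tori because the field is algebraically closed
    ([solve_characters]), which gives density of the image ([ev_pair_generic], [ev_pair_dominant]).
    Pairing with the rows of the adjugate of (c0, c1) shows that al^|D| and be^|D| are pulled back
    from the target, so al and be are Kummer elements of degree prime to p ([kummer_root]). They
    generate the function field of the source over that of the target ([source_field_generated]),
    and a field generated by separable elements is separable ([separable_generated]).

    Contact orders. Smooth or tame means that p does not divide the determinant. For such a cone {j,
    l} and a, b prime to p, the candidates are a u_j, b u_l and -(a u_j + b u_l); they fail only if
    the third vector lies in a cone through j or l. The ratios a / b with a, b prime to p are dense
    ([prime_to_between]), so if they all fail, a single ray i opposite to {j, l} is adjacent to both
    j and l ([not_balanced_common_adjacent]), and the fan has just the rays j, l, i ([three_rays]).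
    The hypothesis applied to the rays j and l then says that the determinants of {i, l} and {i, j}
    are prime to p, and they are the coefficients of the linear relation between the three
    generators: a valid choice of a and b after all ([balanced_exists]). Scaling by a large N
    congruent to 1 modulo p gives Campana type ([campana_scaling]).

    The geometry is handled through [generic_chart]: a dense open set with a ring of functions whose
    fractions form the function field. Dominance and separability then reduce to statements about
    Laurent polynomials on tori. *)

Lemma minimal_annihilator (K L : fieldType) (iota : {rmorphism K -> L}) (z : L) :
  algebraicOver iota z ->
  exists2 p : {poly K}, root (map_poly iota p) z & irreducible_poly p.
Proof.
move=> [p0 p0_neq0 p0z].
pose Q := fun n => `[< exists p, [/\ p != 0, root (map_poly iota p) z & size p = n] >].
have exQ : exists n, Q n by exists (size p0); apply/asboolP; exists p0.
case: (ex_minnP exQ) => m /asboolP[p [p_neq0 pz sz_p]] m_min.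
exists p => //; apply/(subfx_irreducibleP pz p_neq0) => q qz q_neq0.
by rewrite sz_p; apply: m_min; apply/asboolP; exists q.
Qed.

(* The primitive element theorem embeds the field generated by [alpha] and     *)
(* [beta] in a finite extension, to which the theory of separable extensions   *)
(* applies.                                                                    *)
Lemma separable_generated (K L : fieldType) (iota : {rmorphism K -> L})
    (alpha beta : L) (qa qb : {poly K}) :
  root (map_poly iota qa) alpha -> separable_poly qa ->
  root (map_poly iota qb) beta -> separable_poly qb ->
  (forall r : {poly L}, r != 0 -> exists t : K, ~~ root r (iota t)) ->
  forall x : L,
  (forall S : L -> Prop, (forall c, S (iota c)) -> S alpha -> S beta ->
     (forall u v, S u -> S v -> S (u + v)) ->
     (forall u v, S u -> S v -> S (u * v)) ->
     (forall u, S u -> S u^-1) -> S x) ->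
  exists P : {poly K}, separable_poly P /\ root (map_poly iota P) x.
Proof.
move=> qa0 sep_qa qb0 sep_qb infK x genx.
have qa_neq0 := separable_poly_neq0 sep_qa.
have [r r_neq0 PETr] := large_field_PET qa_neq0 qa0 qb0 sep_qb.
(* A [t] off the roots of [r] makes [z = t beta - alpha] a primitive element: [alpha] and [beta] are
   polynomials in [z]. *)
have [t /PETr /=] := infK r r_neq0; set z := iota t * beta - alpha.
move=> [[fa fa_z] [fb fb_z]].
have z_alg : algebraicOver iota z.
  apply: algebraic_sub; last by exists qa.
  by apply: algebraic_mul; [apply: algebraic_id | exists qb => //; apply: separable_poly_neq0].
have [p pz p_irr] := minimal_annihilator z_alg.
(* An abstract copy of K(z), of finite dimension over [K], which [kappa] embeds in [L]. *)
pose Fz : fieldExtType K := SubFieldExtType pz p_irr.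
have p_neq0 := irredp_neq0 p_irr.
pose kappa : {rmorphism Fz -> L} := @subfx_inj K L iota z p.
have kappaZ b (y : Fz) : kappa (b *: y) = iota b * kappa y by apply: subfx_injZ.
have kappaA b : kappa (b%:A) = iota b by rewrite kappaZ rmorph1 mulr1.
have kappa_poly q : map_poly kappa (map_poly (in_alg Fz) q) = map_poly iota q.
  by rewrite -map_poly_comp; apply: eq_map_poly => b /=; rewrite kappaA.
have liftz q : exists y : Fz, kappa y = (map_poly iota q).[z].
  exists (subfx_eval iota z p q); exact: (subfx_inj_eval pz p_neq0 q).
have [a ka] := liftz fa; have [b kb] := liftz fb; rewrite fa_z in ka; rewrite fb_z in kb.
(* The range of [kappa] is a field containing the image of [iota], [alpha] and [beta], hence also
   [x]. *)
have [y ky] : exists y : Fz, kappa y = x.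
  apply: (genx (fun x => exists y : Fz, kappa y = x)).
  - by move=> c; exists c%:A.
  - by exists a.
  - by exists b.
  - by move=> _ _ [u <-] [v <-]; exists (u + v); rewrite rmorphD.
  - by move=> _ _ [u <-] [v <-]; exists (u * v); rewrite rmorphM.
  - by move=> _ [u <-]; exists u^-1; rewrite fmorphV.
have sep1 (q : {poly K}) (c : Fz) : root (map_poly iota q) (kappa c) -> separable_poly q ->
    separable_element 1%AS c.
  move=> qc sep_q; apply/separable_elementP; exists (map_poly (in_alg Fz) q).
  split; first by apply/polyOver1P; exists q.
    by rewrite -(fmorph_root kappa) kappa_poly.
  by rewrite separable_map.
have sep_ab : separable 1%AS <<1 & [:: a; b]>>.
  by apply: separable_Fadjoin_seq; rewrite /= (sep1 qa) ?ka // (sep1 qb) ?kb.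
(* [y] is a polynomial in the generator of [Fz], and this generator is [t b - a]. *)
have yab : y \in <<1 & [:: a; b]>>%VS.
  have [q Dy] := subfxEroot pz p_neq0 y.
  rewrite (Dy : y = (map_poly (in_alg Fz) q).[(subfx_root iota z p : Fz)]).
  apply: rpred_horner.
    apply/polyOverP=> i; rewrite coef_map /=.
    by apply: (subvP (subv_adjoin_seq 1 _)); rewrite rpredZ ?mem1v.
  have ->: (subfx_root iota z p : Fz) = t *: b - a.
    apply: (fmorph_inj kappa); rewrite rmorphB /= -/kappa kappaZ kb ka.
    exact: subfx_inj_root.
  rewrite rpredB ?rpredZ //; apply: seqv_sub_adjoin; by rewrite !inE eqxx ?orbT.
have /separable_elementP[f [/polyOver1P[P ->] Py sepP]] := separableP sep_ab y yab.
exists P; split; first by rewrite separable_map in sepP.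
by rewrite -ky -kappa_poly fmorph_root.
Qed.

(** * Fans in the plane *)

Section FanCombinatorics.
Variables (n : nat) (F : fan n).
Local Notation U i := (vecQ (gen F i)).
Implicit Types (i j l : 'I_n) (s t : {set 'I_n}).

Definition crossQ (x y : 'rV[rat]_2) : rat := x 0 0 * y 0 1 - x 0 1 * y 0 0.

Lemma row2P (T : Type) (x y : 'rV[T]_2) : x 0 0 = y 0 0 -> x 0 1 = y 0 1 -> x = y.
Proof.
move=> e0 e1; apply/rowP => -[[|[|k]] hk] //.
  by rewrite (_ : Ordinal hk = 0) //; apply: val_inj.
by rewrite (_ : Ordinal hk = 1) //; apply: val_inj.
Qed.

Lemma det2E (u v : 'rV[int]_2) : det2 u v = u 0 0 * v 0 1 - u 0 1 * v 0 0.
Proof.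
have top (k : 'I_2) : (col_mx u v : 'M_(1 + 1)) 0 k = u 0 k.
  by rewrite -(col_mxEu u v); congr (col_mx u v _ k); apply: val_inj.
have bot (k : 'I_2) : (col_mx u v : 'M_(1 + 1)) 1 k = v 0 k.
  by rewrite -(col_mxEd u v); congr (col_mx u v _ k); apply: val_inj.
rewrite -top -bot -top -bot /det2.
move: (col_mx u v) => A.
rewrite (expand_det_row _ 0) !big_ord_recl big_ord0 addr0 /cofactor !det_mx11 !mxE /=.
rewrite expr0 expr1 mul1r mulN1r mulrN.
congr (A _ _ * A _ _ - A _ _ * A _ _); exact: val_inj.
Qed.

Lemma crossQ_det2 (u v : 'rV[int]_2) : crossQ (vecQ u) (vecQ v) = (det2 u v)%:~R.
Proof. by rewrite det2E /crossQ !mxE rmorphB !rmorphM. Qed.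

(** The relative interior of the cone of [s]; by [support_cone_sub], [s] is then the smallest cone
    of the fan containing [x]. *)
Definition support_cone x s := exists2 al : 'I_n -> rat,
  s \in cones F /\ (forall i, i \in s -> 0 < al i) & x = \sum_(i in s) al i *: U i.

(** [fan_inter] writes [x] as a combination of rays of [s :&: t] as well; independence of the rays
    of [s] then forces the positive coefficients to sit there. *)
Lemma support_cone_sub x s t :
  support_cone x s -> t \in cones F -> cone (gen F) t x -> s \subset t.
Proof.
move=> [al [sF al_gt0] Dx] tF tx; apply/fintype.subsetP => i si; apply: contraT => ti.
have : (cone (gen F) s `&` cone (gen F) t) x.
  by split=> //; exists al; split=> // m /al_gt0/ltW.
rewrite fan_inter // => -[b [_ Dx']].
suff /(_ i si) : forall i, i \in s -> al i - (i \in t)%:R * b i = 0.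
  by rewrite (negPf ti) mul0r subr0 => ali0; have := al_gt0 i si; rewrite ali0 ltxx.
apply: (fan_free sF); under eq_bigr do rewrite scalerBl; rewrite sumrB -Dx Dx'.
apply/eqP; rewrite subr_eq0 (eq_bigl (fun i => (i \in s) && (i \in t))); last first.
  by move=> k; rewrite inE.
rewrite big_mkcondr /=; apply/eqP; apply: eq_bigr => k _.
by case: (k \in t); rewrite ?mul1r // mul0r scale0r.
Qed.

Lemma support_cone_in x s : support_cone x s -> s \in cones F /\ cone (gen F) s x.
Proof.
by move=> [al [sF al0] Dx]; split=> //; exists al; split=> // i /al0/ltW.
Qed.

Lemma support_cone_uniq x s t : support_cone x s -> support_cone x t -> s = t.
Proof.
move=> xs xt; have [sF sx] := support_cone_in xs; have [tF tx] := support_cone_in xt.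
by apply/eqP; rewrite finset.eqEsubset (support_cone_sub xs) // (support_cone_sub xt).
Qed.

Lemma support_cone_exists x : complete_fan F -> exists s, support_cone x s.
Proof.
move=> /(_ x)[s sF [a [a_ge0 Dx]]].
exists [set i in s | a i != 0]%SET, a.
  split; first by apply: fan_face sF _; apply/fintype.subsetP => i; rewrite inE => /andP[].
  by move=> i; rewrite inE => /andP[/a_ge0 ai0 ne0]; rewrite lt_def ne0.
rewrite Dx (bigID (fun i => a i != 0)) /= [X in _ + X]big1 ?addr0.
  by apply: eq_bigl => i; rewrite inE.
by move=> i /andP[_ /negPn/eqP->]; rewrite scale0r.
Qed.

Lemma support_cone1 c i : 0 < c -> support_cone (c *: U i) [set i]%SET.
Proof.
move=> c_gt0; exists (fun=> c); first by split=> //; exact: fan_ray.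
by rewrite big_set1.
Qed.

Lemma support_cone2 c d i j : i != j -> [set i; j]%SET \in cones F ->
  0 < c -> 0 < d -> support_cone (c *: U i + d *: U j) [set i; j]%SET.
Proof.
move=> ij ijF c0 d0; exists (fun k => if k == i then c else d).
  by split=> // k _; case: ifP.
by rewrite big_setU1 ?inE //= big_set1 eqxx eq_sym (negPf ij).
Qed.

Lemma cross_neq0 i j : i != j -> [set i; j]%SET \in cones F -> crossQ (U i) (U j) != 0.
Proof.
move=> ij ijF; apply/eqP => cr0.
have fr a b : a *: U i + b *: U j = 0 -> b = 0.
  move=> e; have := @fan_free _ F _ ijF (fun k => if k == i then a else b) _ j.
  rewrite big_setU1 ?inE //= big_set1 [j == i]eq_sym (negPf ij) !eqxx.
  exact.
have Ui0 : U i = 0.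
  apply: row2P; rewrite [in RHS]mxE.
    by apply: (fr (- U j 0 0)); apply: row2P; rewrite !mxE;
      move: cr0; rewrite /crossQ !mxE; lra.
  apply: (fr (- U j 0 1)); apply: row2P; rewrite !mxE;
      move: cr0; rewrite /crossQ !mxE; lra.
have := @fan_free _ F _ (fan_ray F i) (fun=> 1) _ i.
rewrite big_set1 Ui0 scaler0 inE eqxx => /(_ erefl isT)/eqP; by rewrite oner_eq0.
Qed.

Lemma cross_dependence (x y z : 'rV[rat]_2) :
  crossQ y z *: x + crossQ z x *: y + crossQ x y *: z = 0.
Proof. by apply: row2P; rewrite !mxE /crossQ; ring. Qed.

(** Three vectors of the plane satisfy [cross_dependence], whose last coefficient is nonzero if the
    first two are independent, against [fan_free]. *)
Lemma cone_card_le2 s i j l : s \in cones F -> i \in s -> j \in s -> l \in s ->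
  i != j -> i != l -> j != l -> False.
Proof.
move=> sF si sj sl ij il jl.
have sub3 : ([set i; j; l] \subset s)%SET by rewrite !finset.subUset !finset.sub1set si sj sl.
have sF3 : [set i; j; l]%SET \in cones F by apply: fan_face sF sub3.
have ijF : [set i; j]%SET \in cones F by apply: fan_face sF3 _; apply: finset.subsetUl.
have := cross_neq0 ij ijF.
pose a k := if k == i then crossQ (U j) (U l) else
  if k == j then crossQ (U l) (U i) else crossQ (U i) (U j).
have := @fan_free _ F _ sF3 a _ l.
rewrite finset.setUC big_setU1 ?inE ?negb_or ?[l == _]eq_sym ?il ?jl //=.
rewrite big_setU1 ?inE //= big_set1 /a !eqxx.
rewrite [l == _]eq_sym (negPf il) [l == j]eq_sym (negPf jl) [j == _]eq_sym (negPf ij).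
by rewrite addrC cross_dependence => ->.
Qed.

Lemma cross_expand (x y z : 'rV[rat]_2) : crossQ x y != 0 ->
  z = (crossQ z y / crossQ x y) *: x + (crossQ x z / crossQ x y) *: y.
Proof.
move=> ne0; apply: (scalerI ne0); rewrite scalerDr !scalerA.
rewrite ![_ * (_ / _)]mulrC !divfK //.
have := cross_dependence x y z; rewrite /crossQ => e.
apply/eqP; rewrite -subr_eq0; apply/eqP; rewrite -[RHS]e.
by apply: row2P; rewrite !mxE; ring.
Qed.

Lemma crossQ_comb (x y : 'rV[rat]_2) a b :
  crossQ x (- (a *: x + b *: y)) = - (b * crossQ x y).
Proof. by rewrite /crossQ !mxE; ring. Qed.

Lemma crossQZ (x : 'rV[rat]_2) a : crossQ x (a *: x) = 0.
Proof. by rewrite /crossQ !mxE; ring. Qed.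

(** The ray [i] lies inside the sector opposite to {j, l} and forms a cone with [j]. The slope x / y
    orders the rays of that sector, increasing from the side of -u_l to the side of -u_j. *)
Definition adjacent_opposite j l i (x y : rat) : Prop :=
  [/\ [set j; i]%SET \in cones F, 0 < x /\ 0 < y, i != j, i != l &
      U i = - (x *: U j + y *: U l)].

(** The set [s] is some {j, i}. Solving -(a u_j + b u_l) = al_j u_j + al_i u_i for u_i gives the
    slope (a + al_j) / b, larger than a / b. *)
Lemma support_adjacent_opposite j l (a b : rat) s : j != l ->
  [set j; l]%SET \in cones F -> 0 < a -> 0 < b ->
  support_cone (- (a *: U j + b *: U l)) s -> j \in s ->
  exists i x y, adjacent_opposite j l i x y /\ a * y < b * x.
Proof.
move=> jl jlF a0 b0 [al [sF al0] Dx] js; have cr := cross_neq0 jl jlF.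
(* If [l] were in [s] too, bringing everything to one side would give a relation with coefficient
   [al j + a > 0] at [j]. *)
have ls : l \notin s.
  apply/negP => ls.
  have := @fan_free _ F _ sF (fun k => al k + (k == j)%:R * a + (k == l)%:R * b) _ j js.
  rewrite eqxx (negPf jl) mul0r addr0 mul1r => eq0.
  suff /eq0 : \sum_(k in s) (al k + (k == j)%:R * a + (k == l)%:R * b) *: U k = 0.
    by have := al0 j js; lra.
  under eq_bigr do rewrite !scalerDl; rewrite !big_split /= -Dx.
  have pick (k0 : 'I_n) c : k0 \in s -> \sum_(k in s) ((k == k0)%:R * c) *: U k = c *: U k0.
    move=> k0s; rewrite (bigD1 k0) //= eqxx mul1r big1 ?addr0 // => k /andP[_ /negPf->].
    by rewrite mul0r scale0r.
  by rewrite !pick // -addrA addNr.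
have [i /andP[si ij]] : exists i, (i \in s) && (i != j).
  apply/existsP; apply: contraNT cr => /existsPn noi.
  move: Dx; rewrite (bigD1 j) //= big1; last first.
    by move=> k /andP[ks kj]; have := noi k; rewrite ks kj.
  rewrite addr0 => /(congr1 (crossQ (U j))); rewrite crossQ_comb crossQZ => /eqP.
  by rewrite oppr_eq0 mulf_eq0 gt_eqF.
have Ds : s = [set j; i]%SET.
  apply/eqP; rewrite finset.eqEsubset finset.subUset !finset.sub1set js si !andbT.
  apply/fintype.subsetP => k ks; rewrite !inE; apply: contraT; rewrite negb_or => /andP[kj ki].
  by case: (cone_card_le2 sF ks js si kj ki); rewrite eq_sym.
have al0i := al0 i si; have al0j := al0 j js.
rewrite Ds in sF ls; rewrite Ds big_setU1 ?inE ?[j == i]eq_sym ?(negPf ij) //= big_set1 in Dx.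
have nz : al i != 0 by rewrite gt_eqF.
exists i, ((a + al j) / al i), (b / al i); split; first split => //.
- by split; rewrite divr_gt0 // addr_gt0.
- by apply: contraNneq ls => <-; rewrite !inE eqxx orbT.
- apply: (scalerI nz); rewrite scalerN scalerDr !scalerA ![al i * _]mulrC !divfK //.
  rewrite -[LHS](addKr (al j *: U j)) -Dx scalerDl.
  by apply: row2P; rewrite !mxE; ring.
by rewrite !mulrA ltr_pM2r ?invr_gt0 // mulrC ltr_pM2l // ltrDl.
Qed.

(** Otherwise [u_i] would lie in the interior of the cone {j, i'}. So the ray adjacent to [j] has
    the least slope among the opposite rays. *)
Lemma adjacent_opposite_extremal j l i i' (x y x' y' : rat) :
  adjacent_opposite j l i' x' y' -> i != j -> 0 < x -> 0 < y ->
  U i = - (x *: U j + y *: U l) -> x * y' < x' * y -> False.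
Proof.
move=> [jiF [x'0 y'0] i'j _ Di'] ij x0 y0 Di lt.
have y'nz : y' != 0 by rewrite gt_eqF.
have Ei : U i = (x' * y / y' - x) *: U j + (y / y') *: U i'.
  rewrite Di Di'; apply: row2P; rewrite !mxE; field; exact: y'nz.
have /support_cone_uniq : support_cone (U i) [set j; i']%SET.
  rewrite Ei; apply: support_cone2 => //; first by rewrite eq_sym.
    by rewrite subr_gt0 ltr_pdivlMr.
  by rewrite divr_gt0.
have := @support_cone1 1 i ltr01; rewrite scale1r => Ui /(_ _ Ui)/setP/(_ j).
by rewrite !inE eqxx /= eq_sym (negPf ij).
Qed.

Lemma opposite_ray_uniq j l i i' (x y x' y' : rat) : 0 < y -> 0 < y' ->
  U i = - (x *: U j + y *: U l) -> U i' = - (x' *: U j + y' *: U l) ->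
  x * y' = x' * y -> i = i'.
Proof.
move=> y0 y'0 Di Di' e; have ynz : y != 0 by rewrite gt_eqF.
have Ei : U i' = (y' / y) *: U i.
  rewrite Di Di'.
  have -> : x' = x * y' / y by rewrite e mulfK.
  by apply: row2P; rewrite !mxE; field; exact: ynz.
have /support_cone_uniq := @support_cone1 (y' / y) i (divr_gt0 y'0 y0); rewrite -Ei.
have := @support_cone1 1 i' ltr01; rewrite scale1r => Ui' /(_ _ Ui')/setP/(_ i).
by rewrite !inE eqxx => /esym/eqP.
Qed.

(** With common denominators cleared, the mediant (X + X') / (Y + Y') lies strictly between the two
    slopes; it still does after numerator and denominator are multiplied by a large multiple of p
    and increased by 1, which makes both prime to p. *)
Lemma prime_to_between (p : nat) (x y x' y' : rat) : (1 < p)%N ->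
  0 < x -> 0 < y -> 0 < x' -> 0 < y' -> x * y' < x' * y ->
  exists a b : nat, [/\ ~~ (p %| a)%N, ~~ (p %| b)%N, x * b%:R < a%:R * y &
     a%:R * y' < x' * b%:R].
Proof.
move=> p1 x0 y0 x'0 y'0 lt.
have [d [X [Y [X' [Y' [d0 [DX [DY [DX' DY']]]]]]]]] : exists d X Y X' Y' : nat,
    (0 < d)%N /\ x * d%:R = X%:R /\ y * d%:R = Y%:R /\ x' * d%:R = X'%:R /\ y' * d%:R = Y'%:R.
  have frac (z : rat) : 0 < z -> exists N d : nat, (0 < d)%N /\ z * d%:R = N%:R.
    move=> z0; exists `|numq z|%N, `|denq z|%N; rewrite absz_gt0 denq_neq0; split=> //.
    by rewrite !natr_absz gtr0_norm ?denq_gt0 // gtr0_norm ?numq_gt0 // numqE.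
  have [X [dx [dx0 ex]]] := frac x x0; have [Y [dy [dy0 ey]]] := frac y y0.
  have [X' [dx' [dx'0 ex']]] := frac x' x'0; have [Y' [dy' [dy'0 ey']]] := frac y' y'0.
  exists (dx * dy * dx' * dy')%N, (X * (dy * dx' * dy'))%N, (Y * (dx * dx' * dy'))%N,
    (X' * (dx * dy * dy'))%N, (Y' * (dx * dy * dx'))%N.
  by rewrite !muln_gt0 dx0 dy0 dx'0 dy'0 !natrM -ex -ey -ex' -ey'; do ![split]; ring.
have dd : 0 < d%:R :> rat by rewrite ltr0n.
have toN (u v : rat) (w w' : rat) : u * d%:R * w < v * d%:R * w' -> u * w < v * w'.
  by move=> h; rewrite -(ltr_pM2l dd); move: h; lra.
have lt' : (X * Y' < X' * Y)%N.
  rewrite -(ltr_nat rat) !natrM -DX -DY -DX' -DY'.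
  move: lt; rewrite -(ltr_pM2r (mulr_gt0 dd dd)) => lt.
  rewrite (_ : x * _ * _ = x * y' * (d%:R * d%:R)); last by ring.
  by rewrite (_ : x' * _ * _ = x' * y * (d%:R * d%:R)); last by ring.
(* The integer gap X' Y - X Y' is at least 1; scaled by q = p M, it exceeds X and Y', the errors due
   to the added 1. *)
pose M := (X + Y').+1.
pose q := (p * M)%N; have hq := leq_mul (leqnn q) lt'.
have qM : (X + Y' < q)%N by apply: leq_trans (leq_pmull M (ltnW p1)).
exists (p * (M * (X + X')) + 1)%N, (p * (M * (Y + Y')) + 1)%N.
have ndvd k : ~~ (p %| p * k + 1)%N.
  by rewrite dvdn_addr ?dvdn_mulr // dvdn1 gtn_eqF.
split => //.
  rewrite [_ * y]mulrC; apply: toN; rewrite DX DY -!natrM ltr_nat.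
  by move: hq qM; rewrite !mulnA -/q; lia.
rewrite [_ * y']mulrC; apply: toN; rewrite DX' DY' -!natrM ltr_nat.
by move: hq qM; rewrite !mulnA -/q; lia.
Qed.
End FanCombinatorics.

(** * Contact orders with determinant prime to p *)

Section ContactOrders.
Variables (n : nat) (F : fan n) (hF : complete_fan F) (p : nat) (p1 : (1 < p)%N).
Local Notation U i := (vecQ (gen F i)).
Implicit Types (i j l : 'I_n) (s t : {set 'I_n}).

(** The third contact order -(a u_j + b u_l) avoids the divisors met by the first two, so no divisor
    is met at two marked points. *)
Definition balanced j l (a b : nat) : Prop :=
  exists s, [/\ support_cone F (- (a%:R *: U j + b%:R *: U l)) s, j \notin s & l \notin s].

Lemma balancedC j l a b : balanced j l a b -> balanced l j b a.
Proof. by move=> [s [h js ls]]; exists s; rewrite addrC. Qed.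

Lemma not_balanced_adjacent j l a b : j != l -> [set j; l]%SET \in cones F ->
  (0 < a)%N -> (0 < b)%N -> ~ balanced j l a b ->
  (exists i x y, adjacent_opposite F j l i x y /\ a%:R * y < b%:R * x) \/
  (exists i x y, adjacent_opposite F l j i x y /\ b%:R * y < a%:R * x).
Proof.
move=> jl jlF a0 b0 nb.
have [s Ds] := support_cone_exists (- (a%:R *: U j + b%:R *: U l)) hF.
have [js|js] := boolP (j \in s).
  by left; apply: (support_adjacent_opposite jl jlF _ _ Ds); rewrite ?ltr0n.
have [ls|ls] := boolP (l \in s); last by case: nb; exists s.
rewrite addrC in Ds; right.
by apply: (support_adjacent_opposite _ _ _ _ Ds); rewrite ?ltr0n // 1?eq_sym // finset.setUC.
Qed.

(** Let [i] be the opposite ray adjacent to [j]. A vector of larger slope is unbalanced, but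
    extremality keeps it out of the cones through [j]; so it lies in a cone on [l] and an opposite
    ray i'. A gap between i and i' would contain a vector with coefficients prime to p, unbalanced
    again, against [adjacent_opposite_extremal]. Hence i = i'. *)
Lemma not_balanced_common_adjacent j l : j != l -> [set j; l]%SET \in cones F ->
  (forall a b, ~~ (p %| a)%N -> ~~ (p %| b)%N -> ~ balanced j l a b) ->
  (exists i x y, adjacent_opposite F j l i x y) ->
  exists i x y, adjacent_opposite F j l i x y /\ [set l; i]%SET \in cones F.
Proof.
move=> jl jlF nb [i [x [y adi]]]; exists i, x, y; split=> //.
have [jiF [x0 y0] ij il Di] := adi.
have pos a : ~~ (p %| a)%N -> (0 < a)%N by case: a => //; rewrite dvdn0.
(* The upper bound (x + 1) / y is arbitrary: any slope a / b above x / y will do. *)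
have x'0 : 0 < x + 1 by rewrite addr_gt0.
have [|a [b [pa pb h1 _]]] := prime_to_between p1 x0 y0 x'0 y0; first by rewrite ltr_pM2r // ltrDl.
have aux i' x' y' c d : adjacent_opposite F j l i' x' y' -> ~~ (p %| c)%N -> ~~ (p %| d)%N ->
    c%:R * y' < d%:R * x' -> x * d%:R < c%:R * y -> False.
  move=> adi' /pos c0 /pos d0 lt1 lt2; have [_ [x'_gt0 y'_gt0] _ _ _] := adi'.
  apply: (adjacent_opposite_extremal adi' ij x0 y0 Di).
  have c0' : 0 < c%:R :> rat by rewrite ltr0n.
  have d0' : 0 < d%:R :> rat by rewrite ltr0n.
  rewrite -(ltr_pM2r d0'); apply: (@lt_trans _ _ (c%:R * y * y')).
    by rewrite mulrAC ltr_pM2r.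
  by rewrite mulrAC (_ : x' * y * d%:R = d%:R * x' * y) ?ltr_pM2r //; ring.
have [[i' [x' [y' [adi' lt]]]]|[i' [x' [y' [adi' lt]]]]] :=
  not_balanced_adjacent jl jlF (pos a pa) (pos b pb) (nb a b pa pb).
  by case: (aux _ _ _ _ _ adi' pa pb lt h1).
have [liF [x'_gt0 y'_gt0] i'l i'j] := adi'; rewrite addrC => Di'.
(* For i' the roles of [j] and [l] are exchanged: its slope is y' / x', to be compared with x /
   y. *)
have [lt2|lt2|e] := ltgtP (x * x') (y' * y).
- have [c [d [pc pd h2 h3]]] := prime_to_between p1 x0 y0 y'_gt0 x'_gt0 lt2.
  have [[i2 [x2 [y2 [adi2 lt3]]]]|[i2 [x2 [y2 [adi2 lt3]]]]] :=
    not_balanced_adjacent jl jlF (pos c pc) (pos d pd) (nb c d pc pd).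
    by case: (aux _ _ _ _ _ adi2 pc pd lt3 h2).
  have [_ [x2_gt0 y2_gt0] _ _ _] := adi2; rewrite addrC in Di'.
  case: (adjacent_opposite_extremal adi2 i'l x'_gt0 y'_gt0 Di').
  have c0 : 0 < c%:R :> rat by rewrite ltr0n pos.
  rewrite -(ltr_pM2l c0); apply: (@lt_trans _ _ (y' * d%:R * y2)).
    by rewrite mulrA ltr_pM2r.
  by rewrite mulrA -mulrA [ltRHS]mulrC ltr_pM2l.
- rewrite addrC in Di; case: (adjacent_opposite_extremal adi' il y0 x0 Di).
  by rewrite mulrC [x' * x]mulrC.
- by rewrite (opposite_ray_uniq y0 x'_gt0 Di Di' e).
Qed.

(** A positive combination of u_j, u_l, u_i vanishes, so the cones on two of them cover the plane;
    any ray lies in one of these and is therefore one of its rays. *)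
Lemma three_rays j l i x y : j != l -> [set j; l]%SET \in cones F ->
  adjacent_opposite F j l i x y -> [set l; i]%SET \in cones F ->
  forall r, r \in [set j; l; i]%SET.
Proof.
move=> jl jlF [jiF [x0 y0] ij il Di] liF r; have cr := cross_neq0 jl jlF.
have Ur := @support_cone1 _ F 1 r ltr01; rewrite scale1r in Ur.
have incone s : s \in cones F -> cone (gen F) s (U r) -> r \in s.
  by move=> sF sr; have := support_cone_sub Ur sF sr; rewrite finset.sub1set.
have cone2 a b k k' : k != k' -> U r = a *: U k + b *: U k' -> 0 <= a -> 0 <= b ->
    cone (gen F) [set k; k']%SET (U r).
  move=> kk' -> a0 b0; exists (fun v => if v == k then a else b).
  split; first by move=> t _; case: ifP.
  by rewrite big_setU1 ?inE //= big_set1 eqxx eq_sym (negPf kk').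
(* Write u_r = c u_j + d u_l; a negative coefficient is removed by solving the relation for u_l or
   u_j in terms of u_i, whichever leaves nonnegative coefficients. *)
have := cross_expand (U r) cr; set c := (_ / _); set d := (_ / _) => Dr.
have xnz : x != 0 by rewrite gt_eqF. have ynz : y != 0 by rewrite gt_eqF.
have [c0|c0] := leP 0 c; have [d0|d0] := leP 0 d.
- by have := incone _ jlF (cone2 _ _ _ _ jl Dr c0 d0); rewrite !inE => ->.
- have : r \in [set j; i]%SET.
    apply: incone => //; apply: (cone2 (c + x * (- d / y)) (- d / y)).
    + by rewrite eq_sym.
    + by rewrite Dr Di; apply: row2P; rewrite !mxE; field; exact: ynz.
    + by rewrite addr_ge0 // mulr_ge0 ?ltW // divr_gt0 // oppr_gt0.
    + by rewrite ltW // divr_gt0 // oppr_gt0.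
  by rewrite !inE => /orP[] ->; rewrite ?orbT.
- have : r \in [set l; i]%SET.
    apply: incone => //; apply: (cone2 (d + y * (- c / x)) (- c / x)).
    + by rewrite eq_sym.
    + by rewrite Dr Di; apply: row2P; rewrite !mxE; field; exact: xnz.
    + by rewrite addr_ge0 // mulr_ge0 ?ltW // divr_gt0 // oppr_gt0.
    + by rewrite ltW // divr_gt0 // oppr_gt0.
  by rewrite !inE => /orP[] ->; rewrite ?orbT.
have [lt|lt] := leP (- c / x) (- d / y).
- have : r \in [set j; i]%SET.
    apply: incone => //; apply: (cone2 (c + x * (- d / y)) (- d / y)).
    + by rewrite eq_sym.
    + by rewrite Dr Di; apply: row2P; rewrite !mxE; field; exact: ynz.
    + by move: lt; rewrite ler_pdivrMr // [_ * x]mulrC; lra.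
    + by rewrite ltW // divr_gt0 // oppr_gt0.
  by rewrite !inE => /orP[] ->; rewrite ?orbT.
have : r \in [set l; i]%SET.
  apply: incone => //; apply: (cone2 (d + y * (- c / x)) (- c / x)).
  + by rewrite eq_sym.
  + by rewrite Dr Di; apply: row2P; rewrite !mxE; field; exact: xnz.
  + by move: lt; rewrite ltr_pdivrMr // [_ * y]mulrC; lra.
  + by rewrite ltW // divr_gt0 // oppr_gt0.
by rewrite !inE => /orP[] ->; rewrite ?orbT.
Qed.

(** If nothing is balanced, the rays are [j], [l], [i]. The cones avoiding [j] and [l] are {i, l}
    and {i, j}, whose determinants are prime to p by hypothesis, and Cramer's relation |det(u_i,
    u_l)| u_j + |det(u_i, u_j)| u_l = -|det(u_j, u_l)| u_i is balanced. *)
Lemma balanced_exists :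
  (forall i : 'I_n, exists j l : 'I_n,
     [/\ j != l, [set j; l]%SET \in cones F, i \notin [set j; l]%SET &
         ~~ (p%:Z %| det2 (gen F j) (gen F l))%Z]) ->
  exists j l a b, [/\ j != l, [set j; l]%SET \in cones F,
    ~~ (p%:Z %| det2 (gen F j) (gen F l))%Z,
    ~~ (p %| a)%N /\ ~~ (p %| b)%N & balanced j l a b].
Proof.
move=> hcones.
(* A complete fan has a ray, since the zero cone does not contain the vector (1, 1). *)
have [i0] : exists i0 : 'I_n, True.
  have [s [al _ Dx]] := support_cone_exists (const_mx 1) hF.
  have [s0|[i _]] := set_0Vmem s; last by exists i.
  by move: Dx; rewrite s0 big_set0 => /rowP/(_ 0); rewrite !mxE.
move=> _; have [j [l [jl jlF _ pD]]] := hcones i0.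
apply: contrapT => nobal.
have nb a b : ~~ (p %| a)%N -> ~~ (p %| b)%N -> ~ balanced j l a b.
  by move=> pa pb bal; apply: nobal; exists j, l, a, b.
clear nobal i0.
(* The pair (1, 1) is unbalanced, which provides an opposite ray adjacent to [j] or to [l]; in the
   second case exchange the two. *)
wlog : j l jl jlF pD nb / exists i x y, adjacent_opposite F j l i x y.
  move=> wl; have p1' : ~~ (p %| 1)%N by rewrite dvdn1 gtn_eqF.
  have [[i [x [y [ad _]]]]|[i [x [y [ad _]]]]] :=
    not_balanced_adjacent jl jlF (ltn0Sn 0) (ltn0Sn 0) (nb 1%N 1%N p1' p1').
    by apply: (wl j l) => //; exists i, x, y.
  apply: (wl l j); rewrite 1?eq_sym // 1?finset.setUC //.
  - by move: pD; rewrite !det2E -rpredN opprB mulrC [X in _ - X]mulrC.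
  - by move=> a b pa pb /balancedC; apply: nb.
  - by exists i, x, y.
move=> ex; have [i [x [y [ad liF]]]] := not_balanced_common_adjacent jl jlF nb ex.
have all3 := three_rays jl jlF ad liF; have [jiF [x0 y0] ij il Di] := ad.
have opp_det k k' : k' != k -> (forall r, r \in [set j; l; i]%SET) ->
    k' \in [set j; l]%SET -> k \in [set j; l]%SET ->
    ~~ (p %| `|det2 (gen F i) (gen F k)|)%N.
  move=> kk' _ hk' hk; have [j' [l' [jl' jlF' kn pD']]] := hcones k'.
  move: kn; rewrite !inE negb_or => /andP[kj kl].
  have mem r : r != k' -> r = k \/ r = i.
    move=> rk; have := all3 r; rewrite !inE => /orP[hr|/eqP->]; last by right.
    left; move: hk hk' hr rk kk'; rewrite !inE.
    by do 3![case/orP=> /eqP->]; rewrite ?eqxx.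
  have [] := mem j' _; rewrite 1?eq_sym // => ej; have [] := mem l' _; rewrite 1?eq_sym // => el.
  - by rewrite ej el eqxx in jl'.
  - by move: pD'; rewrite ej el !det2E -rpredN opprB mulrC [X in _ - X]mulrC.
  - by move: pD'; rewrite ej el.
  - by rewrite ej el eqxx in jl'.
have pa := opp_det l j jl all3 (set21 _ _) (set22 _ _).
have pb : ~~ (p %| `|det2 (gen F i) (gen F j)|)%N.
  by apply: (opp_det j l) => //; rewrite ?set21 ?set22 // eq_sym.
apply: (nb _ _ pa pb).
have cr := cross_neq0 jl jlF.
have e1 : crossQ (U i) (U l) = - x * crossQ (U j) (U l).
  by rewrite Di; move: (U j) (U l) => v w; rewrite /crossQ !mxE; ring.
have e2 : crossQ (U i) (U j) = y * crossQ (U j) (U l).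
  by rewrite Di; move: (U j) (U l) => v w; rewrite /crossQ !mxE; ring.
exists [set i]%SET; split; rewrite ?inE 1?eq_sym //.
rewrite !natr_absz !intr_norm -!crossQ_det2 e1 e2 !normrM normrN.
rewrite (gtr0_norm x0) (gtr0_norm y0).
have -> : - (x * `|crossQ (U j) (U l)| *: U j + y * `|crossQ (U j) (U l)| *: U l) =
   `|crossQ (U j) (U l)| *: U i.
  by rewrite Di; move: `|_| => c; apply: row2P; rewrite !mxE; ring.
by apply: support_cone1; rewrite normr_gt0.
Qed.

End ContactOrders.

(** * Scaling to Campana type *)

Section CampanaContact.
Variables (n : nat) (F : fan n) (p : nat) (p_prime : prime p).
Local Notation U i := (vecQ (gen F i)).

Lemma vecQMn (v : 'rV[int]_2) N : vecQ (v *+ N) = N%:R *: vecQ v.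
Proof. by rewrite scaler_nat; exact: raddfMn. Qed.

(** Scaling keeps the supporting cones and multiplies the multiplicities, so a large [N] takes care
    of the finite weights, and disjointness of the supports of the infinite ones. Taking [N]
    congruent to 1 modulo p keeps the determinant prime to p. *)
Lemma campana_scaling (m : 'I_n -> option nat) (r : nat) (c : 'I_r -> 'rV[int]_2)
    (s : 'I_r -> {set 'I_n}) :
  (forall k, support_cone F (vecQ (c k)) (s k)) ->
  (forall k k' i, i \in s k -> i \in s k' -> k = k') ->
  exists N : nat, [/\ ~~ (p %| N)%N, campana_type F m (fun k => c k *+ N) &
    forall k, support_cone F (vecQ (c k *+ N)) (s k)].
Proof.
move=> sup disj.
have /choice[al Dal] : forall k, exists al : 'I_n -> rat,
    (forall i, i \in s k -> 0 < al i) /\ vecQ (c k) = \sum_(i in s k) al i *: U i.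
  by move=> k; have [al [_ al0] Dc] := sup k; exists al.
(* Only finite weights need a bound, hence the default 0 for an infinite one. *)
pose T k i := Num.bound ((odflt 0%N (m i))%:R / al k i).
pose N := (p * (\sum_k \sum_i T k i) + 1)%N.
have N_gt0 : 0 < N%:R :> rat by rewrite ltr0n /N; lia.
have supN k : support_cone F (vecQ (c k *+ N)) (s k).
  have [al0 Dc] := Dal k; have [_ [sF _] _] := sup k.
  exists (fun i => N%:R * al k i); first by split=> // i si; rewrite mulr_gt0 // al0.
  by rewrite vecQMn Dc scaler_sumr; apply: eq_bigr => i _; rewrite scalerA.
exists N; split=> //.
  by rewrite dvdn_addr ?dvdn_mulr // dvdn1 gtn_eqF // prime_gt1.
exists (fun k i => if i \in s k then N%:R * al k i else 0); split.
- move=> k; have [al0 Dc] := Dal k; exists (s k); split.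
  + exact: support_cone_in (supN k).
  + by move=> t tF; apply: support_cone_sub (supN k) tF.
  + by move=> i; case: ifP => // si; rewrite mulr_ge0 ?ltW // al0.
  + by move=> i /negPf->.
  + rewrite vecQMn Dc scaler_sumr big_mkcond /=; apply: eq_bigr => i _.
    by case: ifP => _; rewrite ?scalerA ?scale0r.
- move=> i e mi k; have [al0 _] := Dal k; case: ifP => si; [right | by left].
  rewrite -ler_pdivrMr ?al0 //; apply: le_trans (_ : (T k i)%:R <= _).
    rewrite /T mi /=; apply/ltW/archi_boundP.
    by rewrite divr_ge0 //; apply/ltW/al0.
  rewrite ler_nat /N (bigD1 k) //= (bigD1 i) //=.
  have := prime_gt0 p_prime; nia.
- move=> i mi k k'; case: ifP => sk; last by rewrite ltxx.
  by case: ifP => sk'; [move=> _ _; apply: disj sk sk' | rewrite ltxx].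
Qed.

Lemma det2Mn (u v : 'rV[int]_2) N : det2 (u *+ N) (v *+ N) = det2 u v * (N%:R * N%:R).
Proof. by rewrite !det2E !mulmxnE; ring. Qed.

Lemma campana_contact_exists (m : 'I_n -> option nat) (hF : complete_fan F) :
  (forall i : 'I_n, exists j l : 'I_n,
     [/\ j != l, [set j; l]%SET \in cones F, i \notin [set j; l]%SET &
         smooth_pair (gen F j) (gen F l) \/ tame_pair p (gen F j) (gen F l)]) ->
  exists (c : 'I_3 -> 'rV[int]_2) (s : 'I_3 -> {set 'I_n}),
    [/\ campana_type F m c, forall k, support_cone F (vecQ (c k)) (s k),
        c 0 + c 1 + c ord_max = 0 & ~~ (p%:Z %| det2 (c 0%R) (c 1%R))%Z].
Proof.
move=> hcones; have p1 := prime_gt1 p_prime.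
have [|j [l [a [b [jl jlF pD [pa pb] [s [Ds js ls]]]]]]] := balanced_exists hF p1.
  move=> i; have [j [l [jl jlF ijl sm]]] := hcones i; exists j, l; split=> //.
  case: sm => [|/andP[]//]; rewrite /smooth_pair unitmxE -/(det2 _ _) => Du.
  apply/negP => /(@dvdz_mulr _ _ (det2 (gen F j) (gen F l))^-1).
  by rewrite divrr // dvdzE /= dvdn1 gtn_eqF.
have a0 : (0 < a)%N by case: a pa {Ds}; rewrite ?dvdn0.
have b0 : (0 < b)%N by case: b pb {Ds}; rewrite ?dvdn0.
pose c0 (k : 'I_3) : 'rV[int]_2 := [:: gen F j *+ a; gen F l *+ b; - (gen F j *+ a + gen F l *+ b)]`_k.
pose s0 (k : 'I_3) : {set 'I_n} := nth s [:: [set j]%SET; [set l]%SET] k.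
have [] := @campana_scaling m 3 c0 s0.
- case=> [[|[|[|//]]] hk]; rewrite /c0 /s0 /=.
  + by rewrite vecQMn; apply: support_cone1; rewrite ltr0n.
  + by rewrite vecQMn; apply: support_cone1; rewrite ltr0n.
  + by rewrite /vecQ map_mxN map_mxD -!/(vecQ _) !vecQMn.
- case=> [[|[|[|//]]] hk] [[|[|[|//]]] hk'] i; rewrite /s0 /= ?inE.
  all: try by move=> *; apply: val_inj.
  all: try (move/eqP->).
  all: try by move/eqP=> e; rewrite e eqxx in jl.
  all: try by move=> is0; rewrite is0 in js ls.
  all: try by move=> is0 /eqP e; rewrite -e is0 in js ls.
move=> N [pN camp sup]; exists (fun k => c0 k *+ N), s0; split=> //.
  by rewrite -!mulrnDl /c0 /= subrr mul0rn.
rewrite det2Mn /c0 /= (_ : det2 _ _ = det2 (gen F j) (gen F l) * a%:R * b%:R).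
  rewrite dvdzE !abszM !natz !absz_nat /= !Euclid_dvdM //.
  by rewrite (negPf (pD : ~~ (p %| `|det2 (gen F j) (gen F l)|)%N)) (negPf pa) (negPf pb) (negPf pN).
by rewrite !det2E !mulmxnE; ring.
Qed.

End CampanaContact.

(** * Glued spaces *)

Section Algebra.
Variable k : fieldType.
Implicit Types X Y : kspace k.

(** The algebra of regular functions that the axioms of [kspace] leave out; for glued spaces it
    comes from [glued_kalgebraic]. *)
Record kalgebraic X : Prop := KAlgebraic {
  regular_cst : forall U c, open U -> regular X U (fun=> c);
  regularD : forall U f g, open U -> regular X U f -> regular X U g ->
    regular X U (fun x => f x + g x);
  regularM : forall U f g, open U -> regular X U f -> regular X U g ->
    regular X U (fun x => f x * g x);
  open_nonzero : forall U f, open U -> regular X U f -> open [set x | U x /\ f x != 0];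
  regularV : forall U f, open U -> regular X U f ->
    regular X [set x | U x /\ f x != 0] (fun x => (f x)^-1) }.

Lemma regular_sum X (hX : kalgebraic X) U N (f : 'I_N -> X -> k) : open U ->
  (forall i, regular X U (f i)) -> regular X U (fun x => \sum_i f i x).
Proof.
move=> oU; elim: N f => [|N IHN] f fU.
  apply: regular_ext (regular_cst hX 0 oU) => x _; by rewrite big_ord0.
apply: regular_ext (regularD hX oU (fU ord0) (IHN (fun i => f (lift ord0 i)) _)) => //.
by move=> x _; rewrite big_ord_recl.
Qed.

Lemma regularX X (hX : kalgebraic X) U n (f : X -> k) : open U ->
  regular X U f -> regular X U (fun x => f x ^+ n).
Proof.
move=> oU fU; elim: n => [|n IHn].
  by apply: regular_ext (regular_cst hX 1 oU) => x _; rewrite expr0.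
by apply: regular_ext (regularM hX oU fU IHn) => x _; rewrite exprS.
Qed.

Lemma regularV_unit X (hX : kalgebraic X) U f : open U -> regular X U f ->
  (forall x, U x -> f x != 0) -> regular X U (fun x => (f x)^-1).
Proof.
move=> oU fU f0; have := regularV hX oU fU; congr (regular X _ _).
by apply/seteqP; split=> x /=; [case | split=> //; apply: f0].
Qed.

Lemma regular_exprz X (hX : kalgebraic X) U (n : int) (f : X -> k) : open U ->
  regular X U f -> (forall x, U x -> f x != 0) -> regular X U (fun x => f x ^ n).
Proof.
move=> oU fU f0; case: n => n; first exact: regularX.
by apply: regularV_unit => //; [exact: regularX | move=> x Ux; rewrite expf_neq0 ?f0].
Qed.

Lemma regular_quotient X (hX : kalgebraic X) U f g : open U ->
  regular X U f -> regular X U g ->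
  regular X [set x | U x /\ g x != 0] (fun x => f x / g x).
Proof.
move=> oU fU gU; have oV := open_nonzero hX oU gU.
apply: (regularM hX oV); last exact: regularV.
by apply: regular_res fU => // x [].
Qed.

Section GluedSpace.
Variable A : atlas k.
Let G := glue A.

Lemma open_glued (O : set G) :
  (forall x, O x -> exists B : set G, [/\ open B, B x & B `<=` O]) -> open O.
Proof. by move=> h; rewrite openE => x /h[B [oB Bx BO]]; rewrite /interior nbhsE; exists B. Qed.

Lemma open_principal i a : afun i a -> open ([set x | adom i x /\ a x != 0] : set G).
Proof.
move=> ia; set P := [set x | _].
exists [set P]; last by rewrite bigcup_set1.
move=> _ ->; exists [fset (P : set (glued A))]%fset.
  by move=> j /fset1P->; apply/mem_set; exists i, a.
by apply/seteqP; split=> x /=; [apply; apply/fset1P | move=> Px j /fset1P->].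
Qed.

(** Principal sets form a subbase, so a property stable under intersection and enlargement need only
    be checked on those around [x]. *)
Lemma glued_nbhs_ind (x : G) (Q : set G -> Prop) : Q setT ->
  (forall B C, Q B -> Q C -> Q (B `&` C)) ->
  (forall B C, B `<=` C -> Q B -> Q C) ->
  (forall i a, afun i a -> adom i x -> a x != 0 ->
     Q [set y | adom i y /\ a y != 0]) ->
  forall O, open O -> O x -> Q O.
Proof.
move=> QT QI QS Qp O [D subD <-] [B DB Bx].
suff QB : Q B by apply: QS QB => y By; exists B.
have [J JP JB] := subD _ DB; rewrite -JB in Bx *.
apply: (QS (\bigcap_(i in [set` enum_fset J]) i)); first by [].
have {JP} : forall P, P \in (enum_fset J : seq _) -> principal P /\ P x.
  by move=> P PJ; split; [have /set_mem := JP P PJ | apply: Bx].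
elim: (enum_fset J : seq _) {JB Bx} => [|P s IHs] sP.
  by apply: (QS setT) => // y _ P.
have [[i [a [ia DP]]] Px] := sP P (mem_head _ _).
have {}Px : adom i x /\ a x != 0 by rewrite DP in Px.
apply: (QS (P `&` \bigcap_(i in [set` s]) i)).
  by move=> y [Py sy] R; rewrite /= inE => /orP[/eqP->|] //; apply: sy.
apply: QI; first by rewrite DP; apply: Qp => //; case: Px.
by apply: IHs => R Rs; apply: sP; rewrite inE Rs orbT.
Qed.

Definition chart_quotient i (x : G) (f : G -> k) : Prop :=
  exists (a b : apoint A -> k) (V : set G), [/\ afun i a, afun i b, open V, V x &
    forall y, V y -> [/\ adom i y, b y != 0 & f y = a y / b y]].

Lemma regular_gluedP (U : set G) f : open U ->
  (regular G U f <-> forall x, U x -> exists i, chart_quotient i x f).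
Proof.
move=> oU; split=> Uf x Ux.
  have [i [a [b [V [ia ib oV Vx VP]]]]] := Uf x Ux; exists i, a, b, V; split=> // y.
  by case/VP.
have [i [a [b [V [ia ib oV Vx VP]]]]] := Uf x Ux.
exists i, a, b, (V `&` U); split=> //; first exact: openI.
by move=> y [/VP[iy by0 fy] Uy].
Qed.

(** Products are only required to agree on the chart: in the toric case, [chi (m + m')] and
    [chi m * chi m'] may differ outside it. *)
Record chart_rings : Prop := ChartRings {
  afun_cst : forall i (x : apoint A) c, adom i x -> afun i (fun _ : apoint A => c);
  afunD : forall i (x : apoint A) (a b : apoint A -> k), adom i x ->
    afun i a -> afun i b -> afun i (fun x => a x + b x);
  afunM : forall i (x : apoint A) (a b : apoint A -> k), adom i x ->
    afun i a -> afun i b -> exists2 c, afun i c & forall y, adom i y -> c y = a y * b y }.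

(** This lets functions given as quotients in different charts be added and multiplied: near [x]
    both become quotients in one chart [j]. *)
Definition chart_compatible : Prop := forall (x : G) i i', adom i x -> adom i' x ->
  exists j, (forall a, afun i a -> chart_quotient j x a) /\
            (forall a, afun i' a -> chart_quotient j x a).

Hypotheses (hA : chart_rings) (cA : chart_compatible).

Lemma open_adom i : open (adom i : set G).
Proof.
apply: open_glued => x ix; exists [set x | adom i x /\ (1 : k) != 0]; split.
- exact: open_principal (afun_cst hA 1 ix).
- by split=> //; apply: oner_neq0.
- by move=> y [].
Qed.

Lemma chart_quotient_afun i x a : adom i x -> afun i a -> chart_quotient i x a.
Proof.
move=> ix ia; exists a, (fun=> 1), (adom i); split=> //.
- exact: (afun_cst hA 1 ix).
- exact: open_adom.
- by move=> y iy; rewrite oner_neq0 divr1.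
Qed.

Lemma chart_quotient_adom i x f : chart_quotient i x f -> adom i x.
Proof. by move=> [a [b [V [_ _ _ Vx VP]]]]; case: (VP x Vx). Qed.

Lemma chart_quotient_ext i x f (V : set G) g : open V -> V x ->
  (forall y, V y -> f y = g y) -> chart_quotient i x f -> chart_quotient i x g.
Proof.
move=> oV Vx fg [a [b [W [ia ib oW Wx WP]]]]; exists a, b, (W `&` V).
by split=> //; [apply: openI | move=> y [/WP[iy b0 <-] /fg ->]].
Qed.

Lemma chart_quotientD i x f g : chart_quotient i x f -> chart_quotient i x g ->
  chart_quotient i x (fun y => f y + g y).
Proof.
move=> qf; have ix := chart_quotient_adom qf; move: qf.
move=> [a [b [V [ia ib oV Vx VP]]]] [a' [b' [V' [ia' ib' oV' Vx' VP']]]].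
have [c1 ic1 Dc1] := afunM hA ix ia ib'; have [c2 ic2 Dc2] := afunM hA ix ia' ib.
have [d id Dd] := afunM hA ix ib ib'.
exists (fun y => c1 y + c2 y), d, (V `&` V'); split=> //.
- exact: (afunD hA ix).
- exact: openI.
move=> y [/VP[iy b0 ->] /VP'[_ b'0 ->]]; rewrite Dc1 // Dc2 // Dd //.
by rewrite mulf_neq0 // addf_div.
Qed.

Lemma chart_quotientM i x f g : chart_quotient i x f -> chart_quotient i x g ->
  chart_quotient i x (fun y => f y * g y).
Proof.
move=> qf; have ix := chart_quotient_adom qf; move: qf.
move=> [a [b [V [ia ib oV Vx VP]]]] [a' [b' [V' [ia' ib' oV' Vx' VP']]]].
have [c ic Dc] := afunM hA ix ia ia'; have [d id Dd] := afunM hA ix ib ib'.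
exists c, d, (V `&` V'); split=> //; first exact: openI.
move=> y [/VP[iy b0 ->] /VP'[_ b'0 ->]]; rewrite Dc // Dd //.
by rewrite mulf_neq0 // mulf_div.
Qed.

Lemma chart_quotientV i x f : f x != 0 -> chart_quotient i x f ->
  (chart_quotient i x (fun y => (f y)^-1) /\
   exists V : set G, [/\ open V, V x & forall y, V y -> f y != 0]).
Proof.
move=> fx [a [b [V [ia ib oV Vx VP]]]].
have fN0 y : V y -> (f y != 0) = (a y != 0).
  by move=> /VP[_ b0 ->]; rewrite mulf_eq0 invr_eq0 (negPf b0) orbF.
pose W : set G := V `&` [set y | adom i y /\ a y != 0].
have oW : open W by apply: openI => //; apply: open_principal.
have Wx : W x by split=> //; split; [case: (VP x Vx) | rewrite -fN0].
split; last by exists W; split=> // y [Vy [_ ay]]; rewrite fN0.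
exists b, a, W; split=> // y [/VP[iy b0 ->] [_ a0]]; split=> //.
by rewrite invf_div.
Qed.

Lemma chart_quotient_trans i j x f : (forall a, afun i a -> chart_quotient j x a) ->
  chart_quotient i x f -> chart_quotient j x f.
Proof.
move=> ij [a [b [V [ia ib oV Vx VP]]]].
have [|bV _] := chart_quotientV _ (ij b ib); first by case: (VP x Vx).
apply: chart_quotient_ext oV Vx _ (chart_quotientM (ij a ia) bV).
by move=> y /VP[_ _ ->].
Qed.

Lemma chart_quotient_common x i i' f g : chart_quotient i x f -> chart_quotient i' x g ->
  exists j, chart_quotient j x f /\ chart_quotient j x g.
Proof.
move=> qf qg.
have [j [hj hj']] := cA (chart_quotient_adom qf) (chart_quotient_adom qg).
by exists j; split; apply: chart_quotient_trans; [|exact: qf| |exact: qg].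
Qed.

Lemma glued_kalgebraic : (forall x : apoint A, exists i, @adom _ A i x) -> kalgebraic G.
Proof.
move=> cover.
have oN (U : set G) (f : G -> k) : open U -> regular G U f -> open [set x | U x /\ f x != 0].
  move=> oU /(regular_gluedP _ oU) Uf; apply: open_glued => x [Ux fx].
  have [i qf] := Uf x Ux; have [_ [V [oV Vx VP]]] := chart_quotientV fx qf.
  by exists (V `&` U); split=> //; [apply: openI | move=> y [/VP fy Uy]].
split=> //.
- move=> U c oU; apply/(regular_gluedP _ oU) => x _; have [i ix] := cover x.
  by exists i; apply: chart_quotient_afun => //; apply: afun_cst ix.
- move=> U f g oU /(regular_gluedP _ oU) Uf /(regular_gluedP _ oU) Ug.
  apply/(regular_gluedP _ oU) => x Ux; have [i qf] := Uf x Ux; have [i' qg] := Ug x Ux.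
  by have [j [jf jg]] := chart_quotient_common qf qg; exists j; apply: chart_quotientD.
- move=> U f g oU /(regular_gluedP _ oU) Uf /(regular_gluedP _ oU) Ug.
  apply/(regular_gluedP _ oU) => x Ux; have [i qf] := Uf x Ux; have [i' qg] := Ug x Ux.
  by have [j [jf jg]] := chart_quotient_common qf qg; exists j; apply: chart_quotientM.
move=> U f oU Uf'; have /(regular_gluedP _ oU) Uf := Uf'.
apply/(regular_gluedP _ (oN _ _ oU Uf')) => x [Ux fx]; have [i qf] := Uf x Ux.
by exists i; case: (chart_quotientV fx qf).
Qed.

Lemma regular_afun i a : afun i a -> regular G (adom i) a.
Proof.
move=> ia; apply/(regular_gluedP _ (open_adom i)) => x ix; exists i.
exact: chart_quotient_afun.
Qed.

End GluedSpace.

(** Principal sets and local quotients are built from coordinate functions, so continuity and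
    pull-back of regular functions can be tested on these. *)
Lemma morphism_glue X (A : atlas k) (phi : X -> glue A) :
  kalgebraic X ->
  (forall i, open (phi @^-1` (adom i : set (glue A)))) ->
  (forall i a, afun i a -> regular X (phi @^-1` (adom i : set (glue A))) (a \o phi)) ->
  morphism phi.
Proof.
move=> hX oi ra.
have cont : continuous phi.
  apply/continuousP => O oO; rewrite openE => x Ox; rewrite /interior.
  apply: (@glued_nbhs_ind A (phi x) (fun B => nbhs x (phi @^-1` B))) oO Ox.
  - exact: filterT.
  - by move=> B C; apply: filterI.
  - by move=> B C BC; apply: filterS => y /BC.
  - move=> i a ia ix ax; apply: open_nbhs_nbhs; split=> //.
    exact: open_nonzero (oi i) (ra i a ia).
split=> //.
move=> V f oV Vf; have oV' : open (phi @^-1` V) by move/continuousP: cont; apply.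
apply: regular_glue => // x Vx.
have [i [a [b [W [ia ib oW Wx WP]]]]] := Vf (phi x) Vx.
have oW' : open (phi @^-1` W) by move/continuousP: cont; apply.
exists (phi @^-1` W); split=> //; first by move=> y /WP[].
apply: (@regular_ext _ X _ (fun y => a (phi y) / b (phi y))).
  by move=> y /WP[_ _ _ /= ->].
apply: regular_res (regular_quotient hX (oi i) (ra i a ia) (ra i b ib)) => //.
  exact: open_nonzero (oi i) (ra i b ib).
by move=> y /WP[_ iy b0 _].
Qed.

Lemma morphism_comp X Y (Z : kspace k) (phi : X -> Y) (psi : Y -> Z) :
  morphism phi -> morphism psi -> morphism (psi \o phi).
Proof.
move=> [cphi rphi] [cpsi rpsi]; split.
  apply/continuousP => V oV; have /continuousP c1 := cphi.
  by have /continuousP c2 := cpsi; apply: (c1 (psi @^-1` V)); apply: c2.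
move=> V f oV Vf; have /continuousP c2 := cpsi.
exact: (rphi (psi @^-1` V) (f \o psi) (c2 V oV) (rpsi V f oV Vf)).
Qed.

Lemma morphism_cst X (hX : kalgebraic X) Y (y : Y) : morphism (fun _ : X => y).
Proof.
split; first by move=> x; apply: cvg_cst.
move=> V f oV _; apply: regular_ext (regular_cst hX (f y) _) => //.
have /continuousP : continuous (fun _ : X => y) by move=> x; apply: cvg_cst.
exact.
Qed.

End Algebra.

(** * Finite sums and tensor products of function spaces *)

Section Spans.
Variables (k : fieldType) (T : Type).
Implicit Types (S : set (T -> k)) (a b : T -> k).

Definition sums_of S : set (T -> k) :=
  [set a | exists (N : nat) (h : 'I_N -> T -> k), (forall i, S (h i)) /\
     a = fun z => \sum_i h i z].

Lemma sums_of0 S : sums_of S (fun=> 0).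
Proof.
exists 0%N, (fun _ => fun=> 0); split; first by case.
by apply/funext => z; rewrite big_ord0.
Qed.

Lemma sums_of1 S a : S a -> sums_of S a.
Proof.
move=> Sa; exists 1%N, (fun _ => a); split=> //.
by apply/funext => z; rewrite big_ord1.
Qed.

Lemma sums_ofD S a b : sums_of S a -> sums_of S b -> sums_of S (fun x => a x + b x).
Proof.
move=> [N [h [Sh ->]]] [N' [h' [Sh' ->]]].
exists (N + N')%N, (fun i => match fintype.split i with inl i => h i | inr i => h' i end).
split; first by move=> i; case: (fintype.split i).
apply/funext => z; rewrite big_split_ord /=; congr (_ + _); apply: eq_bigr => i _.
  by rewrite (unsplitK (inl i)).
by rewrite (unsplitK (inr i)).
Qed.

Lemma sums_of_sum S N (h : 'I_N -> T -> k) : (forall i, sums_of S (h i)) ->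
  sums_of S (fun x => \sum_i h i x).
Proof.
elim: N h => [|N IHN] h Sh.
  by have := sums_of0 S; congr (sums_of S _); apply/funext => z; rewrite big_ord0.
have := sums_ofD (Sh ord0) (IHN _ (fun i => Sh (lift ord0 i))).
by congr (sums_of S _); apply/funext => z; rewrite big_ord_recl.
Qed.

Lemma sums_ofM S (D : set T) a b :
  (forall f g, S f -> S g -> exists2 c, S c & forall z, D z -> c z = f z * g z) ->
  sums_of S a -> sums_of S b ->
  exists2 c, sums_of S c & forall z, D z -> c z = a z * b z.
Proof.
move=> SM [N [h [Sh ->]]] [N' [h' [Sh' ->]]].
have /choice[c Hc] : forall ij : 'I_N * 'I_N', exists c,
    S c /\ forall z, D z -> c z = h ij.1 z * h' ij.2 z.
  by move=> [i j]; have [c Sc Dc] := SM _ _ (Sh i) (Sh' j); exists c.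
exists (fun z => \sum_i \sum_j c (i, j) z).
  apply: sums_of_sum => i; apply: sums_of_sum => j; apply: sums_of1.
  by case: (Hc (i, j)).
move=> z Dz; rewrite big_distrl; apply: eq_bigr => i _.
by rewrite big_distrr; apply: eq_bigr => j _; case: (Hc (i, j)) => _ ->.
Qed.

End Spans.

Section Tensor.
Variables (k : fieldType) (S T : Type) (P : set (S -> k)) (Q : set (T -> k)).

Definition tensor : set (S * T -> k) :=
  [set a | exists (N : nat) (f : 'I_N -> S -> k) (g : 'I_N -> T -> k),
     (forall i, P (f i) /\ Q (g i)) /\ a = fun z => \sum_i f i z.1 * g i z.2].

Definition pure_tensor : set (S * T -> k) :=
  [set a | exists f g, [/\ P f, Q g & a = fun z => f z.1 * g z.2]].

Lemma tensorE : tensor = sums_of pure_tensor.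
Proof.
apply/seteqP; split=> a.
  move=> [N [f [g [PQ ->]]]]; exists N, (fun i z => f i z.1 * g i z.2); split=> // i.
  by exists (f i), (g i); case: (PQ i).
move=> [N [h [Sh ->]]].
have /choice[fg Hfg] : forall i, exists fg : (S -> k) * (T -> k),
    [/\ P fg.1, Q fg.2 & h i = fun z => fg.1 z.1 * fg.2 z.2].
  by move=> i; have [f [g Hfg]] := Sh i; exists (f, g).
exists N, (fun i => (fg i).1), (fun i => (fg i).2); split.
  by move=> i; case: (Hfg i).
by apply/funext => z; apply: eq_bigr => i _; case: (Hfg i) => _ _ ->.
Qed.

Lemma tensor1 f g : P f -> Q g -> tensor (fun z => f z.1 * g z.2).
Proof. by move=> Pf Qg; rewrite tensorE; apply: sums_of1; exists f, g. Qed.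

Lemma tensorD a b : tensor a -> tensor b -> tensor (fun x => a x + b x).
Proof. by rewrite tensorE; apply: sums_ofD. Qed.

Lemma tensorM a b :
  (forall f f', P f -> P f' -> P (fun x => f x * f' x)) ->
  (forall g g', Q g -> Q g' -> Q (fun x => g x * g' x)) ->
  tensor a -> tensor b -> tensor (fun x => a x * b x).
Proof.
move=> PM QM; rewrite tensorE => ta tb.
have [|c tc Dc] := sums_ofM (D := setT) _ ta tb.
  move=> _ _ [f [g [Pf Qg ->]]] [f' [g' [Pf' Qg' ->]]].
  exists (fun z => (f z.1 * f' z.1) * (g z.2 * g' z.2)); last by move=> z _; rewrite mulrACA.
  exists (fun x => f x * f' x), (fun x => g x * g' x); split=> //; [exact: PM | exact: QM].
by move: tc; congr (sums_of _ _); apply/funext => z; rewrite Dc.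
Qed.

End Tensor.

(** * Products, affine sets, the projective line and toric surfaces *)

Section Products.
Variables (k : fieldType) (X Y : kspace k) (hX : kalgebraic X) (hY : kalgebraic Y).

Lemma prod_chart_rings : chart_rings (prod_atlas X Y).
Proof.
split=> -[U V] x.
- move=> c [/= oU oV Ux Vx].
  rewrite (_ : (fun=> c) = fun z => c * 1); last by apply/funext => z; rewrite mulr1.
  by apply: (tensor1 (f := fun=> c) (g := fun=> 1)); apply: regular_cst.
- by move=> a b [/= oU oV Ux Vx]; apply: tensorD.
- move=> a b [/= oU oV Ux Vx] ia ib; exists (fun z => a z * b z) => //.
  by apply: tensorM ia ib => f g; apply: regularM.
Qed.

Lemma prod_chart_compatible : chart_compatible (prod_atlas X Y).
Proof.
move=> x [U V] [U' V'] [/= oU oV Ux Vx] [/= oU' oV' Ux' Vx'].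
have ix : @adom _ (prod_atlas X Y) (U `&` U', V `&` V') x.
  by split=> //=; apply: openI.
exists (U `&` U', V `&` V').
split=> a [N [f [g [fg ->]]]]; apply: (chart_quotient_afun prod_chart_rings ix);
  exists N, f, g; split=> // i; have [fr gr] := fg i; split.
- by apply: regular_res fr => //; [apply: openI | move=> ? []].
- by apply: regular_res gr => //; [apply: openI | move=> ? []].
- by apply: regular_res fr => //; [apply: openI | move=> ? []].
- by apply: regular_res gr => //; [apply: openI | move=> ? []].
Qed.

Lemma prod_kalgebraic : kalgebraic (kprod X Y).
Proof.
apply: (glued_kalgebraic prod_chart_rings prod_chart_compatible) => x.
by exists (setT, setT); split=> //; apply: openT.
Qed.

Lemma slice_morphism (x : X) : morphism (fun y : Y => (x, y) : kprod X Y).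
Proof.
apply: (morphism_glue (A := prod_atlas X Y) hY) => -[U V].
  (* Charts are indexed by pairs of arbitrary sets; the chart is empty when one of them is not
     open. *)
  have [[oU [oV Ux]]|h] := pselect (open U /\ open V /\ U x).
    by rewrite (_ : _ @^-1` _ = V) //; apply/seteqP; split=> y //= [].
  rewrite (_ : _ @^-1` _ = set0); first exact: open0.
  by apply/seteqP; split=> y //= [/= *]; apply: h.
move=> a [N [f [g [fg ->]]]].
have [[oU [oV Ux]]|h] := pselect (open U /\ open V /\ U x).
  rewrite (_ : _ @^-1` _ = V); last by apply/seteqP; split=> y //= [].
  apply: (regular_sum hY oV (f := fun i y => f i x * g i y)) => i.
  by apply: (regularM hY oV); [apply: regular_cst | case: (fg i)].
rewrite (_ : _ @^-1` _ = set0); last first.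
  by apply/seteqP; split=> y //= [/= *]; apply: h.
by apply: regular_glue; [exact: open0 | move=> y []].
Qed.

End Products.

Section Affine.
Variables (k : fieldType) (n : nat) (I : set {mpoly k[n]}).

Lemma affine_chart_rings : chart_rings (affine_atlas I).
Proof.
split=> -[] x.
- by move=> c _; exists c%:MP; apply/funext => y; rewrite mevalC.
- by move=> _ _ _ [P ->] [Q ->]; exists (P + Q); apply/funext => y; rewrite mevalD.
- move=> _ _ _ [P ->] [Q ->]; exists (fun y => (P * Q).@[sval y]).
    by exists (P * Q).
  by move=> y _; rewrite mevalM.
Qed.

Lemma affine_chart_compatible : chart_compatible (affine_atlas I).
Proof.
move=> x [] [] ix _; exists tt.
by split=> a; apply: (chart_quotient_afun affine_chart_rings ix).
Qed.

Lemma affine_kalgebraic : kalgebraic (affine_set I).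
Proof.
by apply: (glued_kalgebraic affine_chart_rings affine_chart_compatible); exists tt.
Qed.

End Affine.

Section ProjectiveLine.
Variable k : fieldType.

Lemma P1_chart_rings : chart_rings (P1_atlas k).
Proof.
split=> b x.
- by move=> c _; exists c%:P; apply/funext => y; rewrite hornerC.
- by move=> _ _ _ [P ->] [Q ->]; exists (P + Q); apply/funext => y; rewrite hornerD.
- move=> _ _ _ [P ->] [Q ->]; exists (fun y => (P * Q).[P1_coord b y]).
    by exists (P * Q).
  by move=> y _; rewrite hornerM.
Qed.

Lemma horner_inv (P : {poly k}) :
  exists (Q : {poly k}) (N : nat), forall t, t != 0 -> P.[t^-1] = Q.[t] / t ^+ N.
Proof.
elim/poly_ind: P => [|P c [Q [N PQ]]].
  by exists 0, 0%N => t _; rewrite !horner0 mul0r.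
exists (Q + c%:P * 'X^(N.+1)), N.+1 => t t0.
by rewrite !hornerE ?hornerXn PQ // mulrDl mulfK ?expf_neq0 // exprSr invfM mulrA.
Qed.

(** It holds at [Some 0] and [None] too, where both coordinates are 0 and [0^-1 = 0]. *)
Lemma P1_coord_inv b (z : P1 k) : P1_coord (~~ b) z = (P1_coord b z)^-1.
Proof. by case: b z => [] [t|] /=; rewrite ?invrK ?invr0. Qed.

Lemma P1_chart_compatible : chart_compatible (P1_atlas k).
Proof.
move=> x b b' bx b'x; exists b; split=> a; first exact: (chart_quotient_afun P1_chart_rings bx).
have [->|bb'] := eqVneq b' b; first exact: (chart_quotient_afun P1_chart_rings bx).
have {bb'} Db' : b' = ~~ b by move: bb'; case: b' b {bx b'x} => [] [].
move=> [P ->]; have [Q [N PQ]] := horner_inv P.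
have x0 : P1_coord b x != 0.
  rewrite {}Db' in b'x; case: b x bx b'x => [] [t|] //= h h'.
    by rewrite invr_eq0; apply/eqP => t0; apply: h; rewrite t0.
  by apply/eqP => t0; apply: h'; rewrite t0.
have iN : @afun _ (P1_atlas k) b (fun z => ('X^N * 'X : {poly k}).[P1_coord b z]).
  by exists ('X^N * 'X).
(* The extra factor ['X] makes the denominator vanish at the point missing from the other chart even
   when [N = 0]. *)
exists (fun z => (Q * 'X).[P1_coord b z]), (fun z => ('X^N * 'X).[P1_coord b z]).
exists [set z | adom b z /\ ('X^N * 'X : {poly k}).[P1_coord b z] != 0]; split=> //.
- by exists (Q * 'X).
- exact: (open_principal iN).
- by split=> //; rewrite !hornerE ?hornerXn mulf_neq0 ?expf_neq0.
move=> z [bz]; rewrite !hornerE ?hornerXn => nz; split=> //.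
have z0 : P1_coord b z != 0 by apply: contraNneq nz => ->; rewrite mulr0.
by rewrite Db' P1_coord_inv PQ // -mulf_div divff // mulr1.
Qed.

Lemma P1_kalgebraic : kalgebraic (P1 k).
Proof.
apply: (glued_kalgebraic P1_chart_rings P1_chart_compatible) => -[t|].
  by exists false.
by exists true.
Qed.

End ProjectiveLine.

Section ToricSurface.
Variables (k : fieldType) (n : nat) (F : fan n).

Lemma pairingDl (m m' v : 'rV[int]_2) : pairing (m + m') v = pairing m v + pairing m' v.
Proof. by rewrite /pairing -big_split; apply: eq_bigr => i _; rewrite mxE mulrDl. Qed.

Lemma pairing0l (v : 'rV[int]_2) : pairing 0 v = 0.
Proof. by rewrite /pairing big1 // => i _; rewrite mxE mul0r. Qed.

Lemma dualP (s : {set 'I_n}) m :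
  reflect (forall i, i \in s -> 0 <= pairing m (gen F i)) (dual F s m).
Proof. exact: forall_inP. Qed.

Lemma perpP (s : {set 'I_n}) m :
  reflect (forall i, i \in s -> pairing m (gen F i) = 0) (perp F s m).
Proof. by apply: (iffP forall_inP) => h i /h => [/eqP|->]. Qed.

Lemma dualD (s : {set 'I_n}) m m' : dual F s m -> dual F s m' -> dual F s (m + m').
Proof.
by move=> /dualP h /dualP h'; apply/dualP => i si; rewrite pairingDl addr_ge0 ?h ?h'.
Qed.

(** A sum of nonnegative integers vanishes only if both terms do: the orthogonal of [s] is a face of
    its dual monoid. *)
Lemma perpD (s : {set 'I_n}) m m' : dual F s m -> dual F s m' ->
  perp F s (m + m') = perp F s m && perp F s m'.
Proof.
move=> /dualP h /dualP h'; apply/perpP/andP => [mm'|[/perpP p /perpP p']]; last first.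
  by move=> i si; rewrite pairingDl p ?p'.
split; apply/perpP => i si; have := mm' i si; rewrite pairingDl => /eqP;
  by rewrite paddr_eq0 ?h ?h' // => /andP[/eqP ? /eqP ?].
Qed.

Lemma perp0 (s : {set 'I_n}) : perp F s 0.
Proof. by apply/perpP => i _; rewrite pairing0l. Qed.

Lemma dual_perp (s : {set 'I_n}) m : perp F s m -> dual F s m.
Proof. by move=> /perpP h; apply/dualP => i /h ->. Qed.

Lemma dualS (s t : {set 'I_n}) m : s \subset t -> dual F t m -> dual F s m.
Proof. by move=> /fintype.subsetP st /dualP h; apply/dualP => i /st /h. Qed.

Lemma chi_neq0 m (x : toric_point k F) : (chi m x != 0) = perp F (orbit_cone x) m.
Proof. by have [_ h _ _] := proj2_sig x; apply: h. Qed.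

Lemma chi0 (x : toric_point k F) : chi 0 x = 1.
Proof. by have [_ _ h _] := proj2_sig x. Qed.

Lemma orbit_cone_in (x : toric_point k F) : orbit_cone x \in cones F.
Proof. by have [] := proj2_sig x. Qed.

(** Extension by zero off a face of a monoid stays multiplicative on the monoid ([perpD]). *)
Lemma chiD m m' (x : toric_point k F) : dual F (orbit_cone x) m ->
  dual F (orbit_cone x) m' -> chi (m + m') x = chi m x * chi m' x.
Proof.
move=> dm dm'; have pD := perpD dm dm'; have eq0 v := esym (chi_neq0 v x).
have [pm|pm] := boolP (perp F (orbit_cone x) m); last first.
  rewrite (negPf pm) /= in pD; move: pm pD; rewrite !eq0 negbK => /eqP-> /negbFE/eqP->.
  by rewrite mul0r.
have [pm'|pm'] := boolP (perp F (orbit_cone x) m'); last first.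
  rewrite (negPf pm') andbF in pD; move: pm' pD; rewrite !eq0 negbK => /eqP-> /negbFE/eqP->.
  by rewrite mulr0.
by have [_ _ _ h] := proj2_sig x; apply: h.
Qed.

Definition monomial s : set (toric_point k F -> k) :=
  [set a | exists c m, dual F s m /\ a = fun x => c * chi m x].

Lemma toric_afunE s : @afun _ (toric_atlas k F) s = sums_of (monomial s).
Proof.
apply/seteqP; split=> a.
  move=> [N [c [m [dm ->]]]]; exists N, (fun i x => c i * chi (m i) x); split=> // i.
  by exists (c i), (m i).
move=> [N [h [Sh ->]]].
have /choice[cm Hcm] : forall i, exists cm : k * 'rV[int]_2,
    dual F s cm.2 /\ h i = fun x => cm.1 * chi cm.2 x.
  by move=> i; have [c [m H]] := Sh i; exists (c, m).
exists N, (fun i => (cm i).1), (fun i => (cm i).2); split.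
  by move=> i; case: (Hcm i).
by apply/funext => z; apply: eq_bigr => i _; case: (Hcm i) => _ ->.
Qed.

Lemma toric_chart_rings : chart_rings (toric_atlas k F).
Proof.
split=> s x.
- move=> c _; rewrite toric_afunE; apply: sums_of1; exists c, 0; split.
    by apply: dual_perp; apply: perp0.
  by apply/funext => y; rewrite chi0 mulr1.
- by move=> a b _; rewrite toric_afunE; apply: sums_ofD.
- move=> a b _; rewrite toric_afunE; apply: sums_ofM.
  move=> _ _ [c [m [dm ->]]] [c' [m' [dm' ->]]].
  exists (fun x => c * c' * chi (m + m') x); first by exists (c * c'), (m + m'); rewrite dualD.
  by move=> y [_ ys]; rewrite chiD ?(dualS ys) // mulrACA.
Qed.

(** Two charts overlap in the chart of the common face, where the coordinate functions of both are
    coordinate functions. *)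
Lemma toric_chart_compatible : chart_compatible (toric_atlas k F).
Proof.
move=> x s s' [sF xs] [sF' xs'].
have ix : @adom _ (toric_atlas k F) (s :&: s')%SET x.
  split; last by rewrite finset.subsetI xs xs'.
  by apply: fan_face sF _; apply: finset.subsetIl.
exists (s :&: s')%SET; split=> a [N [c [m [dm ->]]]];
  apply: (chart_quotient_afun toric_chart_rings ix); exists N, c, m; split=> // i.
  exact: dualS (finset.subsetIl _ _) (dm i).
exact: dualS (finset.subsetIr _ _) (dm i).
Qed.

Lemma toric_kalgebraic : kalgebraic (toric k F).
Proof.
apply: (glued_kalgebraic toric_chart_rings toric_chart_compatible) => x.
by exists (orbit_cone x); split=> //; apply: orbit_cone_in.
Qed.

End ToricSurface.

(** * Generic charts *)

Section GenericCharts.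
Variable k : fieldType.

(** Nonvanishing somewhere on [D], that is, being nonzero as a function on [D]. *)
Definition nonzero_on (T : Type) (D : set T) (a : T -> k) : Prop := exists x, D x /\ a x != 0.

(** A ring of functions that becomes an integral domain modulo vanishing on [D]; [fd_domain]
    expresses this by points. *)
Record function_domain (T : Type) (D : set T) (R : set (T -> k)) : Prop := FunctionDomain {
  fd_nonempty : D !=set0;
  fd_cst : forall c, R (fun=> c);
  fdD : forall a b, R a -> R b -> R (fun x => a x + b x);
  fdM : forall a b, R a -> R b -> exists2 c, R c & forall x, D x -> c x = a x * b x;
  fd_domain : forall a b, R a -> R b -> nonzero_on D a -> nonzero_on D b ->
    exists x, [/\ D x, a x != 0 & b x != 0] }.

Lemma fd_sum T (D : set T) R (hR : function_domain D R) N (f : 'I_N -> T -> k) :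
  (forall i, exists2 c, R c & forall x, D x -> c x = f i x) ->
  exists2 c, R c & forall x, D x -> c x = \sum_i f i x.
Proof.
elim: N f => [|N IHN] f Rf.
  by exists (fun=> 0); [exact: (fd_cst hR) | move=> x _; rewrite big_ord0].
have [c Rc Dc] := Rf ord0; have [i|c' Rc' Dc'] := IHN (fun i => f (lift ord0 i)).
  exact: Rf.
exists (fun x => c x + c' x); first exact: (fdD hR).
by move=> x Dx; rewrite big_ord_recl Dc // Dc'.
Qed.

Lemma fdM_nonzero T (D : set T) R (hR : function_domain D R) a b : R a -> R b ->
  nonzero_on D a -> nonzero_on D b ->
  exists c, [/\ R c, nonzero_on D c & forall x, D x -> c x = a x * b x].
Proof.
move=> Ra Rb na nb; have [x [Dx ax bx]] := fd_domain hR Ra Rb na nb.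
have [c Rc Dc] := fdM hR Ra Rb; exists c; split=> //.
by exists x; rewrite Dc // mulf_neq0.
Qed.

(** For [fd_domain], treat one variable at a time: a(., y0) and b(., y1) are nonzero and share a
    point x off their zeros; then a(x, .) and b(x, .) share a point y. *)
Lemma fd_tensor S T (D : set S) (E : set T) P Q :
  function_domain D P -> function_domain E Q ->
  function_domain [set z | D z.1 /\ E z.2] (tensor P Q).
Proof.
move=> hP hQ; split.
- have [x Dx] := fd_nonempty hP; have [y Ey] := fd_nonempty hQ; by exists (x, y).
- move=> c; rewrite (_ : (fun=> c) = fun z => c * 1); last by apply/funext => z; rewrite mulr1.
  by apply: (tensor1 (f := fun=> c) (g := fun=> 1)); [apply: (fd_cst hP) | apply: (fd_cst hQ)].
- exact: tensorD.
- move=> a b; rewrite tensorE => ta tb; apply: sums_ofM ta tb.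
  move=> _ _ [f [g [Pf Qg ->]]] [f' [g' [Pf' Qg' ->]]].
  have [c Pc Dc] := fdM hP Pf Pf'; have [d Qd Dd] := fdM hQ Qg Qg'.
  exists (fun z => c z.1 * d z.2); first by exists c, d.
  by move=> z [Dz Ez]; rewrite Dc // Dd // mulrACA.
have slice1 a y : tensor P Q a -> exists2 c, P c & forall x, D x -> c x = a (x, y).
  move=> [N [f [g [PQ ->]]]]; apply: (fd_sum hP) => i /=.
  have [Pf _] := PQ i; have [c Pc Dc] := fdM hP Pf (fd_cst hP (g i y)).
  by exists c.
have slice2 a x : tensor P Q a -> exists2 c, Q c & forall y, E y -> c y = a (x, y).
  move=> [N [f [g [PQ ->]]]]; apply: (fd_sum hQ) => i /=.
  have [_ Qg] := PQ i; have [c Qc Dc] := fdM hQ (fd_cst hQ (f i x)) Qg.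
  by exists c.
move=> a b ta tb [[x0 y0] /= [[Dx0 Ey0] a0]] [[x1 y1] /= [[Dx1 Ey1] b1]].
have [a' Pa' Da'] := slice1 a y0 ta; have [b' Pb' Db'] := slice1 b y1 tb.
have [||x [Dx]] := fd_domain hP Pa' Pb'; first by exists x0; rewrite Da'.
  by exists x1; rewrite Db'.
rewrite Da' // Db' // => ax bx.
have [a2 Qa2 Da2] := slice2 a x ta; have [b2 Qb2 Db2] := slice2 b x tb.
have [||y [Ey]] := fd_domain hQ Qa2 Qb2; first by exists y0; rewrite Da2.
  by exists y1; rewrite Db2.
by rewrite Da2 // Db2 // => ay b_y; exists (x, y).
Qed.

(** [D] plays the role of a dense affine open set with coordinate ring [R]. This is enough for
    irreducibility ([gc_irreducible]) and for the function field to be the field of fractions of [R]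
    ([chart_function_field]). *)
Record generic_chart (X : kspace k) (D : set X) (R : set (X -> k)) : Prop := GenericChart {
  gc_fd : function_domain D R;
  gc_open : open D;
  gc_regular : forall a, R a -> regular X D a;
  gc_quotient : forall U f, open U -> U !=set0 -> regular X U f ->
    exists a b, [/\ R a, R b, nonzero_on D b &
      forall x, D x -> b x != 0 -> U x /\ f x = a x / b x] }.

Lemma gc_dense X (hX : kalgebraic X) D R (gX : @generic_chart X D R) U : open U -> U !=set0 ->
  exists b, [/\ R b, nonzero_on D b & forall x, D x -> b x != 0 -> U x].
Proof.
move=> oU U0; have [a [b [_ Rb nb h]]] := gc_quotient gX oU U0 (regular_cst hX 1 oU).
by exists b; split=> // x Dx bx; case: (h x Dx bx).
Qed.

Lemma gc_irreducible X (hX : kalgebraic X) D R (gX : @generic_chart X D R) :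
  irreducible_space X.
Proof.
have [x Dx] := fd_nonempty (gc_fd gX); split; first by exists x.
move=> U V oU oV U0 V0.
have [b [Rb nb hb]] := gc_dense hX gX oU U0; have [c [Rc nc hc]] := gc_dense hX gX oV V0.
have [y [Dy yb yc]] := fd_domain (gc_fd gX) Rb Rc nb nc.
by exists y; split; [apply: hb | apply: hc].
Qed.

(** It suffices that the coordinate functions of all charts become fractions of [R] on [D]. The last
    clause is density: a coordinate function nonzero at some point of its chart stays nonzero
    generically on [D]. *)
Lemma glued_generic_chart (A : atlas k) (hA : chart_rings A) (D : set (glue A)) R :
  function_domain D R -> open D -> (forall a, R a -> regular (glue A) D a) ->
  (forall i a (x : apoint A), afun i a -> adom i x ->
     exists c d, [/\ R c, R d, nonzero_on D d,
       forall y : apoint A, D y -> d y != 0 -> adom i y /\ a y = c y / d y &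
       a x != 0 -> nonzero_on D c]) ->
  generic_chart D R.
Proof.
move=> fR oD regR qR; split=> // U f oU [x Ux] /(regular_gluedP _ oU) Uf.
(* Each nonempty open set contains the locus in [D] where some nonzero element of [R] does not
   vanish. *)
have dense (O : set (glue A)) : open O -> O x ->
    exists b, [/\ R b, nonzero_on D b & forall y, D y -> b y != 0 -> O y].
  apply: (glued_nbhs_ind (Q := fun O =>
    exists b, [/\ R b, nonzero_on D b & forall y, D y -> b y != 0 -> O y])).
  - exists (fun=> 1); split=> //; first exact: (fd_cst fR).
    by have [y Dy] := fd_nonempty fR; exists y; rewrite oner_neq0.
  - move=> B C [b [Rb nb hb]] [c [Rc nc hc]].
    have [e [Re ne De]] := fdM_nonzero fR Rb Rc nb nc; exists e; split=> // y Dy.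
    by rewrite De // mulf_eq0 negb_or => /andP[yb yc]; split; [apply: hb | apply: hc].
  - by move=> B C BC [b [Rb nb hb]]; exists b; split=> // y Dy /hb => /(_ Dy)/BC.
  - move=> i a ia ix ax; have [c [d [Rc Rd nd hcd nc]]] := qR i a x ia ix.
    have [e [Re ne De]] := fdM_nonzero fR Rc Rd (nc ax) nd; exists e; split=> // y Dy.
    rewrite De // mulf_eq0 negb_or => /andP[yc yd]; have [iy ay] := hcd y Dy yd.
    by split=> //=; rewrite ay mulf_neq0 // invr_eq0.
have [i [a [b [V [ia ib oV Vx VP]]]]] := Uf x Ux.
have [ix bx _] := VP x Vx.
have [c [d [Rc Rd nd hcd _]]] := qR i a x ia ix.
have [c' [d' [Rc' Rd' nd' hcd' nc']]] := qR i b x ib ix.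
have [h [Rh nh hV]] := dense (V `&` U) (openI oV oU) (conj Vx Ux).
have [n1 Rn1 Dn1] := fdM fR Rc Rd'.
have [n2 Rn2 Dn2] := fdM fR Rn1 Rh.
have [n3 Rn3 Dn3] := fdM fR Rn2 Rd'.
have [e1 [Re1 ne1 De1]] := fdM_nonzero fR Rd Rc' nd (nc' bx).
have [e2 [Re2 ne2 De2]] := fdM_nonzero fR Re1 Rh ne1 nh.
have [e3 [Re3 ne3 De3]] := fdM_nonzero fR Re2 Rd' ne2 nd'.
(* The quotient (c / d) / (c' / d') is c d' / (d c'); the additional factors h and d' in both terms
   force [y] into [V] and [U] and [d' y] to be nonzero. *)
exists n3, e3; split=> // y Dy; rewrite De3 // De2 // De1 // Dn3 // Dn2 // Dn1 //.
rewrite !mulf_eq0 !negb_or => /andP[/andP[/andP[yd yc'] yh] yd'].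
have [Vy Uy] := hV y Dy yh; split=> //.
have [_ by0 ->] := VP y Vy; have [_ ->] := hcd y Dy yd; have [_ ->] := hcd' y Dy yd'.
by field; rewrite yd yc' yh yd'.
Qed.

Lemma gc_common_denominator X (hX : kalgebraic X) D R (gX : @generic_chart X D R)
    U N (f : 'I_N -> X -> k) : open U -> U !=set0 -> (forall i, regular X U (f i)) ->
  exists (c : 'I_N -> X -> k) (d : X -> k), [/\ forall i, R (c i), R d, nonzero_on D d &
    forall x, D x -> d x != 0 -> U x /\ forall i, f i x = c i x / d x].
Proof.
move=> oU U0; elim: N f => [|N IHN] f fU.
  have [b [Rb nb hb]] := gc_dense hX gX oU U0.
  by exists (fun _ => fun=> 0), b; split=> // [[]|x Dx /hb -/(_ Dx)] //; split=> // -[].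
have [c [d [Rc Rd nd hd]]] := IHN (fun i => f (lift ord0 i)) (fun i => fU _).
have [a [b [Ra Rb nb hab]]] := gc_quotient gX oU U0 (fU ord0).
have fR := gc_fd gX.
have [e [Re ne De]] := fdM_nonzero fR Rd Rb nd nb.
have [a' Ra' Da'] := fdM fR Ra Rd.
have /choice[c' Hc'] : forall i, exists c', R c' /\ forall x, D x -> c' x = c i x * b x.
  by move=> i; have [c' Rc' Dc'] := fdM fR (Rc i) Rb; exists c'.
exists (fun i => if unlift ord0 i is Some j then c' j else a'), e; split=> //.
  by move=> i; case: unliftP => [j|] _ //; case: (Hc' j).
move=> x Dx; rewrite De // mulf_eq0 negb_or => /andP[xd xb].
have [Ux fx] := hab x Dx xb; have [_ fxi] := hd x Dx xd; split=> // i.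
case: unliftP => [j ->|->].
  have [_ ->] := Hc' j; rewrite // fxi; by field; rewrite xd xb.
by rewrite fx Da' //; field; rewrite xd xb.
Qed.

Lemma prod_generic_chart (X Y : kspace k) (hX : kalgebraic X) (hY : kalgebraic Y)
    D R E S : @generic_chart X D R -> @generic_chart Y E S ->
  @generic_chart (kprod X Y) [set z | D z.1 /\ E z.2] (tensor R S).
Proof.
move=> gX gY; have fX := gc_fd gX; have fY := gc_fd gY.
have hA := prod_chart_rings hX hY.
have DE : [set z : X * Y | D z.1 /\ E z.2] = @adom _ (prod_atlas X Y) (D, E).
  apply/seteqP; split=> z; last by case.
  by move=> [Dz Ez]; split=> //; apply: gc_open; eassumption.
apply: (glued_generic_chart (A := prod_atlas X Y) hA).
- exact: fd_tensor.
- by rewrite DE; apply: (open_adom hA).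
- move=> a [N [f [g [fg ->]]]]; rewrite DE; apply: (regular_afun hA).
  exists N, f, g; split=> // i; have [Rf Sg] := fg i.
  by split; [apply: (gc_regular gX) | apply: (gc_regular gY)].
move=> [U V] a [x0 y0] [N [f [g [fg ->]]]] /= [/= oU oV Ux Vy].
have U0 : U !=set0 by exists x0. have V0 : V !=set0 by exists y0.
have [c [d [Rc Rd nd hd]]] := gc_common_denominator hX gX oU U0 (fun i => proj1 (fg i)).
have [c' [d' [Sc Sd nd' hd']]] := gc_common_denominator hY gY oV V0 (fun i => proj2 (fg i)).
exists (fun z => \sum_i c i z.1 * c' i z.2), (fun z => d z.1 * d' z.2).
have val x y : D x -> E y -> d x != 0 -> d' y != 0 ->
    \sum_i f i x * g i y = (\sum_i c i x * c' i y) / (d x * d' y).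
  move=> Dx Ey dx dy; rewrite mulr_suml; apply: eq_bigr => i _.
  have [_ ->] := hd x Dx dx; have [_ ->] := hd' y Ey dy; by field; rewrite dx dy.
split.
- by exists N, c, c'; split=> // i; split.
- exact: tensor1.
- have [x [Dx dx]] := nd; have [y [Ey dy]] := nd'.
  by exists (x, y); split=> //=; rewrite mulf_neq0.
- move=> [x y] /= [Dx Ey]; rewrite mulf_eq0 negb_or => /andP[dx dy].
  have [Ux' _] := hd x Dx dx; have [Vy' _] := hd' y Ey dy.
  by rewrite val //; split=> //; split.
(* Density of the product chart: move x0 into [D], then y0 into [E], keeping the sum nonzero. *)
move=> a0.
have rX : regular X U (fun x => \sum_i f i x * g i y0).
  apply: (regular_sum hX oU) => i; apply: (regularM hX oU); first by case: (fg i).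
  exact: regular_cst.
have [|b [Rb nb hb]] := gc_dense hX gX (open_nonzero hX oU rX).
  by exists x0.
have [x [Dx dx bx]] := fd_domain fX Rd Rb nd nb.
have [Ux' fx] := hb x Dx bx.
have rY : regular Y V (fun y => \sum_i f i x * g i y).
  apply: (regular_sum hY oV) => i; apply: (regularM hY oV); last by case: (fg i).
  exact: regular_cst.
have [|b' [Sb nb' hb']] := gc_dense hY gY (open_nonzero hY oV rY).
  by exists y0.
have [y [Ey dy b'y]] := fd_domain fY Sd Sb nd' nb'.
have [_ fy] := hb' y Ey b'y.
exists (x, y); split=> //=; move: fy; rewrite val //; apply: contraNneq => ->.
by rewrite mul0r.
Qed.

End GenericCharts.

(** * Laurent polynomials and independence of characters *)

Section Laurent.
Variable k : closedFieldType.
Implicit Types (f g : k -> k).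

Definition laurent f := exists (P : {poly k}) (n : nat),
  forall x, x != 0 -> f x * x ^+ n = P.[x].

Lemma laurent_cst c : laurent (fun=> c).
Proof. by exists c%:P, 0%N => x _; rewrite hornerC mulr1. Qed.

Lemma laurentX n : laurent (fun x => x ^ n).
Proof.
case: n => n; first by exists 'X^n, 0%N => x _; rewrite hornerXn mulr1.
by exists 1, n.+1 => x x0; rewrite NegzE -exprnN mulVf ?expf_neq0 // hornerE.
Qed.

Lemma laurentD f g : laurent f -> laurent g -> laurent (fun x => f x + g x).
Proof.
move=> [P [n fP]] [Q [m gQ]]; exists (P * 'X^m + Q * 'X^n), (n + m)%N => x x0.
by rewrite !hornerE -fP // -gQ // exprD; ring.
Qed.

Lemma laurentM f g : laurent f -> laurent g -> laurent (fun x => f x * g x).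
Proof.
move=> [P [n fP]] [Q [m gQ]]; exists (P * Q), (n + m)%N => x x0.
by rewrite !hornerE -fP // -gQ // exprD; ring.
Qed.

Lemma laurent_ext f g : (forall x, x != 0 -> f x = g x) -> laurent f -> laurent g.
Proof. by move=> fg [P [n h]]; exists P, n => x x0; rewrite -fg // h. Qed.

Lemma laurent_sum (I : Type) (r : seq I) (f : I -> k -> k) :
  (forall i, laurent (f i)) -> laurent (fun x => \sum_(i <- r) f i x).
Proof.
move=> lf; elim: r => [|i r IHr].
  by apply: laurent_ext (laurent_cst 0) => x _; rewrite big_nil.
by apply: laurent_ext (laurentD (lf i) IHr) => x _; rewrite big_cons.
Qed.

Lemma laurent_prod (I : Type) (r : seq I) (f : I -> k -> k) :
  (forall i, laurent (f i)) -> laurent (fun x => \prod_(i <- r) f i x).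
Proof.
move=> lf; elim: r => [|i r IHr].
  by apply: laurent_ext (laurent_cst 1) => x _; rewrite big_nil.
by apply: laurent_ext (laurentM (lf i) IHr) => x _; rewrite big_cons.
Qed.

Lemma laurent_exp n f : laurent f -> laurent (fun x => f x ^+ n).
Proof.
move=> lf; elim: n => [|n IHn].
  by apply: laurent_ext (laurent_cst 1) => x _; rewrite expr0.
by apply: laurent_ext (laurentM lf IHn) => x _; rewrite exprS.
Qed.

Lemma horner_nonzero (P : {poly k}) : P != 0 -> exists2 x, x != 0 & P.[x] != 0.
Proof.
move=> P0; have /closed_nonrootP[x] : P * 'X != 0 by rewrite mulf_neq0 ?polyX_eq0.
by rewrite rootE !hornerE mulf_eq0 negb_or => /andP[Px x0]; exists x.
Qed.

Lemma laurent_nonzero2 f g : laurent f -> laurent g ->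
  (exists2 x, x != 0 & f x != 0) -> (exists2 x, x != 0 & g x != 0) ->
  exists x, [/\ x != 0, f x != 0 & g x != 0].
Proof.
move=> [P [n fP]] [Q [m gQ]] [x x0 fx] [y y0 gy].
have P0 : P != 0.
  apply: contraNneq fx => P0; have := fP x x0; rewrite P0 horner0 => /eqP.
  by rewrite mulf_eq0 (negPf (expf_neq0 _ x0)) orbF.
have Q0 : Q != 0.
  apply: contraNneq gy => Q0; have := gQ y y0; rewrite Q0 horner0 => /eqP.
  by rewrite mulf_eq0 (negPf (expf_neq0 _ y0)) orbF.
have [z z0] := horner_nonzero (mulf_neq0 P0 Q0).
rewrite hornerM -fP // -gQ // !mulf_eq0 !negb_or => /andP[/andP[fz _] /andP[gz _]].
by exists z.
Qed.

(** Being Laurent in each variable separately suffices to find common points of nonvanishing, one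
    variable at a time. *)
Definition laurent2 (h : k -> k -> k) :=
  (forall y, y != 0 -> laurent (h^~ y)) /\ (forall x, x != 0 -> laurent (h x)).

Lemma laurent2_nonzero2 h h' : laurent2 h -> laurent2 h' ->
  (exists x y, [/\ x != 0, y != 0 & h x y != 0]) ->
  (exists x y, [/\ x != 0, y != 0 & h' x y != 0]) ->
  exists x y, [/\ x != 0, y != 0, h x y != 0 & h' x y != 0].
Proof.
move=> [l1 l2] [l1' l2'] [x1 [y1 [x10 y10 h1]]] [x2 [y2 [x20 y20 h2]]].
have [||x [x0 hx h'x]] := laurent_nonzero2 (l1 y1 y10) (l1' y2 y20).
- by exists x1.
- by exists x2.
have [||y [y0 hy h'y]] := laurent_nonzero2 (l2 x x0) (l2' x x0).
- by exists y1.
- by exists y2.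
by exists x, y.
Qed.

(* Restricting to the curve (t, t^(2B)) separates finitely many characters.    *)
Lemma characters_independent N (c : 'I_N -> k) (m : 'I_N -> 'rV[int]_2) :
  (forall x y, x != 0 -> y != 0 -> \sum_i c i * (x ^ (m i 0 0) * y ^ (m i 0 1)) = 0) ->
  forall G : 'rV[int]_2 -> k, \sum_i c i * G (m i) = 0.
Proof.
move=> vanish G.
pose m0 i : int := m i 0 0; pose m1 i : int := m i 0 1.
pose B := (\sum_i (`|m0 i| + `|m1 i|)).+1%N.
have bnd i : (`|m0 i| < B)%N /\ (`|m1 i| < B)%N.
  by rewrite /B (bigD1 i) //=; split; lia.
(* As |m0| < B, the exponents m0 + 2B m1 separate the characters; the shift by K makes them natural
   numbers. *)
pose K := (2 * B * B + B)%N.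
pose e i := absz (m0 i + (2 * B)%:Z * m1 i + K%:Z).
have De i : (e i)%:Z = m0 i + (2 * B)%:Z * m1 i + K%:Z.
  have [h0 h1] := bnd i; rewrite /e gez0_abs // /K.
  have : - (B%:Z) <= m0 i by lia.
  have : - (B%:Z) <= m1 i by lia.
  nia.
have e_inj i j : e i = e j -> m i = m j.
  move=> eij; have : (e i)%:Z = (e j)%:Z by rewrite eij.
  rewrite !De => /addIr h; have [h0 h1] := bnd i; have [h0' h1'] := bnd j.
  have h01 : m1 i = m1 j by nia.
  by apply: row2P => //; move: h; rewrite h01 => /addIr.
pose P : {poly k} := \sum_i c i *: 'X^(e i).
have P0 : P = 0.
  apply: contrapT => /eqP/horner_nonzero[x x0] /negP[]; apply/eqP.
  have E := vanish x (x ^ (2 * B)%:Z) x0 (expfz_neq0 _ x0).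
  transitivity ((\sum_i c i * (x ^ m0 i * (x ^ (2 * B)%:Z) ^ m1 i)) * x ^ K%:Z); last first.
    by rewrite E mul0r.
  rewrite /P horner_sum mulr_suml.
  apply: eq_bigr => i _; rewrite hornerZ hornerXn -mulrA; congr (_ * _).
  by rewrite -[x ^+ e i]/(x ^ (e i)%:Z) De !expfzDr // exprz_exp.
(* [G (m i)] depends only on the exponent [e i], so the sum is a linear combination of coefficients
   of [P], which vanish. *)
pose G' j := if [pick i | e i == j] is Some i then G (m i) else 0.
have GG' i : G (m i) = G' (e i).
  rewrite /G'; case: pickP => [i' /eqP/e_inj->//|/(_ i)]; by rewrite eqxx.
pose M := (\max_i e i).+1.
transitivity (\sum_(j < M) P`_j * G' j); last first.
  by rewrite P0 big1 // => j _; rewrite coef0 mul0r.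
under [RHS]eq_bigr => j _ do rewrite coef_sum mulr_suml.
rewrite exchange_big; apply: eq_bigr => i _ /=.
have eM : (e i < M)%N by rewrite ltnS (leq_bigmax i).
rewrite (bigD1 (Ordinal eM)) //= coefZ coefXn eqxx mulr1 -GG' big1 ?addr0 // => j ji.
rewrite coefZ coefXn (_ : (j : nat) == e i = false) ?mulr0 ?mul0r //.
by apply: negbTE; apply: contraNneq ji => je; apply/eqP/val_inj.
Qed.

End Laurent.

(** * Generic charts of the torus, the projective line and the toric surface *)

Section Torus.
Variable k : closedFieldType.

Definition torus_equation : set {mpoly k[3]} :=
  [set P | P = 'X_0 * 'X_1 * 'X_ord_max - 1].
Definition torus : kspace k := affine_set torus_equation.

Lemma torusP (w : torus) : sval w 0 * sval w 1 * sval w ord_max = 1.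
Proof.
have := proj2_sig w _ erefl; rewrite mevalB !mevalM !mevalXU meval1.
by move/eqP; rewrite subr_eq0 => /eqP.
Qed.

Lemma torus_inj (w w' : torus) : sval w = sval w' -> w = w'.
Proof.
case: w w' => [v hv] [v' hv'] /= e; subst v'.
by congr exist; apply: Prop_irrelevance.
Qed.

Lemma torus_neq0 (w : torus) i : sval w i != 0.
Proof.
have := oner_neq0 k; rewrite -(torusP w) !mulf_eq0 !negb_or => /andP[/andP[h0 h1] h2].
case: i => [[|[|[|//]]] hi].
- by rewrite (_ : Ordinal hi = 0) //; apply: val_inj.
- by rewrite (_ : Ordinal hi = 1) //; apply: val_inj.
- by rewrite (_ : Ordinal hi = ord_max) //; apply: val_inj.
Qed.

Definition torus_coords (x y : k) : 'I_3 -> k := fun i => [:: x; y; (x * y)^-1]`_i.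

Lemma torus_coords_eq x y : x != 0 -> y != 0 ->
  forall P : {mpoly k[3]}, torus_equation P -> P.@[torus_coords x y] = 0.
Proof.
move=> x0 y0 _ ->; rewrite mevalB !mevalM !mevalXU meval1 /torus_coords /=.
by rewrite divff ?subrr // mulf_neq0.
Qed.

Definition torus_at x y (x0 : x != 0) (y0 : y != 0) : torus :=
  exist _ (torus_coords x y) (torus_coords_eq x0 y0).

Lemma torus_coordsE (w : torus) : sval w = torus_coords (sval w 0) (sval w 1).
Proof.
apply/funext => -[[|[|[|//]]] hi]; rewrite /torus_coords /=.
- by congr (sval w _); apply: val_inj.
- by congr (sval w _); apply: val_inj.
rewrite (_ : Ordinal hi = ord_max); last by apply: val_inj.
have xy0 : sval w 0 * sval w 1 != 0 by rewrite mulf_neq0 ?torus_neq0.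
by apply: (mulfI xy0); rewrite torusP divff.
Qed.

Definition torus_functions : set (torus -> k) :=
  [set a | exists P : {mpoly k[3]}, a = fun x => P.@[sval x]].

Lemma torus_poly_laurent2 (P : {mpoly k[3]}) : laurent2 (fun x y => P.@[torus_coords x y]).
Proof.
have coord i : laurent2 (fun x y => torus_coords x y i).
  case: i => [[|[|[|//]]] hi]; rewrite /torus_coords /=; split=> z z0.
  - by apply: laurent_ext (laurentX k 1) => x _.
  - exact: laurent_cst.
  - exact: laurent_cst.
  - by apply: laurent_ext (laurentX k 1) => x _.
  - apply: laurent_ext (laurentM (laurentX k (-1)) (laurent_cst z^-1)) => x _.
    by rewrite invfM.
  - apply: laurent_ext (laurentM (laurentX k (-1)) (laurent_cst z^-1)) => x _.
    by rewrite invfM mulrC.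
split=> z z0.
  apply: laurent_ext (_ : forall x, x != 0 -> _ = _) _ => [x _|]; first by rewrite mevalE.
  apply: laurent_sum => mm; apply: laurentM; first exact: laurent_cst.
  by apply: laurent_prod => i; apply: laurent_exp; case: (coord i) => + _; apply.
apply: laurent_ext (_ : forall x, x != 0 -> _ = _) _ => [x _|]; first by rewrite mevalE.
apply: laurent_sum => mm; apply: laurentM; first exact: laurent_cst.
by apply: laurent_prod => i; apply: laurent_exp; case: (coord i) => _; apply.
Qed.

Lemma torus_domain : function_domain [set: torus] torus_functions.
Proof.
split.
- by exists (torus_at (oner_neq0 k) (oner_neq0 k)).
- by move=> c; exists c%:MP; apply/funext => y; rewrite mevalC.
- by move=> _ _ [P ->] [Q ->]; exists (P + Q); apply/funext => y; rewrite mevalD.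
- move=> _ _ [P ->] [Q ->]; exists (fun y : torus => (P * Q).@[sval y]).
    by exists (P * Q).
  by move=> y _; rewrite mevalM.
move=> _ _ [P ->] [Q ->] [w [_ Pw]] [w' [_ Qw']].
have [||x [y [x0 y0 Pxy Qxy]]] :=
    laurent2_nonzero2 (torus_poly_laurent2 P) (torus_poly_laurent2 Q).
- by exists (sval w 0), (sval w 1); rewrite -torus_coordsE !torus_neq0.
- by exists (sval w' 0), (sval w' 1); rewrite -torus_coordsE !torus_neq0.
by exists (torus_at x0 y0).
Qed.

Lemma torus_chart : generic_chart [set: torus] torus_functions.
Proof.
apply: (glued_generic_chart (affine_chart_rings torus_equation)).
- exact: torus_domain.
- exact: openT.
- by move=> a ia; apply: (@regular_afun _ _ (affine_chart_rings torus_equation) tt).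
move=> [] a x ia _; exists a, (fun=> 1); split=> //.
- by have := @fd_cst _ _ _ _ torus_domain 1.
- by exists x; rewrite oner_neq0.
- by move=> y _ _; rewrite divr1.
- by move=> ax; exists x.
Qed.

Lemma torus_kalgebraic : kalgebraic torus.
Proof. exact: affine_kalgebraic. Qed.

Lemma torus_coord_regular j : regular torus setT (fun x : torus => sval x j).
Proof.
apply: (@regular_afun _ _ (affine_chart_rings torus_equation) tt).
by exists 'X_j; apply/funext => x; rewrite mevalXU.
Qed.

Lemma torus_variety : is_variety torus.
Proof.
have hT := torus_kalgebraic; split.
- exact: (gc_irreducible hT torus_chart).
- rewrite /separated_space -openC; apply: open_glued => -[w w'] /= ww'.
  have [i wi] : exists i, sval w i != sval w' i.
    apply: contrapT => h; apply: ww'; apply: torus_inj; apply/funext => i.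
    by apply: contrapT => wi; apply: h; exists i; apply/eqP.
  pose d (z : torus * torus) := sval z.1 i - sval z.2 i.
  have cr := torus_coord_regular.
  have d_afun : @afun _ (prod_atlas torus torus) (setT, setT) d.
    have := @tensorD k torus torus (regular torus setT) (regular torus setT)
      (fun z => sval z.1 i * 1) (fun z => -1 * sval z.2 i).
    have -> : d = fun z => sval z.1 i * 1 + -1 * sval z.2 i.
      by apply/funext => z; rewrite mulr1 mulN1r.
    have cst c : regular torus setT (fun=> c) by apply: regular_cst => //; exact: openT.
    apply; first exact: (tensor1 (f := fun x : torus => sval x i) (g := fun=> 1)).
    exact: (tensor1 (f := fun=> -1) (g := fun x : torus => sval x i)).
  exists [set z | @adom _ (prod_atlas torus torus) (setT, setT) z /\ d z != 0]; split.
  + exact: (open_principal d_afun).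
  + by split; [split=> //; exact: openT | rewrite /d subr_eq0].
  + by move=> z [_ dz] /= zz; move: dz; rewrite /d zz subrr eqxx.
- exists 1%N, (fun _ => 3), (fun _ => torus_equation), (fun _ => id); split.
    move=> _; split=> //.
    + by move=> V; rewrite image_id.
    + by move=> V f oV; rewrite image_id.
  by move=> x; exists ord0; exists x.
Qed.

End Torus.

Section P1Chart.
Variable k : closedFieldType.

Definition A1_in_P1 : set (P1 k) := [set z | z <> None].
Definition A1_functions : set (P1 k -> k) :=
  [set a | exists P : {poly k}, a = fun z => P.[P1_coord false z]].

Lemma A1_domain : function_domain A1_in_P1 A1_functions.
Proof.
split.
- by exists (Some 0).
- by move=> c; exists c%:P; apply/funext => y; rewrite hornerC.
- by move=> _ _ [P ->] [Q ->]; exists (P + Q); apply/funext => y; rewrite hornerD.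
- move=> _ _ [P ->] [Q ->]; exists (fun y : P1 k => (P * Q).[P1_coord false y]).
    by exists (P * Q).
  by move=> y _; rewrite hornerM.
move=> _ _ [P ->] [Q ->] [z [_ Pz]] [z' [_ Qz']].
have P0 : P != 0 by apply: contraNneq Pz => ->; rewrite horner0.
have Q0 : Q != 0 by apply: contraNneq Qz' => ->; rewrite horner0.
have [t t0] := horner_nonzero (mulf_neq0 P0 Q0).
by rewrite hornerM mulf_eq0 negb_or => /andP[Pt Qt]; exists (Some t).
Qed.

Lemma P1_chart : generic_chart A1_in_P1 A1_functions.
Proof.
have hA := P1_chart_rings k.
apply: (glued_generic_chart hA).
- exact: A1_domain.
- exact: (open_adom hA false).
- by move=> a ia; apply: (regular_afun hA (i := false)).
case=> a x; last first.
  move=> ia bx; exists a, (fun=> 1); split=> //.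
  - by have := @fd_cst _ _ _ _ A1_domain 1.
  - by exists x; rewrite oner_neq0.
  - by move=> y Dy _; rewrite divr1.
  - by move=> ax; exists x.
move=> [P ->] bx; have [Q [N PQ]] := horner_inv P.
exists (fun z => (Q * 'X).[P1_coord false z]), (fun z => ('X^N * 'X).[P1_coord false z]).
split.
- by exists (Q * 'X).
- by exists ('X^N * 'X).
- by exists (Some 1); split=> //=; rewrite !hornerE ?hornerXn ?expr1n ?mulr1 oner_neq0.
- move=> [t|] //= _; rewrite !hornerE ?hornerXn mulf_eq0 negb_or => /andP[tN t0].
  split; first by move=> [] t0'; rewrite t0' eqxx in t0.
  by rewrite PQ // -mulf_div divff // mulr1.
move=> Px; have P0 : P != 0 by apply: contraNneq Px => ->; rewrite horner0.
have [s s0 Ps] := horner_nonzero P0; exists (Some s^-1); split=> //=.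
rewrite !hornerE mulf_neq0 ?invr_eq0 //; apply: contraNneq Ps => Qs.
by rewrite -[s]invrK PQ ?invr_eq0 // Qs mul0r.
Qed.

End P1Chart.

Section ToricChart.
Variables (k : closedFieldType) (n : nat) (F : fan n).

Definition toric_torus : set (toric k F) := [set x | orbit_cone x = finset.set0].
Definition toric_functions : set (toric k F -> k) := @afun _ (toric_atlas k F) finset.set0.

Lemma dual_set0 m : dual F finset.set0 m.
Proof. by apply/dualP => i; rewrite inE. Qed.

Lemma perp_set0 m : perp F finset.set0 m.
Proof. by apply/perpP => i; rewrite inE. Qed.

Lemma torus_point_subproof (x y : k) : finset.set0 \in cones F -> x != 0 -> y != 0 ->
  let v : {set 'I_n} * ('rV[int]_2 -> k) :=
    (finset.set0, fun m : 'rV[int]_2 => x ^ (m 0 0) * y ^ (m 0 1)) in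
  [/\ v.1 \in cones F, forall m, (v.2 m != 0) = perp F v.1 m, v.2 0 = 1 &
      forall m m', perp F v.1 m -> perp F v.1 m' -> v.2 (m + m') = v.2 m * v.2 m'].
Proof.
move=> F0 x0 y0 v; split=> //=.
- by move=> m; rewrite perp_set0 mulf_neq0 ?expfz_neq0.
- by rewrite !mxE !expr0z mulr1.
- by move=> m m' _ _; rewrite !mxE !expfzDr // mulrACA.
Qed.

Definition torus_point F0 (x y : k) (x0 : x != 0) (y0 : y != 0) : toric k F :=
  exist _ _ (torus_point_subproof F0 x0 y0).

Lemma chi_torus_point F0 (x y : k) x0 y0 m :
  chi m (@torus_point F0 x y x0 y0) = x ^ (m 0 0) * y ^ (m 0 1).
Proof. by []. Qed.

Lemma chi_torusD (x : toric k F) m m' : toric_torus x -> chi (m + m') x = chi m x * chi m' x.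
Proof. by move=> tx; rewrite chiD // tx dual_set0. Qed.

Lemma chi_torus_neq0 (x : toric k F) m : toric_torus x -> chi m x != 0.
Proof. by move=> tx; rewrite chi_neq0 tx perp_set0. Qed.

Lemma chi_torusN (x : toric k F) m : toric_torus x -> chi (- m) x = (chi m x)^-1.
Proof.
move=> tx; apply: (mulfI (chi_torus_neq0 m tx)).
by rewrite -chi_torusD // subrr chi0 divff // chi_torus_neq0.
Qed.

Lemma chi_torusMz (x : toric k F) m (e : int) : toric_torus x -> chi (m *~ e) x = chi m x ^ e.
Proof.
move=> tx; have nat_case d : chi (m *+ d) x = chi m x ^+ d.
  by elim: d => [|d IHd]; rewrite ?mulr0n ?chi0 // mulrS chi_torusD // IHd exprS.
case: e => d; first exact: nat_case.
by rewrite NegzE mulrNz -pmulrn chi_torusN // nat_case -exprnN.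
Qed.

Definition std0 : 'rV[int]_2 := \row_j (j == 0)%:R.
Definition std1 : 'rV[int]_2 := \row_j (j == 1)%:R.

Lemma lattice_basis (m : 'rV[int]_2) : m = std0 *~ m 0 0 + std1 *~ m 0 1.
Proof. by apply: row2P; rewrite -!scaler_int !mxE !intz /=; lia. Qed.

Lemma chi_torusE (x : toric k F) m : toric_torus x ->
  chi m x = chi std0 x ^ (m 0 0) * chi std1 x ^ (m 0 1).
Proof. by move=> tx; rewrite {1}[m]lattice_basis chi_torusD // !chi_torusMz. Qed.

Lemma toric_laurent2 N (c : 'I_N -> k) (m : 'I_N -> 'rV[int]_2) :
  laurent2 (fun x y => \sum_i c i * (x ^ (m i 0 0) * y ^ (m i 0 1))).
Proof.
by split=> z z0; apply: laurent_sum => i; apply: laurentM; try exact: laurent_cst;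
  apply: laurentM; try exact: laurent_cst; apply: laurentX.
Qed.

Hypothesis F0 : finset.set0 \in cones F.

Lemma toric_domain : function_domain toric_torus toric_functions.
Proof.
have hA := toric_chart_rings k F.
pose t1 := torus_point F0 (oner_neq0 k) (oner_neq0 k).
have d1 : @adom _ (toric_atlas k F) finset.set0 t1 by [].
split.
- by exists t1.
- by move=> c; apply: (afun_cst hA c d1).
- by move=> a b; apply: (afunD hA d1).
- move=> a b ia ib; have [c ic Dc] := afunM hA d1 ia ib; exists c => // x tx.
  by apply: Dc; split=> //; rewrite tx.
move=> _ _ [N [c [m [_ ->]]]] [N' [c' [m' [_ ->]]]] [u [tu au]] [v [tv bv]].
have [||x [y [x0 y0 ax bx]]] := laurent2_nonzero2 (toric_laurent2 c m) (toric_laurent2 c' m').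
- exists (chi std0 u), (chi std1 u); rewrite !chi_torus_neq0 //; split=> //.
  by under eq_bigr do rewrite -(chi_torusE _ tu).
- exists (chi std0 v), (chi std1 v); rewrite !chi_torus_neq0 //; split=> //.
  by under eq_bigr do rewrite -(chi_torusE _ tv).
by exists (torus_point F0 x0 y0).
Qed.

Lemma toric_chart : generic_chart toric_torus toric_functions.
Proof.
have hA := toric_chart_rings k F.
have tE : toric_torus = @adom _ (toric_atlas k F) finset.set0.
  apply/seteqP; split=> x; first by move=> tx; split=> //; rewrite tx.
  by move=> [_]; rewrite finset.subset0 => /eqP.
apply: (glued_generic_chart hA).
- exact: toric_domain.
- by rewrite tE; exact: (open_adom hA).
- by move=> a ia; rewrite tE; apply: (regular_afun hA).
move=> s a x [N [c [m [dm ->]]]] [sF xs].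
exists (fun x => \sum_i c i * chi (m i) x), (fun=> 1); split.
- by exists N, c, m; split=> // i; apply: dual_set0.
- by have := @fd_cst _ _ _ _ toric_domain 1.
- by have [y ty] := fd_nonempty toric_domain; exists y; rewrite oner_neq0.
- by move=> y ty _; rewrite divr1; split=> //; split=> //; rewrite ty finset.sub0set.
(* Density of the torus: a combination of characters that vanishes on it vanishes for arbitrary
   values of the characters, among them those at the point [x], possibly on the boundary. *)
move=> ax; apply: contrapT => nz; move/eqP: ax; apply.
apply: (@characters_independent _ _ c m _ (fun m => chi m x)) => u v u0 v0.
apply: contrapT => /eqP h; apply: nz; exists (torus_point F0 u0 v0); split=> //.
Qed.

End ToricChart.

(** * Function fields *)

Section FunctionField.
Variables (k : fieldType) (T : Type) (D : set T) (R : set (T -> k)).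

Definition generic_fraction (f : T -> k) : Prop := exists a b,
  [/\ R a, R b, nonzero_on D b & forall x, D x -> b x != 0 -> f x = a x / b x].

Definition generic_eq (f g : T -> k) : Prop := exists h,
  [/\ R h, nonzero_on D h & forall x, D x -> h x != 0 -> f x = g x].

Hypothesis hR : function_domain D R.

Lemma nonzero_on1 : nonzero_on D (fun=> 1 : k).
Proof. by have [x Dx] := fd_nonempty hR; exists x; rewrite oner_neq0. Qed.

Lemma generic_fraction_of a : R a -> generic_fraction a.
Proof.
move=> Ra; exists a, (fun=> 1); split=> //; first exact: (fd_cst hR).
  exact: nonzero_on1.
by move=> x _ _; rewrite divr1.
Qed.

Lemma generic_eq_refl f : generic_eq f f.
Proof.
by exists (fun=> 1); split=> //; [exact: (fd_cst hR) | exact: nonzero_on1].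
Qed.

Lemma generic_eq_sym f g : generic_eq f g -> generic_eq g f.
Proof. by move=> [h [Rh nh fg]]; exists h; split=> // x Dx hx; rewrite fg. Qed.

Lemma generic_eq2 (f g f' g' u v : T -> k) : generic_eq f g -> generic_eq f' g' ->
  (forall x, f x = g x -> f' x = g' x -> u x = v x) -> generic_eq u v.
Proof.
move=> [h [Rh nh fg]] [h' [Rh' nh' fg']] uv.
have [e [Re ne De]] := fdM_nonzero hR Rh Rh' nh nh'; exists e; split=> // x Dx.
by rewrite De // mulf_eq0 negb_or => /andP[hx hx']; apply: uv; [apply: fg | apply: fg'].
Qed.

Lemma generic_eq_trans f g h : generic_eq f g -> generic_eq g h -> generic_eq f h.
Proof. by move=> fg gh; apply: generic_eq2 fg gh _ => x -> ->. Qed.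

Lemma generic_fraction2 (op : k -> k -> k) (num : k -> k -> k -> k -> k) f g :
  (forall a b c d, R a -> R b -> R c -> R d ->
     exists2 e, R e & forall x, D x -> e x = num (a x) (b x) (c x) (d x)) ->
  (forall a b c d, b != 0 -> d != 0 -> op (a / b) (c / d) = num a b c d / (b * d)) ->
  generic_fraction f -> generic_fraction g -> generic_fraction (fun x => op (f x) (g x)).
Proof.
move=> Rnum opE [a [b [Ra Rb nb fab]]] [c [d [Rc Rd nd gcd]]].
have [e [Re ne De]] := fdM_nonzero hR Rb Rd nb nd.
have [u Ru Du] := Rnum a b c d Ra Rb Rc Rd; exists u, e; split=> // x Dx.
rewrite De // mulf_eq0 negb_or => /andP[bx dx].
by rewrite fab // gcd // Du // opE.
Qed.

Lemma generic_fractionD f g : generic_fraction f -> generic_fraction g ->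
  generic_fraction (fun x => f x + g x).
Proof.
apply: (generic_fraction2 (op := +%R) (num := fun a b c d => a * d + c * b)).
  move=> a b c d Ra Rb Rc Rd.
  have [u Ru Du] := fdM hR Ra Rd; have [v Rv Dv] := fdM hR Rc Rb.
  by exists (fun x => u x + v x); [apply: (fdD hR) | move=> x Dx; rewrite Du // Dv].
by move=> a b c d b0 d0; rewrite addf_div.
Qed.

Lemma generic_fractionM f g : generic_fraction f -> generic_fraction g ->
  generic_fraction (fun x => f x * g x).
Proof.
apply: (generic_fraction2 (op := *%R) (num := fun a b c d => a * c)).
  by move=> a b c d Ra _ Rc _; exact: (fdM hR).
by move=> a b c d b0 d0; rewrite mulf_div.
Qed.

Lemma generic_fractionN f : generic_fraction f -> generic_fraction (fun x => - f x).
Proof.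
move=> [a [b [Ra Rb nb fab]]]; have [c Rc Dc] := fdM hR (fd_cst hR (-1)) Ra.
by exists c, b; split=> // x Dx bx; rewrite fab // Dc // mulN1r mulNr.
Qed.

Lemma generic_fraction_nonzero f : generic_fraction f -> ~ generic_eq f (fun=> 0) ->
  exists h, [/\ R h, nonzero_on D h & forall x, D x -> h x != 0 -> f x != 0].
Proof.
move=> [a [b [Ra Rb nb fab]]] f0.
have na : nonzero_on D a.
  apply: contrapT => na; apply: f0; exists b; split=> // x Dx bx.
  rewrite fab //; have [->|ax] := eqVneq (a x) 0; first by rewrite mul0r.
  by case: na; exists x.
have [e [Re ne De]] := fdM_nonzero hR Ra Rb na nb; exists e; split=> // x Dx.
by rewrite De // mulf_eq0 negb_or => /andP[ax bx]; rewrite fab // mulf_neq0 ?invr_eq0.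
Qed.

Lemma generic_fractionV f : generic_fraction f -> generic_fraction (fun x => (f x)^-1).
Proof.
move=> [a [b [Ra Rb nb fab]]].
have [na|na] := pselect (nonzero_on D a).
  have [e [Re ne De]] := fdM_nonzero hR Ra Rb na nb.
  have [c Rc Dc] := fdM hR Rb Rb; exists c, e; split=> // x Dx.
  rewrite De // mulf_eq0 negb_or => /andP[ax bx].
  by rewrite fab // Dc // invf_div; field; rewrite ax bx.
exists (fun=> 0), b; split=> //; first exact: (fd_cst hR).
move=> x Dx bx; rewrite fab //; have [->|ax] := eqVneq (a x) 0; first by rewrite !mul0r invr0.
by case: na; exists x.
Qed.

Definition fraction_rep := {f : T -> k | generic_fraction f}.
HB.instance Definition _ := gen_eqMixin fraction_rep.
HB.instance Definition _ := gen_choiceMixin fraction_rep.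

Definition fraction_equiv (f g : fraction_rep) : bool := `[< generic_eq (sval f) (sval g) >].

Lemma fraction_equiv_is_equiv : equiv_class_of fraction_equiv.
Proof.
split.
- by move=> f; apply/asboolP; apply: generic_eq_refl.
- by move=> f g; apply/asboolP/asboolP; apply: generic_eq_sym.
- by move=> g f h /asboolP fg /asboolP gh; apply/asboolP; apply: generic_eq_trans fg gh.
Qed.

Canonical fraction_equiv_rel := EquivRelPack fraction_equiv_is_equiv.

(** The field of fractions of [R], built as classes of functions modulo generic equality, so that
    germs and pull-backs are computed on the functions themselves. *)
Definition function_field := {eq_quot fraction_equiv}%qT.
HB.instance Definition _ := Choice.on function_field.

Definition germ_of f (hf : generic_fraction f) : function_field :=
  (\pi_(function_field) (exist _ f hf : fraction_rep))%qT.

Lemma germ_ofP f g hf hg : @germ_of f hf = @germ_of g hg <-> generic_eq f g.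
Proof. by split=> [/eqmodP/asboolP|fg]; [|apply/eqmodP/asboolP]. Qed.

Lemma germ_of_surj (u : function_field) : exists f hf, u = @germ_of f hf.
Proof. by elim/quotW: u => -[f hf]; exists f, hf. Qed.

Lemma germ_of_repr (u : function_field) : u = @germ_of (sval (repr u)) (proj2_sig (repr u)).
Proof. by rewrite /germ_of; case E: (repr u) => [f hf]; rewrite -E reprK. Qed.

Definition ff_add (u v : function_field) := germ_of
  (generic_fractionD (proj2_sig (repr u)) (proj2_sig (repr v))).
Definition ff_mul (u v : function_field) := germ_of
  (generic_fractionM (proj2_sig (repr u)) (proj2_sig (repr v))).
Definition ff_opp (u : function_field) := germ_of (generic_fractionN (proj2_sig (repr u))).
Definition ff_inv (u : function_field) := germ_of (generic_fractionV (proj2_sig (repr u))).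
Definition ff_cst c : function_field := germ_of (generic_fraction_of (fd_cst hR c)).

Lemma repr_germ f hf : generic_eq (sval (repr (@germ_of f hf))) f.
Proof. by apply/(germ_ofP (proj2_sig (repr (germ_of hf))) hf); rewrite -germ_of_repr. Qed.

Lemma germ_ofD f g hf hg : ff_add (@germ_of f hf) (@germ_of g hg) =
  germ_of (generic_fractionD hf hg).
Proof.
by apply/germ_ofP; apply: generic_eq2 (repr_germ hf) (repr_germ hg) _ => x -> ->.
Qed.

Lemma germ_ofM f g hf hg : ff_mul (@germ_of f hf) (@germ_of g hg) =
  germ_of (generic_fractionM hf hg).
Proof.
by apply/germ_ofP; apply: generic_eq2 (repr_germ hf) (repr_germ hg) _ => x -> ->.
Qed.

Lemma germ_ofN f hf : ff_opp (@germ_of f hf) = germ_of (generic_fractionN hf).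
Proof.
by apply/germ_ofP; apply: generic_eq2 (repr_germ hf) (repr_germ hf) _ => x -> _.
Qed.

Lemma germ_ofV f hf : ff_inv (@germ_of f hf) = germ_of (generic_fractionV hf).
Proof.
by apply/germ_ofP; apply: generic_eq2 (repr_germ hf) (repr_germ hf) _ => x -> _.
Qed.

Lemma germ_of_ext f g hf hg : f =1 g -> @germ_of f hf = @germ_of g hg.
Proof.
move=> fg; apply/germ_ofP; apply: generic_eq2 (generic_eq_refl f) (generic_eq_refl f) _.
by move=> x _ _; apply: fg.
Qed.

Lemma ff_addA : associative ff_add.
Proof.
move=> u v w; have [f [hf ->]] := germ_of_surj u; have [g [hg ->]] := germ_of_surj v.
have [h [hh ->]] := germ_of_surj w; rewrite !germ_ofD; apply: germ_of_ext => x.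
by rewrite addrA.
Qed.

Lemma ff_addC : commutative ff_add.
Proof.
move=> u v; have [f [hf ->]] := germ_of_surj u; have [g [hg ->]] := germ_of_surj v.
by rewrite !germ_ofD; apply: germ_of_ext => x; rewrite addrC.
Qed.

Lemma ff_add0 : left_id (ff_cst 0) ff_add.
Proof.
move=> u; have [f [hf ->]] := germ_of_surj u.
by rewrite germ_ofD; apply: germ_of_ext => x; rewrite add0r.
Qed.

Lemma ff_addN : left_inverse (ff_cst 0) ff_opp ff_add.
Proof.
move=> u; have [f [hf ->]] := germ_of_surj u.
by rewrite germ_ofN germ_ofD; apply: germ_of_ext => x; rewrite addNr.
Qed.

HB.instance Definition _ := GRing.isZmodule.Build function_field
  ff_addA ff_addC ff_add0 ff_addN.

Lemma ff_mulA : associative ff_mul.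
Proof.
move=> u v w; have [f [hf ->]] := germ_of_surj u; have [g [hg ->]] := germ_of_surj v.
have [h [hh ->]] := germ_of_surj w; rewrite !germ_ofM; apply: germ_of_ext => x.
by rewrite mulrA.
Qed.

Lemma ff_mulC : commutative ff_mul.
Proof.
move=> u v; have [f [hf ->]] := germ_of_surj u; have [g [hg ->]] := germ_of_surj v.
by rewrite !germ_ofM; apply: germ_of_ext => x; rewrite mulrC.
Qed.

Lemma ff_mul1 : left_id (ff_cst 1) ff_mul.
Proof.
move=> u; have [f [hf ->]] := germ_of_surj u.
by rewrite germ_ofM; apply: germ_of_ext => x; rewrite mul1r.
Qed.

Lemma ff_mulD : left_distributive ff_mul ff_add.
Proof.
move=> u v w; have [f [hf ->]] := germ_of_surj u; have [g [hg ->]] := germ_of_surj v.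
have [h [hh ->]] := germ_of_surj w; rewrite germ_ofD !germ_ofM germ_ofD.
by apply: germ_of_ext => x; rewrite mulrDl.
Qed.

Lemma ff_1_neq0 : ff_cst 1 != 0.
Proof.
apply/eqP => /germ_ofP[h [_ [x [Dx hx]] /(_ x Dx hx)/eqP]].
by rewrite oner_eq0.
Qed.

HB.instance Definition _ := GRing.Zmodule_isComNzRing.Build function_field
  ff_mulA ff_mulC ff_mul1 ff_mulD ff_1_neq0.

Lemma ff_mulV (u : function_field) : u != 0 -> ff_inv u * u = 1.
Proof.
have [f [hf ->]] := germ_of_surj u => f0.
have [|h [Rh nh fh]] := generic_fraction_nonzero hf.
  by move=> /(germ_ofP hf (generic_fraction_of (fd_cst hR 0))) e; rewrite e eqxx in f0.
rewrite germ_ofV [_ * _]germ_ofM; apply/germ_ofP; exists h; split=> // x Dx hx.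
by rewrite mulVf // fh.
Qed.

Lemma ff_inv0 : ff_inv 0 = 0.
Proof. by rewrite germ_ofV; apply: germ_of_ext => x; rewrite invr0. Qed.

HB.instance Definition _ := GRing.ComNzRing_isField.Build function_field ff_mulV ff_inv0.

(** Defined for all functions, as [is_function_field] requires; 0 is a default value off the generic
    fractions. *)
Definition germ (f : T -> k) : function_field :=
  if pselect (generic_fraction f) is left hf then germ_of hf else 0.

Lemma germE f (hf : generic_fraction f) : germ f = germ_of hf.
Proof. by rewrite /germ; case: pselect => // hf'; apply: germ_of_ext. Qed.

Lemma germD f g : generic_fraction f -> generic_fraction g ->
  germ (fun x => f x + g x) = germ f + germ g.
Proof.
move=> hf hg; rewrite (germE hf) (germE hg) (germE (generic_fractionD hf hg)).
by rewrite [RHS]germ_ofD.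
Qed.

Lemma germM f g : generic_fraction f -> generic_fraction g ->
  germ (fun x => f x * g x) = germ f * germ g.
Proof.
move=> hf hg; rewrite (germE hf) (germE hg) (germE (generic_fractionM hf hg)).
by rewrite [RHS]germ_ofM.
Qed.

Lemma germV f : generic_fraction f -> germ (fun x => (f x)^-1) = (germ f)^-1.
Proof.
by move=> hf; rewrite (germE hf) (germE (generic_fractionV hf)) [RHS]germ_ofV.
Qed.

Lemma germN f : generic_fraction f -> germ (fun x => - f x) = - germ f.
Proof.
by move=> hf; rewrite (germE hf) (germE (generic_fractionN hf)) [RHS]germ_ofN.
Qed.

Lemma germ1 : germ (fun=> 1) = 1.
Proof. exact: germE. Qed.

Lemma germP f g : generic_fraction f -> generic_fraction g ->
  germ f = germ g <-> generic_eq f g.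
Proof. by move=> hf hg; rewrite (germE hf) (germE hg) germ_ofP. Qed.

Lemma germ_surj (u : function_field) : exists2 f, generic_fraction f & u = germ f.
Proof.
by have [f [hf ->]] := germ_of_surj u; exists f; rewrite // (germE hf).
Qed.

End FunctionField.

Section FunctionFieldOfChart.
Variables (k : fieldType) (X : kspace k) (hX : kalgebraic X) (D : set X) (R : set (X -> k)).
Variable gX : generic_chart D R.
Let hR := gc_fd gX.

Lemma regular_generic_fraction U f : open U -> U !=set0 -> regular X U f ->
  generic_fraction D R f.
Proof.
move=> oU U0 Uf; have [a [b [Ra Rb nb h]]] := gc_quotient gX oU U0 Uf.
by exists a, b; split=> // x Dx bx; case: (h x Dx bx).
Qed.

Lemma open_chart_nonzero b : R b -> open [set x | D x /\ b x != 0].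
Proof. by move=> Rb; apply: (open_nonzero hX (gc_open gX)); apply: (gc_regular gX). Qed.

Lemma chart_function_field :
  @is_function_field k X (function_field hR) (fun _ f => germ hR f).
Proof.
split.
- move=> U f g oU U0 Uf Ug.
  have hf := regular_generic_fraction oU U0 Uf.
  have hg := regular_generic_fraction oU U0 Ug.
  by rewrite germD // germM.
- by move=> *; exact: germ1.
- move=> U V f g oU U0 oV V0 Uf Vg.
  have hf := regular_generic_fraction oU U0 Uf.
  have hg := regular_generic_fraction oV V0 Vg.
  rewrite germP //; split.
    move=> [h [Rh nh fg]].
    have [b [Rb nb hb]] := gc_dense hX gX oU U0.
    have [c [Rc nc hc]] := gc_dense hX gX oV V0.
    have [e [Re ne De]] := fdM_nonzero hR Rb Rc nb nc.
    have [e' [Re' ne' De']] := fdM_nonzero hR Re Rh ne nh.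
    exists [set x | D x /\ e' x != 0]; split=> //; first exact: open_chart_nonzero.
      move=> x /= [Dx]; rewrite De' // De // !mulf_eq0 !negb_or => /andP[/andP[bx cx] _].
      by split; [apply: hb | apply: hc].
    by move=> x /= [Dx]; rewrite De' // mulf_eq0 negb_or => /andP[_ hx]; apply: fg.
  move=> [W [oW W0 _ fg]]; have [b [Rb nb hb]] := gc_dense hX gX oW W0.
  by exists b; split=> // x Dx bx; apply: fg; apply: hb.
- move=> u; have [f [a [b [Ra Rb nb fab]]] ->] := germ_surj u.
  exists [set x | D x /\ b x != 0], f; split=> //; first exact: open_chart_nonzero.
  apply: (@regular_ext _ X _ (fun x => a x / b x)).
    by move=> x [Dx bx]; rewrite fab.
  by apply: (regular_quotient hX (gc_open gX)); apply: (gc_regular gX).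
Qed.

End FunctionFieldOfChart.

Lemma generic_fraction_ext (k : fieldType) T D R (hR : @function_domain k T D R) f g :
  generic_eq D R f g -> generic_fraction D R f -> generic_fraction D R g.
Proof.
move=> [h [Rh nh fg]] [a [b [Ra Rb nb fab]]].
have [e [Re ne De]] := fdM_nonzero hR Rb Rh nb nh.
have [c Rc Dc] := fdM hR Ra Rh; exists c, e; split=> // x Dx.
rewrite De // mulf_eq0 negb_or => /andP[bx hx].
by rewrite -fg // fab // Dc //; field; rewrite bx hx.
Qed.

(** * Pull-back between function fields *)

Section Pullback.
Variables (k : fieldType) (S T : Type) (D : set S) (R : set (S -> k)).
Variables (E : set T) (Q : set (T -> k)).
Hypotheses (hR : function_domain D R) (hQ : function_domain E Q).
Variable phi : S -> T.
Hypothesis pull_fraction : forall a, Q a -> generic_fraction D R (a \o phi).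
(** Dominance of [phi] read on charts: a nonzero function stays generically nonzero after
    composition. *)
Hypothesis pull_nonzero : forall a, Q a -> nonzero_on E a -> exists h,
  [/\ R h, nonzero_on D h & forall x, D x -> h x != 0 -> E (phi x) /\ a (phi x) != 0].

Lemma pull_generic_eq f g : generic_eq E Q f g -> generic_eq D R (f \o phi) (g \o phi).
Proof.
move=> [a [Qa na fg]]; have [h [Rh nh ha]] := pull_nonzero Qa na.
by exists h; split=> // x Dx hx; have [Ex ax] := ha x Dx hx; apply: fg.
Qed.

Lemma pull_generic_fraction f : generic_fraction E Q f -> generic_fraction D R (f \o phi).
Proof.
move=> [a [b [Qa Qb nb fab]]].
have [h [Rh nh hb]] := pull_nonzero Qb nb.
apply: (generic_fraction_ext hR (f := fun x => a (phi x) * (b (phi x))^-1)).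
  by exists h; split=> // x Dx hx; have [Ex bx] := hb x Dx hx; rewrite /= fab.
apply: (generic_fractionM hR (pull_fraction Qa)).
exact: (generic_fractionV hR (pull_fraction Qb)).
Qed.

Definition pullback (u : function_field hQ) : function_field hR :=
  germ hR (sval (repr u) \o phi).

Lemma pullbackE f : generic_fraction E Q f -> pullback (germ hQ f) = germ hR (f \o phi).
Proof.
move=> hf; rewrite (germE hQ hf) /pullback; set u := germ_of _ _.
apply/germP.
- by apply: pull_generic_fraction; apply: proj2_sig.
- exact: pull_generic_fraction.
- by apply: pull_generic_eq; apply: repr_germ.
Qed.

Lemma pullback_zmod_morphism : zmod_morphism pullback.
Proof.
move=> u v; have [f hf ->] := germ_surj u; have [g hg ->] := germ_surj v.
have pf := pull_generic_fraction hf; have pg := pull_generic_fraction hg.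
have hgN := generic_fractionN hQ hg; have hD := generic_fractionD hQ hf hgN.
rewrite -(germN hQ hg) -(germD hQ hf hgN) !pullbackE //.
by rewrite -(germN hR pg) -(germD hR pf (generic_fractionN hR pg)).
Qed.

Lemma pullback_monoid_morphism : monoid_morphism pullback.
Proof.
split.
  rewrite -(germ1 hQ) pullbackE ?germ1 //.
  exact: (generic_fraction_of hQ (fd_cst hQ 1)).
move=> u v; have [f hf ->] := germ_surj u; have [g hg ->] := germ_surj v.
rewrite -germM ?pullbackE //; last exact: (generic_fractionM hQ).
by rewrite -germM //; exact: pull_generic_fraction.
Qed.

Definition pullback_rmorphism : {rmorphism function_field hQ -> function_field hR} :=
  HB.pack pullback
    (GRing.isZmodMorphism.Build _ _ pullback pullback_zmod_morphism)
    (GRing.isMonoidMorphism.Build _ _ pullback pullback_monoid_morphism).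

End Pullback.

(** * The family of curves *)

Section LogFamily.
Variables (k : closedFieldType) (n : nat) (F : fan n).
Variables (c : 'I_3 -> 'rV[int]_2) (s : 'I_3 -> {set 'I_n}).
Hypothesis sup : forall i, support_cone F (vecQ (c i)) (s i).
Hypothesis balance : c 0 + c 1 + c ord_max = 0.

(** [c i] is a strictly positive combination of the rays of [s i], so a character nonnegative on
    these rays vanishes on [c i] only if it vanishes on each. *)
Lemma support_pairing i m :
  [/\ perp F (s i) m -> pairing m (c i) = 0,
      dual F (s i) m -> 0 <= pairing m (c i) &
      dual F (s i) m -> pairing m (c i) = 0 -> perp F (s i) m].
Proof.
have [al [_ al0] Dc] := sup i.
have E : (pairing m (c i))%:~R = \sum_(j in s i) al j * (pairing m (gen F j))%:~R :> rat.
  have Dcl (l : 'I_2) : (c i 0 l)%:~R = \sum_(j in s i) al j * (gen F j 0 l)%:~R :> rat.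
    have := congr1 (fun v : 'rV[rat]_2 => v 0 l) Dc; rewrite mxE summxE => ->.
    by apply: eq_bigr => j _; rewrite !mxE.
  rewrite /pairing rmorph_sum /=; under eq_bigr => l _ do rewrite rmorphM /= Dcl mulr_sumr.
  rewrite exchange_big; apply: eq_bigr => j _; rewrite rmorph_sum mulr_sumr.
  by apply: eq_bigr => l _; rewrite rmorphM mulrCA.
split.
- move=> /perpP h; apply: (intr_inj (R := rat)); rewrite E big1 // => j /h ->.
  by rewrite mulr0.
- move=> /dualP h; rewrite -(ler_int rat) E; apply: sumr_ge0 => j sj.
  by rewrite mulr_ge0 ?ler0z ?h // ltW // al0.
- move=> /dualP h /(congr1 (fun z : int => z%:~R : rat)); rewrite E => /eqP.
  rewrite psumr_eq0 => [/allP h0|j sj]; last by rewrite mulr_ge0 ?ler0z ?h // ltW // al0.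
  apply/perpP => j sj; have := h0 j (mem_index_enum j); rewrite sj /=.
  by rewrite mulf_eq0 gt_eqF ?al0 //= intr_eq0 => /eqP.
Qed.

Lemma empty_cone : finset.set0 \in cones F.
Proof. by have [al [sF _] _] := sup 0; apply: fan_face sF _; apply: finset.sub0set. Qed.

Lemma pairingDr (m u v : 'rV[int]_2) : pairing m (u + v) = pairing m u + pairing m v.
Proof. by rewrite /pairing -big_split; apply: eq_bigr => i _; rewrite mxE mulrDr. Qed.

Lemma pairing0r (m : 'rV[int]_2) : pairing m 0 = 0.
Proof. by rewrite /pairing big1 // => i _; rewrite mxE mulr0. Qed.

Lemma pairing_balance m : pairing m (c ord_max) = - (pairing m (c 0) + pairing m (c 1)).
Proof.
by apply/eqP; rewrite -addr_eq0 addrC -!pairingDr balance pairing0r.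
Qed.

Definition wpow (w : torus k) (m : 'rV[int]_2) : k := sval w 0 ^ m 0 0 * sval w 1 ^ m 0 1.

Definition cone_at (z : P1 k) : {set 'I_n} :=
  if z is Some t then (if t == 0 then s 0 else if t == 1 then s 1 else finset.set0)
  else s ord_max.

(** The character [m] along the curve t -> t^c0 (t - 1)^c1, extended by zero. At infinity, for [m]
    orthogonal to [s ord_max], the two exponents add up to 0, whence the value 1. *)
Definition curve_char (m : 'rV[int]_2) (z : P1 k) : k :=
  if perp F (cone_at z) m then
    (if z is Some t then t ^ pairing m (c 0) * (t - 1) ^ pairing m (c 1) else 1)
  else 0.

Lemma wpow_neq0 w m : wpow w m != 0.
Proof. by rewrite mulf_neq0 // expfz_neq0 // torus_neq0. Qed.

Lemma wpowD w m m' : wpow w (m + m') = wpow w m * wpow w m'.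
Proof. by rewrite /wpow !mxE !expfzDr ?torus_neq0 // mulrACA. Qed.

Lemma wpow0 w : wpow w 0 = 1.
Proof. by rewrite /wpow !mxE !expr0z mulr1. Qed.

Lemma curve_char_neq0 m z : (curve_char m z != 0) = perp F (cone_at z) m.
Proof.
rewrite /curve_char; case: ifP => pm; last by rewrite eqxx.
case: z pm => [t|] /=; last by rewrite oner_neq0.
have [->|t0] := eqVneq t 0.
  have [h _ _] := support_pairing 0 m => /h ->.
  by rewrite expr0z mul1r expfz_neq0 // sub0r oppr_eq0 oner_neq0.
have [->|t1] := eqVneq t 1.
  have [h _ _] := support_pairing 1 m => /h ->.
  by rewrite expr0z mulr1 expfz_neq0 // oner_neq0.
by rewrite mulf_neq0 // expfz_neq0 // subr_eq0.
Qed.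

(** Additivity of exponents fails at 0, where [0 ^ (1 - 1) = 1] but [0 ^ 1 * 0 ^ (-1) = 0]; there it
    is only used for zero exponents. *)
Lemma exprzD_junk (t : k) (a b : int) : (t = 0 -> a = 0 /\ b = 0) -> t ^ (a + b) = t ^ a * t ^ b.
Proof.
have [->|t0 _] := eqVneq t 0; last exact: expfzDr.
by move=> /(_ erefl)[-> ->]; rewrite !expr0z mulr1.
Qed.

Lemma curve_charD m m' z : perp F (cone_at z) m -> perp F (cone_at z) m' ->
  curve_char (m + m') z = curve_char m z * curve_char m' z.
Proof.
move=> pm pm'; rewrite /curve_char pm pm' (perpD (dual_perp pm) (dual_perp pm')) pm pm' /=.
case: z pm pm' => [t|] /= pm pm'; last by rewrite mulr1.
rewrite !pairingDl (@exprzD_junk t (pairing m (c 0)) (pairing m' (c 0))); last first.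
  move=> t0; move: pm pm'; rewrite t0 eqxx.
  by have [h _ _] := support_pairing 0 m; have [h' _ _] := support_pairing 0 m' => /h -> /h' ->.
rewrite (@exprzD_junk (t - 1) (pairing m (c 1)) (pairing m' (c 1))) 1?mulrACA //.
move=> /eqP; rewrite subr_eq0 => /eqP t1; move: pm pm'; rewrite t1 oner_eq0 eqxx.
by have [h _ _] := support_pairing 1 m; have [h' _ _] := support_pairing 1 m' => /h -> /h' ->.
Qed.

Lemma ev_point_subproof (x : torus k * P1 k) :
  let v : {set 'I_n} * ('rV[int]_2 -> k) :=
    (cone_at x.2, fun m => wpow x.1 m * curve_char m x.2) in
  [/\ v.1 \in cones F, forall m, (v.2 m != 0) = perp F v.1 m, v.2 0 = 1 &
      forall m m', perp F v.1 m -> perp F v.1 m' -> v.2 (m + m') = v.2 m * v.2 m'].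
Proof.
move=> v; split=> /=.
- rewrite /cone_at; have sF i : s i \in cones F by have [al [] ] := sup i.
  case: x.2 => [t|//]; case: ifP => // _; case: ifP => // _; exact: empty_cone.
- by move=> m; rewrite mulf_eq0 negb_or wpow_neq0 curve_char_neq0.
- rewrite wpow0 mul1r /curve_char perp0.
  by case: x.2 => [t|] //; rewrite !pairing0l !expr0z mulr1.
- by move=> m m' pm pm'; rewrite wpowD curve_charD // mulrACA.
Qed.

Definition ev_point (x : kprod (torus k) (P1 k)) : toric k F :=
  exist _ _ (ev_point_subproof x).

Lemma chi_ev_point m w z : chi m (ev_point (w, z)) = wpow w m * curve_char m z.
Proof. by []. Qed.

(* Since 0 ^ 0 = 1 and 0 ^ e = 0 for e != 0, of either sign, the formula also   *)
(* gives the extension by zero at the marked points 0 and 1.                   *)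
Lemma curve_char_dual m t : dual F (cone_at (Some t)) m ->
  curve_char m (Some t) = t ^ pairing m (c 0) * (t - 1) ^ pairing m (c 1).
Proof.
rewrite /curve_char; case: ifP => // npm; move: npm => /=.
have [->|t0] := eqVneq t 0.
  have [_ _ h] := support_pairing 0 m => npm dm.
  have /negPf pm0 : pairing m (c 0) != 0 by apply: contraFneq npm => /h ->.
  by rewrite exp0rz pm0 mul0r.
have [->|t1] := eqVneq t 1; last by rewrite perp_set0.
have [_ _ h] := support_pairing 1 m => npm dm.
have /negPf pm0 : pairing m (c 1) != 0 by apply: contraFneq npm => /h ->.
by rewrite subrr exp0rz pm0 mulr0.
Qed.

Lemma curve_char_generic m t : t != 0 -> t != 1 ->
  curve_char m (Some t) = t ^ pairing m (c 0) * (t - 1) ^ pairing m (c 1).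
Proof.
by move=> t0 t1; rewrite curve_char_dual //= (negPf t0) (negPf t1) dual_set0.
Qed.

Lemma P1_coord_regular b : regular (P1 k) [set z | z <> if b then Some 0 else None] (P1_coord b).
Proof.
apply: (@regular_afun _ _ (P1_chart_rings k) b); exists 'X.
by apply/funext => z; rewrite hornerX.
Qed.

Lemma P1_open_adom b : open ([set z | z <> if b then Some 0 else None] : set (P1 k)).
Proof. exact: (open_adom (P1_chart_rings k) b). Qed.

Lemma P1_coord_sub_regular b : 
  regular (P1 k) [set z | z <> if b then Some 0 else None] (fun z => P1_coord b z - 1).
Proof.
apply: (@regular_afun _ _ (P1_chart_rings k) b); exists ('X - 1).
by apply/funext => z; rewrite !hornerE.
Qed.

Arguments P1_coord_regular : clear implicits.
Arguments P1_open_adom : clear implicits.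
Arguments P1_coord_sub_regular : clear implicits.

(** The complement consists of marked points; the polynomial [P] removes those that lie in the chart
    considered. *)
Lemma open_cone_at_sub (t : {set 'I_n}) : open [set z : P1 k | cone_at z \subset t].
Proof.
have princ b (P : {poly k}) : open [set z : P1 k | z <> (if b then Some 0 else None) /\
    P.[P1_coord b z] != 0].
  apply: (@open_principal _ (P1_atlas k) b (fun z => P.[P1_coord b z])).
  by exists P.
apply: open_glued => -[t0|] /= zt.
  pose P : {poly k} := (if s 0 \subset t then 1 else 'X) * (if s 1 \subset t then 1 else 'X - 1).
  exists [set z | z <> None /\ P.[P1_coord false z] != 0]; split; first exact: (princ false P).
    split=> //=; rewrite /P hornerM mulf_neq0 //.
      case: ifP => h; rewrite !hornerE ?oner_neq0 //.
      by apply: contraFneq h => t00; move: zt; rewrite t00 eqxx.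
    case: ifP => h; rewrite !hornerE ?oner_neq0 // subr_eq0.
    by apply: contraFneq h => t01; move: zt; rewrite t01 oner_eq0 eqxx.
  move=> [u|[]//] [_] /=; rewrite /P hornerM mulf_eq0 negb_or.
  have [->|u0] := eqVneq u 0.
    by case: ifP => //; rewrite hornerX eqxx.
  have [->|u1] := eqVneq u 1; last by rewrite finset.sub0set.
  by case: (s 1 \subset t); rewrite // !hornerE subrr eqxx andbF.
pose P : {poly k} := if s 1 \subset t then 1 else 'X - 1.
exists [set z | z <> Some 0 /\ P.[P1_coord true z] != 0]; split; first exact: (princ true P).
  by split=> //=; rewrite /P; case: ifP => _; rewrite !hornerE ?oner_neq0 // ?sub0r oppr_eq0 oner_neq0.
move=> [u|] [] //= u0; have [u00|_] := eqVneq u 0; first by case: u0; rewrite u00.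
have [->|u1] := eqVneq u 1; last by rewrite finset.sub0set.
by rewrite /P; case: ifP => //; rewrite !hornerE invr1 subrr eqxx.
Qed.

Lemma regular_exprz_junk X (hX : kalgebraic X) U (e : int) (f : X -> k) : open U ->
  regular X U f -> (e < 0 -> forall x, U x -> f x != 0) -> regular X U (fun x => f x ^ e).
Proof.
move=> oU fU; case: e => e; first by move=> _; apply: regularX.
by move=> h; apply: regular_exprz => //; apply: h.
Qed.

(** If [s i] is contained in [t], the exponent at the i-th marked point is nonnegative; if not, that
    point is outside the open set and negative powers are regular. Near infinity, in v = 1 / t, the
    function is v^(m.c2) (1 - v)^(m.c1), by balance. *)
Lemma curve_char_regular m t : dual F t m ->
  regular (P1 k) [set z | cone_at z \subset t] (curve_char m).
Proof.
move=> dm; have hP := P1_kalgebraic k; have oU := open_cone_at_sub t.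
have pos i : s i \subset t -> 0 <= pairing m (c i).
  by move=> st; have [_ h _] := support_pairing i m; apply: h; apply: dualS dm.
apply: regular_glue => // -[t0|] /= zt.
  pose V := [set z : P1 k | cone_at z \subset t] `&` [set z | z <> None].
  have oV : open V by apply: openI => //; apply: (P1_open_adom false).
  have VS : V `<=` [set z | z <> None] by move=> z [].
  exists V; split=> //; first by move=> z [].
  apply: (@regular_ext _ (P1 k) _ (fun z => P1_coord false z ^ pairing m (c 0) *
      (P1_coord false z - 1) ^ pairing m (c 1))).
    move=> [u|] [//= cu _]; rewrite curve_char_dual //; exact: dualS dm.
  apply: (regularM hP oV); apply: (regular_exprz_junk hP oV).
  - exact: (regular_res (P1_open_adom false) oV VS (P1_coord_regular false)).
  - move=> neg [u|] [//= cu _]; apply: contraTneq neg => u0; rewrite -leNgt; apply: pos.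
    by move: cu; rewrite u0 eqxx.
  - exact: (regular_res (P1_open_adom false) oV VS (P1_coord_sub_regular false)).
  - move=> neg [u|] [//= cu _]; apply: contraTneq neg => /eqP u1; rewrite -leNgt; apply: pos.
    by move: u1 cu; rewrite subr_eq0 => /eqP->; rewrite oner_eq0 eqxx.
pose V := [set z : P1 k | cone_at z \subset t] `&` [set z | z <> Some 0].
have oV : open V by apply: openI => //; apply: (P1_open_adom true).
have VS : V `<=` [set z | z <> Some 0] by move=> z [].
exists V; split=> //; first by move=> z [].
have e0 : 0 <= pairing m (c ord_max) by apply: pos.
apply: (@regular_ext _ (P1 k) _ (fun z => P1_coord true z ^ pairing m (c ord_max) *
    (- (P1_coord true z - 1)) ^ pairing m (c 1))).
  move=> [u|] [/= cu u0].
    have {}u0 : u != 0 by apply/eqP => u00; apply: u0; rewrite u00.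
    rewrite curve_char_dual; last exact: dualS dm.
    have -> : - (u^-1 - 1) = (u - 1) * u^-1 by rewrite mulrBl divff // mul1r opprB.
    rewrite expfzMl !exprz_inv mulrCA [RHS]mulrC -expfzDr // pairing_balance.
    by congr (_ * _ ^ _); ring.
  rewrite /P1_coord sub0r opprK exp1rz mulr1 exp0rz /curve_char /=.
  have [h0 _ h] := support_pairing ord_max m.
  case: ifP => [/h0->|npm]; first by rewrite eqxx.
  rewrite (_ : (_ == 0) = false) //; apply: contraFF npm => /eqP; apply: h.
  exact: dualS cu dm.
have rV := regular_res (P1_open_adom true) oV VS (P1_coord_sub_regular true).
apply: (regularM hP oV); apply: (regular_exprz_junk hP oV).
- exact: (regular_res (P1_open_adom true) oV VS (P1_coord_regular true)).
- by rewrite ltNge e0.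
- apply: (@regular_ext _ (P1 k) _ (fun z => -1 * (P1_coord true z - 1))).
    by move=> z _; rewrite mulN1r.
  exact: (regularM hP oV (regular_cst hP (-1) oV) rV).
move=> neg [u|] [/= cu u0]; last by rewrite sub0r opprK oner_neq0.
rewrite oppr_eq0 subr_eq0; apply: contraTneq neg => u1; rewrite -leNgt; apply: pos.
have {}u1 : u = 1 by rewrite -[u]invrK u1 invr1.
by move: cu; rewrite u1 oner_eq0 eqxx.
Qed.

Lemma wpow_regular m : regular (torus k) setT (wpow^~ m).
Proof.
have hT := torus_kalgebraic k.
have cr := @torus_coord_regular k.
have oT := @openT (torus k).
have cz j e : regular (torus k) setT (fun x : torus k => sval x j ^ e).
  have H := @regular_exprz k (torus k) hT setT e (fun x => sval x j) oT (cr j).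
  exact: (H (fun x _ => torus_neq0 x j)).
exact: (regularM hT oT (cz 0 (m 0 0)) (cz 1 (m 0 1))).
Qed.

(** Each character is a function of w times a function of z, hence a tensor, and a toric chart pulls
    back to a product of open sets. *)
Lemma ev_point_morphism : morphism ev_point.
Proof.
have hT := torus_kalgebraic k; have hP := P1_kalgebraic k.
have hA := prod_chart_rings hT hP.
have pre t : t \in cones F -> ev_point @^-1` (@adom _ (toric_atlas k F) t) =
    @adom _ (prod_atlas (torus k) (P1 k)) (setT, [set z | cone_at z \subset t]).
  move=> tF; apply/seteqP; split=> -[w z] /=; last by case=> _ _ _ zt; split.
  by move=> [_ zt]; split=> //=; [exact: openT | exact: open_cone_at_sub].
have pre0 t : t \notin cones F -> ev_point @^-1` (@adom _ (toric_atlas k F) t) = set0.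
  by move=> /negP tF; apply/seteqP; split=> x // [].
apply: (morphism_glue (A := toric_atlas k F) (prod_kalgebraic hT hP)) => t.
  have [tF|tF] := boolP (t \in cones F); last by rewrite pre0 //; exact: open0.
  by rewrite pre //; apply: (open_adom hA).
move=> a [N [cc [m [dm ->]]]].
have [tF|tF] := boolP (t \in cones F); last first.
  by rewrite pre0.
rewrite pre //; apply: (regular_afun hA).
exists N, (fun i w => cc i * wpow w (m i)), (fun i z => curve_char (m i) z).
split; last by apply/funext => -[w z]; apply: eq_bigr => i _ /=; rewrite mulrA.
move=> i; split; last by apply: curve_char_regular.
have oT := @openT (torus k).
by apply: (regularM hT oT); [apply: regular_cst | apply: wpow_regular].
Qed.

Definition mark_point (j : 'I_3) : P1 k :=
  nth None [:: Some 0; Some 1; None] j.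

Lemma boundaryP (x : toric k F) : boundary k F x <-> orbit_cone x != finset.set0.
Proof.
split; first by move=> [i _ ix]; apply/set0Pn; exists i.
by case/set0Pn => i ix; exists i.
Qed.

Lemma ev_point_torus w t : t != 0 -> t != 1 -> orbit_cone (ev_point (w, Some t)) = finset.set0.
Proof. by move=> /negPf t0 /negPf t1; rewrite /orbit_cone /= t0 t1. Qed.

Lemma generic_parameter : exists t : k, t != 0 /\ t != 1.
Proof.
have [|t t0] := @horner_nonzero k ('X - 1%:P); first by rewrite polyXsubC_eq0.
by rewrite !hornerE subr_eq0 => t1; exists t.
Qed.

Lemma ev_point_contact w (j : 'I_3) :
  has_contact_order (fun z => ev_point (w, z)) (mark_point j) (c j).
Proof.
move=> m; have hP := P1_kalgebraic k; rewrite /order_at.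
pose V : set (P1 k) := [set z | z <> None].
have oV : open V := P1_open_adom false.
have r0 : regular (P1 k) V (P1_coord false) := P1_coord_regular false.
have r1 : regular (P1 k) V (fun z => P1_coord false z - 1) := P1_coord_sub_regular false.
case: j => [[|[|[|//]]] hj]; rewrite /mark_point /=.
- rewrite (_ : Ordinal hj = 0); last exact: val_inj.
  exists [set z | V z /\ P1_coord false z - 1 != 0],
    (fun z => wpow w m * (P1_coord false z - 1) ^ pairing m (c 1)).
  have oW := open_nonzero hP oV r1.
  split=> //.
  + by split=> //=; rewrite sub0r oppr_eq0 oner_neq0.
  + exact: (regularM hP oW (regular_cst hP (wpow w m) oW) (@regular_exprz k (P1 k) hP _ _ _ oW
      (regular_res oV oW (fun z => @proj1 _ _) r1) (fun z => @proj2 _ _))).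
  + by rewrite /= mulf_neq0 ?wpow_neq0 // expfz_neq0 // sub0r oppr_eq0 oner_neq0.
  move=> [t|] [//= _ t1] zt; have t0 : t != 0 by apply/eqP => t0; apply: zt; rewrite t0.
  have {}t1 : t != 1 by rewrite -subr_eq0.
  by rewrite chi_ev_point (curve_char_generic m t0 t1) /= subr0 mulrCA.
- rewrite (_ : Ordinal hj = 1); last exact: val_inj.
  exists [set z | V z /\ P1_coord false z != 0],
    (fun z => wpow w m * P1_coord false z ^ pairing m (c 0)).
  have oW := open_nonzero hP oV r0.
  split=> //.
  + by split=> //=; rewrite oner_neq0.
  + exact: (regularM hP oW (regular_cst hP (wpow w m) oW) (@regular_exprz k (P1 k) hP _ _ _ oW
      (regular_res oV oW (fun z => @proj1 _ _) r0) (fun z => @proj2 _ _))).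
  + by rewrite /= mulf_neq0 ?wpow_neq0 // expfz_neq0 // oner_neq0.
  move=> [t|] [//= _ t0] zt; have t1 : t != 1 by apply/eqP => t1; apply: zt; rewrite t1.
  rewrite chi_ev_point (curve_char_generic m t0 t1) /=.
  by rewrite mulrA [RHS]mulrC.
rewrite (_ : Ordinal hj = ord_max); last exact: val_inj.
(* Around infinity, in v = 1 / t, the curve is v^c2 (1 - v)^c1; removing v = 1 makes the second
   factor invertible. *)
pose W := [set z : P1 k | z <> Some 0 /\ P1_coord true z - 1 != 0].
have oW : open W := open_nonzero hP (P1_open_adom true) (P1_coord_sub_regular true).
exists W, (fun z => wpow w m * (- (P1_coord true z - 1)) ^ pairing m (c 1)); split=> //.
+ by split=> //=; rewrite sub0r oppr_eq0 oner_neq0.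
+ have r1' := regular_res (P1_open_adom true) oW (fun z => @proj1 _ _) (P1_coord_sub_regular true).
  have rN : regular (P1 k) W (fun z => - (P1_coord true z - 1)).
    apply: (@regular_ext _ (P1 k) _ (fun z => -1 * (P1_coord true z - 1))).
      by move=> z _; rewrite mulN1r.
    exact: (regularM hP oW (regular_cst hP (-1) oW) r1').
  have nz z : W z -> - (P1_coord true z - 1) != 0 by move=> [_]; rewrite oppr_eq0.
  exact: (regularM hP oW (regular_cst hP (wpow w m) oW) (@regular_exprz k (P1 k) hP _ _ _ oW rN nz)).
+ by rewrite /= mulf_neq0 ?wpow_neq0 // expfz_neq0 // sub0r opprK oner_neq0.
move=> [t|] [//= t0 t1] _; have {}t0 : t != 0 by apply/eqP => t00; apply: t0; rewrite t00.
have {}t1 : t != 1 by apply: contraNneq t1 => ->; rewrite invr1 subrr.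
rewrite chi_ev_point (curve_char_generic m t0 t1) /= [RHS]mulrCA; congr (_ * _).
have -> : - (t^-1 - 1) = (t - 1) * t^-1 by rewrite mulrBl divff // mul1r opprB.
rewrite expfzMl !exprz_inv mulrCA [LHS]mulrC -expfzDr // pairing_balance.
by congr (_ * _ ^ _); ring.
Qed.

Lemma ev_point_log_map w : is_log_map c (fun z => ev_point (w, z)) mark_point.
Proof.
have hT := torus_kalgebraic k; have hP := P1_kalgebraic k; split.
- exact (morphism_comp (slice_morphism (X := torus k) hP w) ev_point_morphism).
- split; last by right.
  move=> [[|[|[|//]]] hi] [[|[|[|//]]] hj] //; rewrite /mark_point /=.
  all: try by move=> *; apply: val_inj.
  + by case=> /esym/eqP; rewrite oner_eq0.
  + by case=> /eqP; rewrite oner_eq0.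
- have [t [t0 t1]] := generic_parameter => /(_ (ev_point (w, Some t))) [|i _ hi].
    by exists (Some t).
  have /boundaryP : boundary k F (ev_point (w, Some t)) by exists i.
  by rewrite (ev_point_torus w t0 t1) eqxx.
- move=> [t|]; last by move=> _; exists ord_max.
  move=> /= /boundaryP; rewrite /orbit_cone /=.
  have [->|t0] := eqVneq t 0; first by exists 0.
  have [->|t1] := eqVneq t 1; first by exists 1.
  by rewrite eqxx.
- exact: ev_point_contact.
Qed.

Lemma mark_point_inj : injective mark_point.
Proof. by case: (ev_point_log_map (torus_at (oner_neq0 k) (oner_neq0 k))) => _ []. Qed.

Definition torus_family : log_family k F c :=
  @LogFamily k n F 3 c (torus k) (torus_variety k) (fun j _ => mark_point j)
    (fun j => morphism_cst (torus_kalgebraic k) (mark_point j))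
    (fun i j _ ij e => elimN eqP ij (mark_point_inj e))
    ev_point ev_point_morphism ev_point_log_map.

End LogFamily.

(** * Projections and morphisms into products *)

Section ProductMorphisms.
Variable k : fieldType.
Implicit Types X Y Z : kspace k.

Lemma fst_morphism X Y (hX : kalgebraic X) (hY : kalgebraic Y) :
  morphism (fun z : kprod X Y => z.1 : X).
Proof.
have hA := prod_chart_rings hX hY; have oT := @openT Y.
have pre (U : set X) : open U ->
    (fun z : kprod X Y => z.1 : X) @^-1` U = @adom _ (prod_atlas X Y) (U, setT).
  by move=> oU; apply/seteqP; split=> z; [move=> Uz; split | case].
split; first by apply/continuousP => U oU; rewrite pre //; apply: (open_adom hA).
move=> U f oU Uf; rewrite pre //; apply: (regular_afun hA).
have := tensor1 (Q := regular Y setT) Uf (regular_cst hY 1 oT).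
by congr (tensor _ _ _); apply/funext => z; rewrite mulr1.
Qed.

Lemma snd_morphism X Y (hX : kalgebraic X) (hY : kalgebraic Y) :
  morphism (fun z : kprod X Y => z.2 : Y).
Proof.
have hA := prod_chart_rings hX hY; have oT := @openT X.
have pre (V : set Y) : open V ->
    (fun z : kprod X Y => z.2 : Y) @^-1` V = @adom _ (prod_atlas X Y) (setT, V).
  by move=> oV; apply/seteqP; split=> z; [move=> Vz; split | case].
split; first by apply/continuousP => V oV; rewrite pre //; apply: (open_adom hA).
move=> V f oV Vf; rewrite pre //; apply: (regular_afun hA).
have := tensor1 (P := regular X setT) (regular_cst hX 1 oT) Vf.
by congr (tensor _ _ _); apply/funext => z; rewrite mul1r.
Qed.

Lemma pair_morphism X Y Z (hZ : kalgebraic Z) (phi : Z -> X) (psi : Z -> Y) :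
  morphism phi -> morphism psi -> morphism (fun z => (phi z, psi z) : kprod X Y).
Proof.
move=> [/continuousP cphi rphi] [/continuousP cpsi rpsi].
pose f z : kprod X Y := (phi z, psi z).
have pre U V : open U -> open V ->
    f @^-1` (@adom _ (prod_atlas X Y) (U, V)) = phi @^-1` U `&` psi @^-1` V.
  by move=> oU oV; apply/seteqP; split=> z; [case | move=> [Uz Vz]; split].
have pre0 U V : ~ (open U /\ open V) -> f @^-1` (@adom _ (prod_atlas X Y) (U, V)) = set0.
  by move=> oUV; apply/seteqP; split=> z // [/= oU oV _ _]; apply: oUV.
apply: (morphism_glue (A := prod_atlas X Y) hZ) => -[U V].
  have [[oU oV]|oUV] := pselect (open U /\ open V).
    by rewrite pre //; apply: openI; [apply: cphi | apply: cpsi].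
  by rewrite pre0 //; exact: open0.
move=> a [N [g [h [gh ->]]]].
have [[oU oV]|oUV] := pselect (open U /\ open V); last first.
  by rewrite pre0 //; apply: regular_glue; [exact: open0 | move=> y []].
have oP : open (phi @^-1` U) by apply: cphi.
have oQ : open (psi @^-1` V) by apply: cpsi.
have oI := openI oP oQ; rewrite pre //.
apply: (regular_sum hZ oI (f := fun i z => g i (phi z) * h i (psi z))) => i.
have [gr hr] := gh i; apply: (regularM hZ oI).
  by apply: (regular_res oP oI) (rphi _ _ oU gr) => z [].
by apply: (regular_res oQ oI) (rpsi _ _ oV hr) => z [].
Qed.

End ProductMorphisms.

(** * Kummer extensions and algebraically closed fields *)

Section FieldFacts.

(** The derivative is an invertible multiple of a power of ['X], which is coprime to the polynomial
    as [a] is nonzero. *)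
Lemma separable_Xn_sub (K : fieldType) (N : nat) (a : K) :
  N%:R != 0 :> K -> a != 0 -> separable_poly ('X^N - a%:P).
Proof.
case: N => [|N] N0 a0; first by rewrite eqxx in N0.
rewrite unlock derivB derivC subr0 derivXn /= -scaler_nat.
rewrite coprimepZr // coprimep_expr //.
by rewrite coprimepX rootE !hornerE expr0n /= sub0r oppr_eq0.
Qed.

Lemma kummer_separable (K L : fieldType) (iota : {rmorphism K -> L}) (A : K) (u : L) N :
  iota A = u ^+ N -> N%:R != 0 :> K -> u != 0 ->
  exists q : {poly K}, root (map_poly iota q) u /\ separable_poly q.
Proof.
move=> iA N0 u0; exists ('X^N - A%:P); split.
  by rewrite rmorphB /= map_polyXn map_polyC rootE !hornerE ?hornerXn /= iA subrr.
by apply: separable_Xn_sub; rewrite // -(fmorph_eq0 iota) iA expf_neq0.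
Qed.

Lemma mpoly0_const (K : nzRingType) (P : {mpoly K[0]}) : P = (P@_0%MM)%:MP.
Proof.
apply/mpolyP => m; rewrite mcoeffC (_ : m = 0%MM) ?eqxx ?mulr1 //.
by apply/mnmP => -[].
Qed.

(** The transcendence basis is empty, so that K(b) is the image of [K]. *)
Lemma separably_generated_algebraic (K L : fieldType) (iota : {rmorphism K -> L}) :
  (forall x : L, exists P : {poly K}, separable_poly P /\ root (map_poly iota P) x) ->
  separably_generated iota.
Proof.
move=> alg; exists 0%N, (fun _ => 0); split.
  move=> P; rewrite [P in mmap _ _ P]mpoly0_const mmapC => /eqP; rewrite fmorph_eq0 => /eqP P0.
  by rewrite [P]mpoly0_const P0 mpolyC0.
move=> x; have [P [sepP Px]] := alg x; exists (map_poly iota P); split=> //.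
  move=> j; exists (P`_j)%:MP, 1%:MP; rewrite coef_map !mmapC /= rmorph1 divr1.
  by rewrite oner_neq0.
by rewrite separable_map.
Qed.

Lemma closed_field_large (k : closedFieldType) (N : nat) :
  exists s : seq k, uniq s /\ size s = N.
Proof.
elim: N => [|N [s [us ss]]]; first by exists [::].
have [|x _ hx] := @horner_nonzero k (\prod_(a <- s) ('X - a%:P)).
  by rewrite monic_neq0 // monic_prod_XsubC.
exists (x :: s); rewrite /= us ss; split=> //; rewrite andbT.
by move: hx; rewrite -[_ != 0]/(~~ root _ x) root_prod_XsubC.
Qed.

(** Supplies the scalars that the primitive element theorem asks for in [separable_generated]. *)
Lemma closed_field_nonroot (k : closedFieldType) (L : fieldType) (e : k -> L)
    (r : {poly L}) : injective e -> r != 0 -> exists t, ~~ root r (e t).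
Proof.
move=> e_inj r0; have [s [us ss]] := closed_field_large k (size r).
apply: contrapT => h; have := max_poly_roots r0 (rs := map e s).
rewrite size_map ss ltnn map_inj_uniq // us => H.
suff : false by []; apply: H => //; apply/allP => _ /mapP[t _ ->].
by apply: contraT => nr; case: h; exists t.
Qed.

Lemma closed_field_root (k : closedFieldType) (a : k) (e : int) : a != 0 -> e != 0 ->
  exists2 x, x != 0 & x ^ e = a.
Proof.
move=> a0 e0.
have nat_root N (b : k) : (0 < N)%N -> b != 0 -> exists2 x, x != 0 & x ^+ N = b.
  move=> N0 b0; have /closed_rootP[x] : size ('X^N - b%:P) != 1.
    by rewrite size_XnsubC // eqSS -lt0n.
  rewrite rootE !hornerE ?hornerXn subr_eq0 => /eqP xN; exists x => //.
  by apply: contraNneq b0 => x0; rewrite -xN x0 expr0n gtn_eqF.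
case: e e0 => e e0; first by have [||x x0 xe] := nat_root e a; [case: e e0 | | exists x].
have [//||x x0 xe] := nat_root e.+1 a^-1; first by rewrite invr_eq0.
by exists x => //; rewrite NegzE -exprnN xe invrK.
Qed.

End FieldFacts.

(** * Evaluation at two points *)

Section Evaluation.
Variables (k : closedFieldType) (n : nat) (F : fan n).
Variables (c : 'I_3 -> 'rV[int]_2) (s : 'I_3 -> {set 'I_n}).
Hypothesis sup : forall i, support_cone F (vecQ (c i)) (s i).
Hypothesis balance : c 0 + c 1 + c ord_max = 0.
Hypothesis det_neq0 : det2 (c 0) (c 1) != 0.

Local Notation X := (toric k F).
Local Notation XX := (kprod X X).
Local Notation W1 := (kprod (torus k) (P1 k)).
Local Notation W2 := (kprod W1 (P1 k)).
Local Notation fam := (torus_family sup balance : log_family k F c).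
Local Notation evp := (@ev_point k n F c s sup).

Let hX : kalgebraic X := toric_kalgebraic k F.
Let hT : kalgebraic (torus k) := torus_kalgebraic k.
Let hP : kalgebraic (P1 k) := P1_kalgebraic k.
Let hXX : kalgebraic XX := prod_kalgebraic hX hX.
Let hW1 : kalgebraic W1 := prod_kalgebraic hT hP.
Let hW2 : kalgebraic W2 := prod_kalgebraic hW1 hP.

Definition target_chart := prod_generic_chart hX hX
  (toric_chart k (empty_cone sup)) (toric_chart k (empty_cone sup)).
Definition source_chart := prod_generic_chart hW1 hP
  (prod_generic_chart hT hP (torus_chart k) (P1_chart k)) (P1_chart k).

Definition ev_pair (x : W2) : XX := (evp (x.1.1, x.1.2), evp (x.1.1, x.2)).

Lemma ev_pair_morphism : morphism ev_pair.
Proof.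
have f1 := fst_morphism hW1 hP; have f2 := snd_morphism hW1 hP.
have g1 := fst_morphism hT hP; have g2 := snd_morphism hT hP.
have h1 := morphism_comp f1 g1; have h2 := morphism_comp f1 g2.
have evm := @ev_point_morphism k n F c s sup balance.
exact: (pair_morphism hW2 (morphism_comp (pair_morphism hW2 h1 h2) evm)
  (morphism_comp (pair_morphism hW2 h1 f2) evm)).
Qed.

(** Surjectivity of the isogeny: by Cramer's rule, D-th roots of X0 and X1 raised to the entries of
    the adjugate of (c0, c1) solve the system. *)
Lemma solve_characters (X0 X1 : k) : X0 != 0 -> X1 != 0 ->
  exists al be : k, [/\ al != 0, be != 0 &
    forall m : 'rV[int]_2, al ^ pairing m (c 0) * be ^ pairing m (c 1) =
      X0 ^ m 0 0 * X1 ^ m 0 1].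
Proof.
move=> X00 X10; set D := det2 (c 0) (c 1).
have [A A0 AD] := closed_field_root X00 det_neq0.
have [B B0 BD] := closed_field_root X10 det_neq0.
exists (A ^ c 1 0 1 * B ^ (- c 1 0 0)), (A ^ (- c 0 0 1) * B ^ c 0 0 0).
split; rewrite ?mulf_neq0 ?expfz_neq0 // => m.
rewrite -AD -BD !expfzMl !exprz_exp mulrACA -!expfzDr //.
by congr (A ^ _ * B ^ _); rewrite /D det2E /pairing !big_ord_recl !big_ord0 /=;
  rewrite (_ : lift 0 0 = 1); [ring | exact: val_inj | ring | exact: val_inj].
Qed.

Lemma pairing_coords (m v : 'rV[int]_2) :
  pairing m v = m 0 0 * pairing std0 v + m 0 1 * pairing std1 v.
Proof.
have lift1 : lift 0 0 = 1 :> 'I_2 by exact: val_inj.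
by rewrite /pairing !big_ord_recl !big_ord0 lift1 !mxE /=; ring.
Qed.

(** The character [m] at the image of (x, y) under the isogeny (x, y) -> x^c0 y^c1. *)
Definition two_char (x y : k) (m : 'rV[int]_2) : k := x ^ pairing m (c 0) * y ^ pairing m (c 1).

Lemma two_charE x y m : x != 0 -> y != 0 ->
  two_char x y m = two_char x y std0 ^ m 0 0 * two_char x y std1 ^ m 0 1.
Proof.
move=> x0 y0; rewrite /two_char !expfzMl !exprz_exp mulrACA -!expfzDr //.
by rewrite (pairing_coords m (c 0)) (pairing_coords m (c 1)) ![_ * m 0 _]mulrC.
Qed.

Lemma two_char_neq0 x y m : x != 0 -> y != 0 -> two_char x y m != 0.
Proof. by move=> x0 y0; rewrite mulf_neq0 // expfz_neq0. Qed.

Definition tensor_toric := tensor (@toric_functions k n F) (@toric_functions k n F).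

(** Functions see a point only through its characters, so preimages under the evaluation are needed
    only up to equality of characters. *)
Lemma tensor_chi_ext (a : XX -> k) (u u' v v' : X) : tensor_toric a ->
  (forall m, chi m u = chi m u') -> (forall m, chi m v = chi m v') -> a (u, v) = a (u', v').
Proof.
move=> [N [f [g [fg ->]]]] uu' vv'; apply: eq_bigr => i _ /=.
have [[N1 [c1 [m1 [_ ->]]]] [N2 [c2 [m2 [_ ->]]]]] := fg i.
by congr (_ * _); apply: eq_bigr => j _; rewrite ?uu' ?vv'.
Qed.

(* The points z2 = (1 - be) / (al - be) and z1 = al z2 solve z1 / z2 = al and  *)
(* (z1 - 1) / (z2 - 1) = be.                                                   *)
Lemma ev_pair_hits (u v : X) (al be : k) : toric_torus u -> toric_torus v ->
  al != 0 -> be != 0 -> al != 1 -> be != 1 -> al != be ->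
  (forall m, chi m u = chi m v * (two_char al be m)) ->
  exists x : W2, [/\ toric_torus (ev_pair x).1, toric_torus (ev_pair x).2,
    forall m, chi m (ev_pair x).1 = chi m u & forall m, chi m (ev_pair x).2 = chi m v].
Proof.
move=> tu tv al0 be0 al1 be1 albe uv.
have d0 : al - be != 0 by rewrite subr_eq0.
have a1 : 1 - al != 0 by rewrite subr_eq0 eq_sym.
have b1 : 1 - be != 0 by rewrite subr_eq0 eq_sym.
pose z2 := (1 - be) / (al - be); pose z1 := al * z2.
have z20 : z2 != 0 by rewrite mulf_neq0 ?invr_eq0.
have z10 : z1 != 0 by rewrite mulf_neq0.
have z2m : z2 - 1 = (1 - al) / (al - be) by rewrite /z2; field.
have z1m : z1 - 1 = be * (z2 - 1) by rewrite z2m /z1 /z2; field.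
have z21 : z2 != 1 by rewrite -subr_eq0 z2m mulf_neq0 ?invr_eq0.
have z2m0 : z2 - 1 != 0 by rewrite subr_eq0.
have z11 : z1 != 1 by rewrite -subr_eq0 z1m mulf_neq0.
pose g := two_char z2 (z2 - 1).
have g0 m : g m != 0 by apply: two_char_neq0.
have w0 m : chi m v / g m != 0 by rewrite mulf_neq0 ?invr_eq0 // chi_torus_neq0.
(* The translate that sends z2 to [v]: w = v / (z2^c0 (z2 - 1)^c1). *)
pose w := torus_at (w0 std0) (w0 std1).
have gE m : g m = g std0 ^ m 0 0 * g std1 ^ m 0 1 by apply: two_charE.
have wE m : wpow w m = chi m v / g m.
  rewrite /wpow /w /= /torus_coords /= !expfzMl !exprz_inv mulrACA -chi_torusE //.
  by rewrite -!invr_expz -invfM -gE.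
exists ((w, Some z1), Some z2); split.
- exact: ev_point_torus.
- exact: ev_point_torus.
- move=> m; rewrite /= chi_ev_point (curve_char_generic sup m z10 z11) z1m wE uv.
  have -> : z1 ^ pairing m (c 0) * (be * (z2 - 1)) ^ pairing m (c 1) = two_char al be m * g m.
    by rewrite /z1 (expfzMl al z2) (expfzMl be) mulrACA.
  by move: (g0 m) => gm; field.
- move=> m; rewrite /= chi_ev_point (curve_char_generic sup m z20 z21) wE.
  by rewrite -/(two_char _ _ m) -/g divfK.
Qed.

(** Fix the second point [v] and move the first one along v al^c0 be^c1. The value of [a] is Laurent
    in al and be, and nonzero for the pair that gives [u]; hence it is nonzero for some pair with
    al, be and 1 distinct, which [ev_pair_hits] realizes. Dominance and the pull-back of function
    fields both rest on this. *)
Lemma ev_pair_generic (a : XX -> k) : tensor_toric a ->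
  nonzero_on [set z : XX | toric_torus z.1 /\ toric_torus z.2] a ->
  exists x : W2, [/\ toric_torus (ev_pair x).1, toric_torus (ev_pair x).2 & a (ev_pair x) != 0].
Proof.
move=> ta [[u v] /= [[tu tv] auv]].
have F0 := empty_cone sup.
have [al0 [be0 [al00 be00 Dab]]] := solve_characters
  (mulf_neq0 (chi_torus_neq0 std0 tu) (invr_neq0 (chi_torus_neq0 std0 tv)))
  (mulf_neq0 (chi_torus_neq0 std1 tu) (invr_neq0 (chi_torus_neq0 std1 tv))).
have uv0 m : chi m u = chi m v * (two_char al0 be0 m).
  rewrite /two_char Dab !expfzMl !exprz_inv mulrACA -(chi_torusE m tu) -!invr_expz -invfM.
  by rewrite -(chi_torusE m tv) mulrC divfK // chi_torus_neq0.
have pt_exists al be : al != 0 -> be != 0 -> exists u' : X, toric_torus u' /\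
    forall m, chi m u' = chi m v * (two_char al be m).
  move=> aln0 ben0.
  pose g m := chi m v * (two_char al be m).
  have g0 m : g m != 0 by rewrite mulf_neq0 ?two_char_neq0 // chi_torus_neq0.
  exists (torus_point F0 (g0 std0) (g0 std1)); split=> // m.
  by rewrite chi_torus_point /g (expfzMl (chi std0 v)) (expfzMl (chi std1 v)) mulrACA -chi_torusE // -two_charE.
have [H HE [l1 l2]] : exists2 H : k -> k -> k,
    forall u' al be, (forall m, chi m u' =
      chi m v * (two_char al be m)) -> a (u', v) = H al be
    & laurent2 H.
  have [N [f [g [fg Da]]]] := ta.
  have /choice[cm Hcm] : forall i, exists cm : {N1 : nat & (('I_N1 -> k) * ('I_N1 -> 'rV[int]_2))%type},
      f i = fun x => \sum_j (projT2 cm).1 j * chi ((projT2 cm).2 j) x.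
    move=> i; have [[N1 [c1 [m1 [_ ->]]]] _] := fg i.
    by exists (existT _ N1 (c1, m1)).
  exists (fun al be => \sum_i (\sum_j (projT2 (cm i)).1 j * (chi ((projT2 (cm i)).2 j) v *
     (two_char al be ((projT2 (cm i)).2 j)))) * g i v).
    move=> u' al be uu'; rewrite Da; apply: eq_bigr => i _ /=; rewrite Hcm.
    by congr (_ * _); apply: eq_bigr => j _; rewrite uu'.
  by split=> z z0; apply: laurent_sum => i; apply: laurentM; try exact: laurent_cst;
    apply: laurent_sum => j; apply: laurentM; try exact: laurent_cst; apply: laurentM;
    try exact: laurent_cst; apply: laurentM; try exact: laurent_cst; apply: laurentX.
pose H' (al be : k) := (al - 1) * (be - 1) * (al - be).
have lin d : laurent (fun x : k => x + d).
  by apply: laurentD; [exact: (laurentX k 1) | exact: laurent_cst].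
have lin' d : laurent (fun x : k => d - x).
  apply: laurentD; first exact: laurent_cst.
  apply: laurent_ext (laurentM (laurent_cst (-1)) (laurentX k 1)) => x _.
  by rewrite mulN1r.
have lH' : laurent2 H'.
  by split=> z z0; (apply: laurentM; last first; first by [apply: lin | apply: lin']);
    apply: laurentM; try exact: laurent_cst; apply: lin.
have [||al [be [al_neq0 be_neq0 Hab]]] := laurent2_nonzero2 (conj l1 l2) lH'.
- by exists al0, be0; split=> //; rewrite -(HE u).
- have [t [t0 t1]] := generic_parameter k.
  have [|t' t'0 ht'] := @horner_nonzero k (('X - 1%:P) * ('X - t%:P)).
    by rewrite mulf_neq0 // polyXsubC_eq0.
  move: ht'; rewrite !hornerE mulf_eq0 negb_or => /andP[t'1 t't].
  by exists t', t; split=> //; rewrite /H' !mulf_neq0 // subr_eq0.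
rewrite /H' !mulf_eq0 !negb_or !subr_eq0 => /andP[/andP[al1 be1] albe].
have [u' [tu' uu']] := pt_exists al be al_neq0 be_neq0.
have [x [t1 t2 std1' e2']] := ev_pair_hits tu' tv al_neq0 be_neq0 al1 be1 albe uu'.
exists x; split=> //.
by rewrite [ev_pair x]surjective_pairing (tensor_chi_ext ta std1' e2') (HE u' al be uu').
Qed.

Lemma ev_pair_dominant : dominant ev_pair.
Proof.
move=> O O0 oO; have [b [tb nb hb]] := gc_dense hXX target_chart oO O0.
have [x [t1 t2 bx]] := ev_pair_generic tb nb.
by exists (ev_pair x); split; [apply: hb | exists x].
Qed.

Let fX := gc_fd target_chart.
Let fW := gc_fd source_chart.
Local Notation E := [set z : XX | toric_torus z.1 /\ toric_torus z.2].
Local Notation D2 := [set z : W2 | [set z : W1 | [set: torus k] z.1 /\ A1_in_P1 z.2] z.1 /\ A1_in_P1 z.2].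
Local Notation R2 := (tensor (tensor (@torus_functions k) (@A1_functions k)) (@A1_functions k)).
Local Notation gf := (generic_fraction D2 R2).

Lemma pull_chart_regular a : tensor_toric a ->
  open (ev_pair @^-1` E) /\ regular W2 (ev_pair @^-1` E) (a \o ev_pair).
Proof.
move=> ta; have [/continuousP cev rev] := ev_pair_morphism.
have oE := gc_open target_chart; split; first exact: cev.
exact: (rev _ _ oE (gc_regular target_chart ta)).
Qed.

Lemma ev_pair_pull_fraction a : tensor_toric a -> gf (a \o ev_pair).
Proof.
move=> ta; have [oE ra] := pull_chart_regular ta.
have [|x [t1 t2 _]] := ev_pair_generic (fd_cst fX 1).
  exact: nonzero_on1 fX.
by apply: (regular_generic_fraction source_chart oE _ ra); exists x.
Qed.

Lemma ev_pair_pull_nonzero a : tensor_toric a -> nonzero_on E a -> exists h,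
  [/\ R2 h, nonzero_on D2 h & forall x, D2 x -> h x != 0 -> E (ev_pair x) /\ a (ev_pair x) != 0].
Proof.
move=> ta na; have [oE ra] := pull_chart_regular ta.
have [x [t1 t2 ax]] := ev_pair_generic ta na.
have oO := open_nonzero hW2 oE ra.
have [|h [Rh nh hO]] := gc_dense hW2 source_chart oO; first by exists x.
by exists h.
Qed.

Definition ev_pullback := pullback_rmorphism fW fX ev_pair_pull_fraction ev_pair_pull_nonzero.

Lemma ev_pullbackE f : generic_fraction E tensor_toric f ->
  ev_pullback (germ fX f) = germ fW (f \o ev_pair).
Proof.
exact: (@pullbackE _ _ _ _ _ _ _ fW fX ev_pair ev_pair_pull_fraction ev_pair_pull_nonzero f).
Qed.

Definition z1_of (x : W2) : k := P1_coord false x.1.2.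
Definition z2_of (x : W2) : k := P1_coord false x.2.
Definition w_of i (x : W2) : k := sval x.1.1 i.

Lemma R2_tensor f g h : torus_functions f -> A1_functions g -> A1_functions h ->
  R2 (fun x => f x.1.1 * g x.1.2 * h x.2).
Proof.
by move=> tf ag ah; apply: (tensor1 (f := fun z => f z.1 * g z.2) (g := h)) => //; apply: tensor1.
Qed.

Let one_T : @torus_functions k (fun=> 1) := fd_cst (torus_domain k) 1.
Let one_A : @A1_functions k (fun=> 1) := fd_cst (A1_domain k) 1.

Lemma A1_coord : A1_functions (P1_coord (k := k) false).
Proof. by exists 'X; apply/funext => z; rewrite hornerX. Qed.

Lemma z1_fraction : gf z1_of.
Proof.
apply: (generic_fraction_of fW); have := R2_tensor one_T A1_coord one_A.
by congr R2; apply/funext => x; rewrite mul1r mulr1.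
Qed.

Lemma z2_fraction : gf z2_of.
Proof.
apply: (generic_fraction_of fW); have := R2_tensor one_T one_A A1_coord.
by congr R2; apply/funext => x; rewrite !mul1r.
Qed.

Lemma cst_fraction d : gf (fun=> d).
Proof. exact: (generic_fraction_of fW (fd_cst fW d)). Qed.

(** Identities of rational functions on the source may be tested off the zeros of [q], that is for
    z1 and z2 finite, distinct and different from 0 and 1. *)
Lemma z_generic f g : (forall (w : torus k) (t u : k), t != 0 -> t != 1 -> u != 0 -> u != 1 ->
    t != u -> f ((w, Some t), Some u) = g ((w, Some t), Some u)) -> generic_eq D2 R2 f g.
Proof.
move=> fg; pose q (t u : k) := t * (t - 1) * (u * (u - 1) * (t - u)).
pose P : {poly k} := 'X * ('X - 1%:P).
exists (fun x => q (z1_of x) (z2_of x)); split.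
(* Expanding the factor t - u writes [q] as a sum of two pure tensors. *)
- have := @tensorD _ _ _ _ _ _ _
    (R2_tensor one_T (g := fun z => (P * 'X).[P1_coord false z])
       (h := fun z => P.[P1_coord false z]) (ex_intro _ _ erefl) (ex_intro _ _ erefl))
    (R2_tensor (fd_cst (torus_domain k) (-1)) (g := fun z => P.[P1_coord false z])
       (h := fun z => (P * 'X).[P1_coord false z]) (ex_intro _ _ erefl) (ex_intro _ _ erefl)).
  congr R2; apply/funext => x; rewrite /q /P /z1_of /z2_of /= !(hornerM, hornerD, hornerN, hornerX, hornerC).
  move: (P1_coord false x.1.2) (P1_coord false x.2) => t u; ring.
- have [t [t0 t1]] := generic_parameter k.
  have [|u u0 hu] := @horner_nonzero k (('X - 1%:P) * ('X - t%:P)).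
    by rewrite mulf_neq0 // polyXsubC_eq0.
  move: hu; rewrite !hornerE mulf_eq0 negb_or => /andP[u1 ut].
  exists ((torus_at (oner_neq0 k) (oner_neq0 k), Some t), Some u); split=> //=.
  by rewrite /q /z1_of /z2_of /= !mulf_neq0 // ?subr_eq0 // eq_sym -subr_eq0.
move=> [[w [t|]] [u|]] [[_ z1n] z2n] //; rewrite /q /z1_of /z2_of /=.
rewrite !mulf_eq0 !negb_or !subr_eq0 => /andP[/andP[t0 t1] /andP[/andP[u0 u1] tu]].
exact: fg.
Qed.

Lemma chi_toric (m : 'rV[int]_2) : @toric_functions k n F (chi m).
Proof.
rewrite /toric_functions toric_afunE; apply: sums_of1; exists 1, m.
by split; [exact: dual_set0 | apply/funext => x; rewrite mul1r].
Qed.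

Lemma chi1_fraction (m : 'rV[int]_2) : generic_fraction E tensor_toric (fun z => chi m z.1).
Proof.
apply: (generic_fraction_of fX); have := tensor1 (chi_toric m) (chi_toric 0).
by congr (tensor _ _ _); apply/funext => x; rewrite chi0 mulr1.
Qed.

Lemma chi2_fraction (m : 'rV[int]_2) : generic_fraction E tensor_toric (fun z => chi m z.2).
Proof.
apply: (generic_fraction_of fX); have := tensor1 (chi_toric 0) (chi_toric m).
by congr (tensor _ _ _); apply/funext => x; rewrite chi0 mul1r.
Qed.

Definition alpha_fun (x : W2) : k := z1_of x / z2_of x.
Definition beta_fun (x : W2) : k := (z1_of x - 1) / (z2_of x - 1).

Lemma sub1_fraction f : gf f -> gf (fun x => f x - 1).
Proof. by move=> hf; apply: (generic_fractionD fW hf); apply: cst_fraction. Qed.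

Lemma div_fraction f g : gf f -> gf g -> gf (fun x => f x / g x).
Proof. by move=> hf hg; apply: (generic_fractionM fW hf); apply: (generic_fractionV fW). Qed.

Lemma alpha_fraction : gf alpha_fun.
Proof. exact: (div_fraction z1_fraction z2_fraction). Qed.

Lemma beta_fraction : gf beta_fun.
Proof. exact: (div_fraction (sub1_fraction z1_fraction) (sub1_fraction z2_fraction)). Qed.

Lemma exp_fraction f N : gf f ->
  gf (fun x => f x ^+ N) /\ germ fW (fun x => f x ^+ N) = germ fW f ^+ N.
Proof.
move=> hf; elim: N => [|N [hN eN]].
  have -> : (fun x => f x ^+ 0) = fun=> 1 by apply/funext => x; rewrite expr0.
  by split; [exact: cst_fraction | rewrite germ1 expr0].
have -> : (fun x => f x ^+ N.+1) = fun x => f x * f x ^+ N by apply/funext => x; rewrite exprS.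
by split; [exact: (generic_fractionM fW) | rewrite germM // eN exprS].
Qed.

(** [f * f^-1] is generically 1; if [f] were generically 0 it would also be generically 0. *)
Lemma germ_neq0 f : gf f -> (forall (w : torus k) (t u : k), t != 0 -> t != 1 -> u != 0 -> u != 1 ->
    t != u -> f ((w, Some t), Some u) != 0) -> germ fW f != 0.
Proof.
move=> hf f0; have g0 : germ fW (fun=> 0) = 0 by exact: germE.
rewrite -g0; apply/eqP => /(germP fW hf (cst_fraction 0))[h [Rh nh hf0]].
have fV : generic_eq D2 R2 (fun x => f x * (f x)^-1) (fun=> 1).
  by apply: z_generic => w t u t0 t1 u0 u1 tu; rewrite divff // f0.
have f0eq : generic_eq D2 R2 (fun x => f x * (f x)^-1) (fun=> 0).
  by exists h; split=> // x Dx hx; rewrite hf0 // mul0r.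
have [h' [_ [x [Dx hx]] /(_ x Dx hx)/eqP]] :=
  generic_eq_trans fW (generic_eq_sym f0eq) fV.
by rewrite eq_sym oner_eq0.
Qed.

(* For [m] orthogonal to c1 (to c0), a power of alpha (of beta) is therefore a *)
(* rational function on the target.                                            *)
Lemma character_quotient (m : 'rV[int]_2) : exists2 A,
  generic_fraction E tensor_toric A &
  generic_eq D2 R2 (A \o ev_pair) (fun x => alpha_fun x ^ pairing m (c 0) * beta_fun x ^ pairing m (c 1)).
Proof.
exists (fun z => chi m z.1 * (chi m z.2)^-1).
  apply: (generic_fractionM fX (chi1_fraction m)).
  exact: (generic_fractionV fX (chi2_fraction m)).
apply: z_generic => w t u t0 t1 u0 u1 tu.
rewrite /alpha_fun /beta_fun /z1_of /z2_of /=.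
rewrite !chi_ev_point (curve_char_generic sup m t0 t1) (curve_char_generic sup m u0 u1).
rewrite (expfzMl t) (expfzMl (t - 1)) !exprz_inv -!invr_expz.
have a0 : u ^ pairing m (c 0) != 0 by rewrite expfz_neq0.
have b0 : (u - 1) ^ pairing m (c 1) != 0 by rewrite expfz_neq0 // subr_eq0.
have w0 := wpow_neq0 w m.
move: (t ^ _) ((t - 1) ^ _) (u ^ _) ((u - 1) ^ _) (wpow w m) a0 b0 w0 => a' b' a b v a0 b0 w0.
by field; rewrite a0 b0 w0.
Qed.

(** By [character_quotient], the N-th power of [f] is a pull-back A, so [f] is a root of X^N - A,
    which is separable because N is invertible in characteristic p. *)
Lemma kummer_root (p : nat) (hp : p \in [pchar k]) (f : W2 -> k) (m : 'rV[int]_2) (N : nat) :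
  gf f -> (forall (w : torus k) (t u : k), t != 0 -> t != 1 -> u != 0 -> u != 1 ->
    t != u -> f ((w, Some t), Some u) != 0) ->
  generic_eq D2 R2 (fun x => alpha_fun x ^ pairing m (c 0) * beta_fun x ^ pairing m (c 1))
    (fun x => f x ^+ N) ->
  ~~ (p %| N)%N ->
  exists q : {poly (function_field fX)}, root (map_poly ev_pullback q) (germ fW f) /\ separable_poly q.
Proof.
move=> hf f0 eqf pN; have [A hA eqA] := character_quotient m.
have [hN eN] := exp_fraction N hf.
have iA : ev_pullback (germ fX A) = germ fW f ^+ N.
  rewrite ev_pullbackE // -eN; apply/germP => //.
    exact: (generic_fraction_ext fW (generic_eq_sym eqA) (generic_fraction_ext fW (generic_eq_sym eqf) hN)).
  exact: (generic_eq_trans fW eqA eqf).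
apply: (kummer_separable iA); last exact: germ_neq0.
have natE M : M%:R = germ fX (fun=> M%:R) :> function_field fX.
    elim: M => [|M IHM]; first by symmetry; exact: germE.
    have cX d : generic_fraction E tensor_toric (fun=> d).
      exact: (generic_fraction_of fX (fd_cst fX d)).
    by rewrite -natr1 IHM -(germ1 fX) -(germD fX (cX _) (cX _)); congr germ;
      apply/funext => x; rewrite natr1.
  have cX d : generic_fraction E tensor_toric (fun=> d).
    exact: (generic_fraction_of fX (fd_cst fX d)).
have g0 : germ fX (fun=> 0) = 0 by exact: germE.
rewrite natE -g0.
  apply/eqP => /(germP fX (cX _) (cX _))[h [_ [x [Dx hx]] /(_ x Dx hx)/eqP]].
  by rewrite -(dvdn_pcharf hp) (negPf pN).
Qed.

Lemma alpha_neq0 (w : torus k) (t u : k) : t != 0 -> t != 1 -> u != 0 -> u != 1 ->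
  t != u -> alpha_fun ((w, Some t), Some u) != 0.
Proof. by move=> t0 _ u0 _ _; rewrite /alpha_fun /z1_of /z2_of /= mulf_neq0 ?invr_eq0. Qed.

Lemma beta_neq0 (w : torus k) (t u : k) : t != 0 -> t != 1 -> u != 0 -> u != 1 ->
  t != u -> beta_fun ((w, Some t), Some u) != 0.
Proof.
move=> _ t1 _ u1 _; rewrite /beta_fun /z1_of /z2_of /=.
by rewrite mulf_neq0 ?invr_eq0 ?subr_eq0.
Qed.

(** The rows of the adjugate of (c0, c1), multiplied by the sign of the determinant to make the
    exponent a natural number. *)
Lemma dual_vectors : exists m m' : 'rV[int]_2,
  [/\ pairing m (c 0) = absz (det2 (c 0) (c 1)), pairing m (c 1) = 0,
      pairing m' (c 0) = 0 & pairing m' (c 1) = absz (det2 (c 0) (c 1))].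
Proof.
set D := det2 (c 0) (c 1).
have pE (x y : int) v : pairing (\row_j (if j == 0 then x else y)) v = x * v 0 0 + y * v 0 1.
  rewrite /pairing !big_ord_recl big_ord0 addr0 !mxE /=.
  by rewrite (_ : lift 0 0 = 1) //; exact: val_inj.
have DD : Num.sg D * D = `|D|%N by rewrite abszE normrEsg.
exists (\row_j (if j == 0 then Num.sg D * c 1 0 1 else - (Num.sg D * c 1 0 0))).
exists (\row_j (if j == 0 then - (Num.sg D * c 0 0 1) else Num.sg D * c 0 0 0)).
by rewrite !pE -DD; move: (Num.sg D) => e; rewrite /D det2E; split; ring.
Qed.

(** * Generation of the source field by the target field, alpha and beta *)

Section Generation.
Variable S : function_field fW -> Prop.
Hypotheses (S_iota : forall u, S (ev_pullback u)).
Hypotheses (S_alpha : S (germ fW alpha_fun)) (S_beta : S (germ fW beta_fun)).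
Hypotheses (S_add : forall u v, S u -> S v -> S (u + v)).
Hypotheses (S_mul : forall u v, S u -> S v -> S (u * v)) (S_inv : forall u, S u -> S u^-1).

Definition germ_in (f : W2 -> k) : Prop := gf f /\ S (germ fW f).

Lemma germ_in_ext f g : generic_eq D2 R2 f g -> germ_in f -> germ_in g.
Proof.
move=> fg [hf Sf]; have hg := generic_fraction_ext fW fg hf; split=> //.
by have /(germP fW hf hg) <- := fg.
Qed.

Lemma germ_in_pull f : generic_fraction E tensor_toric f -> germ_in (f \o ev_pair).
Proof.
move=> hf; rewrite /germ_in -ev_pullbackE //; split=> //.
exact: (pull_generic_fraction fW ev_pair_pull_fraction ev_pair_pull_nonzero hf).
Qed.

Lemma germ_in_cst d : germ_in (fun=> d).
Proof. exact: (germ_in_pull (generic_fraction_of fX (fd_cst fX d))). Qed.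

Lemma germ_inD f g : germ_in f -> germ_in g -> germ_in (fun x => f x + g x).
Proof.
move=> [hf Sf] [hg Sg]; split; first exact: (generic_fractionD fW).
by rewrite germD //; apply: S_add.
Qed.

Lemma germ_inM f g : germ_in f -> germ_in g -> germ_in (fun x => f x * g x).
Proof.
move=> [hf Sf] [hg Sg]; split; first exact: (generic_fractionM fW).
by rewrite germM //; apply: S_mul.
Qed.

Lemma germ_inV f : germ_in f -> germ_in (fun x => (f x)^-1).
Proof.
move=> [hf Sf]; split; first exact: (generic_fractionV fW).
by rewrite germV //; apply: S_inv.
Qed.

Lemma germ_in_eq f g : f =1 g -> germ_in f -> germ_in g.
Proof. by move=> /funext ->. Qed.

Lemma germ_inX f N : germ_in f -> germ_in (fun x => f x ^+ N).
Proof.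
move=> Sf; elim: N => [|N IHN].
  by apply: germ_in_eq (germ_in_cst 1) => x; rewrite expr0.
by apply: germ_in_eq (germ_inM Sf IHN) => x; rewrite exprS.
Qed.

Lemma germ_inXz f (e : int) : germ_in f -> germ_in (fun x => f x ^ e).
Proof.
move=> Sf; case: e => N; first exact: germ_inX.
exact: (germ_inV (germ_inX N.+1 Sf)).
Qed.

Lemma germ_in_sum I (r : seq I) (f : I -> W2 -> k) : (forall i, germ_in (f i)) ->
  germ_in (fun x => \sum_(i <- r) f i x).
Proof.
move=> Sf; elim: r => [|i r IHr].
  by apply: germ_in_eq (germ_in_cst 0) => x; rewrite big_nil.
by apply: germ_in_eq (germ_inD (Sf i) IHr) => x; rewrite big_cons.
Qed.

Lemma germ_in_prod I (r : seq I) (f : I -> W2 -> k) : (forall i, germ_in (f i)) ->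
  germ_in (fun x => \prod_(i <- r) f i x).
Proof.
move=> Sf; elim: r => [|i r IHr].
  by apply: germ_in_eq (germ_in_cst 1) => x; rewrite big_nil.
by apply: germ_in_eq (germ_inM (Sf i) IHr) => x; rewrite big_cons.
Qed.

Lemma germ_in_horner (P : {poly k}) f : germ_in f -> germ_in (fun x => P.[f x]).
Proof.
move=> Sf; elim/poly_ind: P => [|P d IHP].
  by apply: germ_in_eq (germ_in_cst 0) => x; rewrite horner0.
apply: germ_in_eq (germ_inD (germ_inM IHP Sf) (germ_in_cst d)) => x.
by rewrite hornerMXaddC.
Qed.

Lemma germ_in_alpha : germ_in alpha_fun.
Proof. by split=> //; exact: alpha_fraction. Qed.

Lemma germ_in_beta : germ_in beta_fun.
Proof. by split=> //; exact: beta_fraction. Qed.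

Lemma germ_inB f g : germ_in f -> germ_in g -> germ_in (fun x => f x - g x).
Proof.
move=> Sf Sg; apply: germ_in_eq (germ_inD Sf (germ_inM (germ_in_cst (-1)) Sg)) => x.
by rewrite mulN1r.
Qed.

(** This is z2 = (1 - be) / (al - be), the formula of [ev_pair_hits]. *)
Lemma germ_in_z2 : germ_in z2_of.
Proof.
have := germ_inM (germ_inB (germ_in_cst 1) germ_in_beta)
                 (germ_inV (germ_inB germ_in_alpha germ_in_beta)).
apply: germ_in_ext; apply: z_generic => w t u t0 t1 u0 u1 tu.
rewrite /alpha_fun /beta_fun /z1_of /z2_of /=.
have u1' : u - 1 != 0 by rewrite subr_eq0.
have tu' : u - t != 0 by rewrite subr_eq0 eq_sym.
have -> : t / u - (t - 1) / (u - 1) = (u - t) / (u * (u - 1)) by field; rewrite u0 u1'.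
by field; rewrite u0 u1' tu'.
Qed.

Lemma germ_in_z1 : germ_in z1_of.
Proof.
apply: germ_in_ext (germ_inM germ_in_alpha germ_in_z2).
by apply: z_generic => w t u t0 t1 u0 u1 tu; rewrite /alpha_fun divfK.
Qed.

(** Dividing the value at z1 by z1^c0 (z1 - 1)^c1 isolates the translation w. *)
Lemma germ_in_wpow m : germ_in (fun x => wpow x.1.1 m).
Proof.
have z11 := germ_inB germ_in_z1 (germ_in_cst 1).
have := germ_inM (germ_in_pull (chi1_fraction m))
  (germ_inV (germ_inM (germ_inXz (pairing m (c 0)) germ_in_z1)
                      (germ_inXz (pairing m (c 1)) z11))).
apply: germ_in_ext; apply: z_generic => w t u t0 t1 u0 u1 tu.
rewrite /= /z1_of /= chi_ev_point (curve_char_generic sup m t0 t1) mulfK //.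
by rewrite mulf_neq0 // expfz_neq0 // subr_eq0.
Qed.

Lemma germ_in_w i : germ_in (w_of i).
Proof.
have w0 : germ_in (w_of 0).
  apply: germ_in_eq (germ_in_wpow std0) => x; by rewrite /wpow !mxE /= expr1z expr0z mulr1.
have w1 : germ_in (w_of 1).
  apply: germ_in_eq (germ_in_wpow std1) => x; by rewrite /wpow !mxE /= expr1z expr0z mul1r.
case: i => [[|[|[|//]]] hi].
- by rewrite (_ : Ordinal hi = 0) //; apply: val_inj.
- by rewrite (_ : Ordinal hi = 1) //; apply: val_inj.
rewrite (_ : Ordinal hi = ord_max); last by apply: val_inj.
apply: germ_in_eq (germ_inV (germ_inM w0 w1)) => x.
by rewrite /w_of (torus_coordsE x.1.1).
Qed.

Lemma germ_in_ring a : R2 a -> germ_in a.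
Proof.
move=> [N [f [g [fg ->]]]]; apply: germ_in_sum => i; have [tf [P Dg]] := fg i.
apply: germ_inM; last first.
  by rewrite Dg; apply: (germ_in_horner P germ_in_z2).
have [N' [f' [g' [fg' ->]]]] := tf; apply: germ_in_sum => j.
have [[Q ->] [P' ->]] := fg' j; apply: germ_inM; last exact: (germ_in_horner P' germ_in_z1).
apply: (germ_in_eq (f := fun x => \sum_(m <- msupp Q) Q@_m * \prod_i w_of i x ^+ m i)).
  by move=> x; rewrite mevalE.
apply: germ_in_sum => m; apply: germ_inM; first exact: germ_in_cst.
by apply: germ_in_prod => l; apply: germ_inX; apply: germ_in_w.
Qed.

Lemma source_field_generated (u : function_field fW) : S u.
Proof.
have [f hf ->] := germ_surj u; have [a [b [Ra Rb nb fab]]] := hf.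
suff [] : germ_in f by [].
apply: germ_in_ext (germ_inM (germ_in_ring Ra) (germ_inV (germ_in_ring Rb))).
by exists b; split=> // x Dx bx; rewrite fab.
Qed.

End Generation.

(** Alpha and beta are |D|-th roots of pulled-back functions, with p not dividing D = det(c0, c1),
    and they generate the source field, so [separable_generated] applies to every element. *)
Lemma ev_pair_separable (p : nat) (hp : p \in [pchar k]) :
  ~~ (p%:Z %| det2 (c 0%R) (c 1%R))%Z -> separable_morphism ev_pair.
Proof.
move=> pD; exists (function_field fX), (function_field fW), (fun _ f => germ fX f),
  (fun _ f => germ fW f), ev_pullback; split.
- exact: (chart_function_field hXX target_chart).
- exact: (chart_function_field hW2 source_chart).
- move=> V f oV V0 Vf; apply: ev_pullbackE.
  exact: (regular_generic_fraction target_chart oV V0 Vf).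
apply: separably_generated_algebraic => x.
have [m [m' [m0 m1 m'0 m'1]]] := dual_vectors.
have pN : ~~ (p %| `|det2 (c 0%R) (c 1%R)|)%N := pD.
have [|qa [qa0 sqa]] := kummer_root (m := m) hp alpha_fraction alpha_neq0 _ pN.
  by apply: z_generic => w t u *; rewrite m0 m1 expr0z mulr1.
have [|qb [qb0 sqb]] := kummer_root (m := m') hp beta_fraction beta_neq0 _ pN.
  by apply: z_generic => w t u *; rewrite m'0 m'1 expr0z mul1r.
have cX d : generic_fraction E tensor_toric (fun=> d).
  exact: (generic_fraction_of fX (fd_cst fX d)).
(* The constants make the target field infinite. *)
have large (r : {poly function_field fW}) : r != 0 -> exists t, ~~ root r (ev_pullback t).
  move=> r0; have inj : injective (fun d => ev_pullback (germ fX (fun=> d))).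
    move=> d d' /fmorph_inj/(germP fX (cX _) (cX _))[h [_ [y [Dy hy]] /(_ y Dy hy)]].
    exact.
  by have [t ht] := closed_field_nonroot inj r0; exists (germ fX (fun=> t)).
apply: (separable_generated qa0 sqa qb0 sqb large) => S Si Sa Sb SD SM SV.
exact: source_field_generated.
Qed.

End Evaluation.

Theorem theorem1p3 (k : closedFieldType) (p : nat) (hp : p \in [pchar k])
    (n : nat) (F : fan n) (hF : complete_fan F)
    (m : 'I_n -> option nat) (hm : forall i, m i <> Some 0%N)
    (hnklt : ~ klt m)
    (hcones : forall i : 'I_n, exists j l : 'I_n,
       [/\ j != l, [set j; l]%SET \in cones F, i \notin [set j; l]%SET &
           smooth_pair (gen F j) (gen F l) \/ tame_pair p (gen F j) (gen F l)]) :
  separably_campana_rationally_connected k F m.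
Proof.
have p_prime : prime p by case/andP: hp.
have [c [s [camp sup bal pD]]] := campana_contact_exists p_prime m hF hcones.
have D0 : det2 (c 0) (c 1) != 0 by apply: contraNneq pD => ->; rewrite dvdz0.
exists 3, c; split=> //; exists (torus_family k sup bal); split.
  exact (ev_pair_dominant sup D0).
exact (ev_pair_separable sup bal D0 hp pD).
Qed.
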